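(* Let $U\subset\mathbb{C}$ be a bounded domain and let $K$ be a compact subset of $U$. Then there exist a constant $C$, depending only on $d(K,\partial U)$ and the diameter of $U$, and a number $\varepsilon_0>0$ such that for every $0<\varepsilon<\varepsilon_0$ and every domain $W\subset\mathbb{C}$ with $K\subseteq W$ and $H(\partial U,\partial W)\le\varepsilon$, one has $$|\lambda_U(w)-\lambda_W(w)|\le \frac{C}{\log(\log(1/\varepsilon))}\qquad\text{for all } w\in K.$$
   Context: All distances are Euclidean. For sets $A,B\subset\mathbb{C}$, $d(A,B)=\inf_{z\in A,\,w\in B}|z-w|$, and the Hausdorff distance is $H(A,B)=\inf\{r>0: A\subseteq N_r(B)\text{ and }B\subseteq N_r(A)\}$, where $N_r(A)$ is the set of points whose distance from $A$ is less than $r$. Boundaries in $H$ and $d$ are taken in $\mathbb{C}$. For a domain $A\subset\mathbb{C}$ whose boundary in the Riemann sphere has at least 3 points, and $z\in A$, the Teichmüller density is $$\lambda_A(z)=\inf_{V\in\mathcal{T}}\|\bar\partial V\|_\infty ,$$ where $\|\cdot\|_\infty$ is the $L^\infty$ norm, $\bar\partial V=\frac{\partial V}{\partial\bar w}=\frac12\left(\frac{\partial V}{\partial x}+i\frac{\partial V}{\partial y}\right)$, and $\mathcal{T}$ is the family of all complex-valued functions $V(w)$ on $A$ with $V(z)=1$, which vanish on $\partial A$, and which have distributional derivatives. Here $V$ is regarded as a (continuous) vector field vanishing on the boundary of $A$: $V$ is continuous and extends continuously by $0$ to the finite boundary points of $A$, and if $A$ is unbounded, vanishing at the boundary point $\infty$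 means $V(w)=o(|w|^2)$ as $w\to\infty$ in $A$. *)

(* Defs.v *)
From HB Require Import structures.
From mathcomp Require Import all_boot all_order all_algebra.
From mathcomp Require Import complex.
From mathcomp Require Import all_classical all_reals all_analysis.

Set Implicit Arguments.
Unset Strict Implicit.
Unset Printing Implicit Defensive.

Import Order.TTheory GRing.Theory Num.Theory numFieldNormedType.Exports.

Local Open Scope classical_set_scope.
Local Open Scope complex_scope.
Local Open Scope ring_scope.

(* The complex numbers are R[i]; the regular module R[i]^o carries the usual
   topology, given by the modulus.  That modulus takes its values in R[i], so
   the R-valued Normc.normc (z |-> sqrt (x^2 + y^2)) is used for distances.
   Lebesgue measure and real differentiation live on R * R, which is
   identified with the complex plane through the following map. *)
Definition toC (R : realType) (p : R * R) : R[i]^o := p.1 +i* p.2.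

Definition leb2 (R : realType) :
    {measure set (measurableTypeR R * measurableTypeR R) -> \bar R} :=
  (@lebesgue_measure R \x @lebesgue_measure R)%E.
Arguments leb2 R : clear implicits.
Arguments toC R p : clear implicits.

Section euclidean_plane.
Variable R : realType.
Implicit Types (A B : set R[i]^o) (z w : R[i]^o).

Definition domain A := [/\ open A, connected A & A !=set0].

Definition boundary A := closure A `\` interior A.

(* Extended-real infima and suprema: distances to the empty set are +oo. *)
Definition set_dist A B : \bar R :=
  ereal_inf [set (Normc.normc (z - w))%:E | z in A & w in B].

Definition diam A : \bar R :=
  ereal_sup [set (Normc.normc (z - w))%:E | z in A & w in A].

Definition nbhd (r : R) A : set R[i]^o :=
  [set z | (set_dist [set z] A < r%:E)%E].

Definition hausdorff_dist A B : \bar R :=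
  ereal_inf [set r%:E | r in
    [set r : R | [/\ 0 < r, A `<=` nbhd r B & B `<=` nbhd r A]]].

End euclidean_plane.

Section distributional_derivatives.
Variable R : realType.
Implicit Types (A : set R[i]^o) (V P F : R[i]^o -> R[i]^o).
Implicit Types (phi : R * R -> R) (v : R * R).

Fixpoint iter_derive (s : seq (R * R)) phi : R * R -> R :=
  if s is v :: s' then fun p => 'D_v (iter_derive s' phi) p else phi.

Definition smooth phi := forall s p, differentiable (iter_derive s phi) p.

Definition test_function A phi :=
  smooth phi /\
  exists L : set R[i]^o,
    [/\ compact L, L `<=` A & forall p, ~ L (toC R p) -> phi p = 0].

Definition locally_integrable2 A F :=
  forall L : set R[i]^o, compact L -> L `<=` A ->
    (leb2 R).-integrable (toC R @^-1` L) (fun p => (complex.Re (F (toC R p)))%:E) /\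
    (leb2 R).-integrable (toC R @^-1` L) (fun p => (complex.Im (F (toC R p)))%:E).

(* P is the distributional derivative of V in the direction v on A.  Testing
   the real and imaginary parts against real test functions is the same as
   testing against complex ones. *)
Definition distr_derivative A v V P :=
  locally_integrable2 A P /\
  forall phi, test_function A phi ->
    (\int[leb2 R]_(p in toC R @^-1` A) (complex.Re (V (toC R p)) * 'D_v phi p))
      = - (\int[leb2 R]_(p in toC R @^-1` A) (complex.Re (P (toC R p)) * phi p))
    /\
    (\int[leb2 R]_(p in toC R @^-1` A) (complex.Im (V (toC R p)) * 'D_v phi p))
      = - (\int[leb2 R]_(p in toC R @^-1` A) (complex.Im (P (toC R p)) * phi p)).

Definition dbar_of (Vx Vy : R[i]^o -> R[i]^o) : R[i]^o -> R[i]^o :=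
  fun w => 2^-1 * (Vx w + 'i%C * Vy w).

(* F represents dbar V on A. *)
Definition is_dbar A V F :=
  exists Vx Vy, [/\ distr_derivative A (1, 0) V Vx,
                    distr_derivative A (0, 1) V Vy & F = dbar_of Vx Vy].

Definition Linf_norm A F : \bar R :=
  'N[leb2 R]_+oo[ (fun p => (Normc.normc (F (toC R p)))%:E) \_ (toC R @^-1` A) ].

End distributional_derivatives.

Section teichmuller_density.
Variable R : realType.
Implicit Types (A : set R[i]^o) (z w : R[i]^o) (V : R[i]^o -> R[i]^o).

(* Only the values of V on A matter.  The condition at infinity is vacuous
   when A is bounded. *)
Definition vanishes_on_boundary A V :=
  (forall b, boundary A b -> V w @[w --> within A (nbhs b)] --> (0 : R[i]^o)) /\
  (forall e : R, 0 < e -> \forall M \near +oo%R, forall w, A w ->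
     M <= Normc.normc w -> Normc.normc (V w) <= e * Normc.normc w ^+ 2).

Definition teichmuller_family A z : set (R[i]^o -> R[i]^o) :=
  [set V : R[i]^o -> R[i]^o | [/\ V z = 1, {within A, continuous V}, vanishes_on_boundary A V
             & exists F, is_dbar A V F]].

(* Distributional derivatives are unique up to null sets, so V determines
   Linf_norm A F.  The intended use is for domains A that contain z and have at
   least three boundary points in the Riemann sphere; the formula itself makes
   sense for all A. *)
Definition teichmuller_density A z : \bar R :=
  ereal_inf [set m | exists V F,
    [/\ teichmuller_family A z V, is_dbar A V F & m = Linf_norm A F]].

End teichmuller_density.

(* Main.v *)
Require Import Defs.
From HB Require Import structures.
From mathcomp Require Import all_boot all_order all_algebra.
From mathcomp Require Import complex.
From mathcomp Require Import all_classical all_reals all_analysis.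
From mathcomp Require Import measurable_realfun ring lra.
Set Implicit Arguments.
Unset Strict Implicit.
Unset Printing Implicit Defensive.
Import Order.TTheory GRing.Theory Num.Theory numFieldNormedType.Exports.
Local Open Scope classical_set_scope.
Local Open Scope ring_scope.

(* Let [V] be a competitor for [A] with [|dbar V| <= M], extended by 0 outside [A].

   The bound on [dbar V] persists on the whole plane, whatever the boundary of [A]: cut [V] off
   where [|V|] is of size [s]; since [|grad V|^2] is twice the Jacobian up to [O(M^2)], and the
   cut off Jacobian is a divergence, the energy of [V] on [{|V| ~ s}] is bounded
   independently of [s] and the cutoff error tends to 0 with the measure of that set.

   The difference of the averages of [V] at scales [r] and [2 r] is a pairing with [dbar V], hence
   [O(M r)].  The growth condition [o(|z|^2)] then makes [V] complex affine at unit scale up to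
   [O(M)], and two zeros of [V] at distance [d] bound the slope.  Summing over the scales,
   [|V(z) - V(b)| <= C M |z - b| log(1 / |z - b|)].

   Finally multiply [V] by a function which is 1 away from the complement of [A], vanishes within
   about [eps] of it, and at distance [4^-k] has gradient [4^k / k], divided by
   [sum 1/k ~ log log (1/eps)].  The product is a competitor for every [B] whose boundary is [eps]-close to that of
   [A], with [|dbar| <= M (1 + C / log log (1/eps))]; exchange [A] and [B]. *)

(** * Integration on the plane *)

Section plane_integral.
Variable R : realType.
Implicit Types (f g : R * R -> R) (p z : R * R).

Local Notation plane := (measurableTypeR R * measurableTypeR R)%type.

(** Closeness of the boundaries says little about [W]: it may be the plane minus a finite net of the
    boundary of [U]. So [W] can be unbounded, neither domain need contain the other, and the
    boundaries may have any shape and positive area. A competitor is therefore studied through its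
    extension by zero alone, by averages at all dyadic scales, without any regularity of the domain.
    The growth condition rules out fields like z^2 and two finite zeros rule out the affine ones.
    The zeros are taken where a horizontal line through the point [w] of [K] leaves [U], or at
    nearby boundary points of [W]; this keeps all constants dependent on the distance and the
    diameter only. A field with bounded dbar is only log-Lipschitz, so a cutoff made at a single
    scale r would cost log(1/r) in the dbar norm. The weights 1/k make each transition cost a
    constant, and the division by the harmonic sum makes the cost small. The comparison is
    multiplicative; it becomes additive because a cut off constant field bounds both densities in
    terms of the distance from [K] to the boundary of [U]. *)

Lemma ballXE (p : R * R) (r : R) :
  ball p r = (ball p.1 r `*` ball p.2 r) :> set (R * R).
Proof. by []. Qed.

Lemma measurable_ballX (p : R * R) (r : R) : measurable (ball p r : set plane).
Proof.
rewrite ballXE; apply: measurableX; rewrite ball_itv; exact: measurable_itv.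
Qed.

(** The plane carries the product sigma-algebra, so Borel sets have to be reached through squares:
    those with rational centre and radius 1/(n+1) that lie in [A] cover it. The norm of [R * R] is
    the sup norm, and its balls are squares throughout. *)
Lemma open_measurable2 (A : set (R * R)) : open A -> measurable (A : set plane).
Proof.
move=> oA.
pose F (i : rat * rat * nat) : set (R * R) :=
  if `[< ball (ratr i.1.1 : R, ratr i.1.2 : R) (i.2.+1%:R^-1) `<=` A >]
  then ball (ratr i.1.1 : R, ratr i.1.2 : R) (i.2.+1%:R^-1) else set0.
have -> : A = \bigcup_i F i.
  apply/seteqP; split => [p Ap|p [i _]]; last first.
    by rewrite /F; case: ifPn => [/asboolP|//]; exact.
  have /nbhs_ballP[e /= e0 eA] : nbhs p A by exact: open_nbhs_nbhs.
  have [n _ /(_ _ (leqnn _)) ne] :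
      \forall n \near \oo, n.+1%:R^-1 < e / 2 :> R.
    have e20 : 0 < e / 2 by rewrite divr_gt0.
    exact: (near_infty_natSinv_lt (PosNum e20)).
  have n0 : 0 < n.+1%:R^-1 :> R by rewrite invr_gt0.
  have rx (x d : R) : 0 < d -> exists q : rat, `|ratr q - x| < d.
    move=> d0; have xx : x - d < x + d by lra.
    have [q] := rat_in_itvoo xx.
    rewrite in_itv /= => ?; exists q; rewrite ltr_norml; lra.
  have [q1 h1] := rx p.1 _ n0; have [q2 h2] := rx p.2 _ n0.
  exists ((q1, q2), n) => //; rewrite /F /=.
  move: n0 ne h1 h2; set d := n.+1%:R^-1 => n0 ne h1 h2.
  have -> : `[< ball (ratr q1 : R, ratr q2 : R) d `<=` A >].
    apply/asboolP => z [/= z1 z2]; apply: eA; split => /=.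
      move: z1 h1 ne; rewrite /ball /= !ltr_norml.
      by move=> /andP[? ?] /andP[? ?] ?; apply/andP; split; lra.
    move: z2 h2 ne; rewrite /ball /= !ltr_norml.
    by move=> /andP[? ?] /andP[? ?] ?; apply/andP; split; lra.
  by split.
apply: countable_bigcupT_measurable => [|i]; first exact: countableP.
by rewrite /F; case: ifP => // _; exact: measurable_ballX.
Qed.

Lemma closed_measurable2 (A : set (R * R)) : closed A -> measurable (A : set plane).
Proof. by move/closed_openC/open_measurable2/measurableC; rewrite setCK. Qed.

Lemma continuous_measurable2 f : continuous f ->
  measurable_fun [set: plane] (f : plane -> measurableTypeR R).
Proof.
move=> /continuousP cf; apply: (measurability _ (RGenOpens.measurableE R)).
move=> _ [_ [a [b ->] <-]]; rewrite setTI; apply: open_measurable2.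
exact/cf/interval_open.
Qed.

Lemma leb2_ball p (r : R) : 0 <= r -> leb2 R (ball p r) = ((2 * r) ^+ 2)%:E.
Proof.
move=> r0; rewrite ballXE.
have mb (x : R) : measurable (ball x r : set (measurableTypeR R)).
  by rewrite ball_itv; exact: measurable_itv.
apply: (etrans (product_measure1E (@lebesgue_measure R) (@lebesgue_measure R)
  (mb p.1) (mb p.2))).
rewrite (_ : (((2 * r) ^+ 2)%:E = (r *+ 2)%:E * (r *+ 2)%:E)%E); last first.
  by rewrite -EFinM expr2 mulr_natl.
by congr (_ * _)%E; exact: lebesgue_measure_ball.
Qed.

Definition I2 f : R := \int[leb2 R]_p f p.

(** Bounded, measurable, compactly supported: integrability is automatic in this class, and it
    absorbs multiplication by locally bounded functions ([lbm] below). *)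
Definition bcs f := measurable_fun [set: plane] (f : plane -> measurableTypeR R) /\
  exists M r, forall p, `|f p| <= M /\ (r < `|p| -> f p = 0).

Lemma bcs_bound f : measurable_fun [set: plane] (f : plane -> measurableTypeR R) ->
  forall z M r, 0 <= r -> (forall p, `|f p| <= M) -> (forall p, ~ ball z r p -> f p = 0) ->
  (leb2 R).-integrable [set: plane] (EFin \o f) /\ `|I2 f| <= M * (2 * r) ^+ 2.
Proof.
move=> mf z M r r0 fM f0.
have mb := measurable_ballX z r.
have ib : (leb2 R).-integrable (ball z r : set plane) (EFin \o f).
  apply: measurable_bounded_integrable => //.
  - by rewrite leb2_ball// ltry.
  - by apply: measurable_funS mf.
  - exists M; split; first exact: num_real.
    by move=> x Mx p _; apply: le_trans (fM p) (ltW Mx).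
have fE : f = f \_ (ball z r : set plane).
  apply/funext => p; rewrite patchE; case: ifPn => // /negP pz.
  by apply: f0 => bp; apply: pz; exact/mem_set.
have iT : (leb2 R).-integrable [set: plane] (EFin \o f).
  rewrite fE -restrict_EFin; apply/integrable_restrict => //.
  by rewrite setTI.
split=> //; rewrite /I2 fE -Rintegral_mkcond.
apply: le_trans (le_normr_Rintegral _ _) _ => //.
have -> : M * (2 * r) ^+ 2 = \int[leb2 R]_(p in ball z r) M.
  by rewrite Rintegral_cst// leb2_ball.
apply: le_Rintegral => //.
- exact: integrable_norm.
- apply: measurable_bounded_integrable => //.
  - by rewrite leb2_ball// ltry.
  - exists M; split; first exact: num_real.
    move=> x Mx p _; rewrite /= ger0_norm ?(ltW Mx)//.
    exact: le_trans (normr_ge0 _) (fM p).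
Qed.

Lemma bcs_integrable f : bcs f -> (leb2 R).-integrable [set: plane] (EFin \o f).
Proof.
move=> [mf [M [r fMr]]].
have [] // := bcs_bound mf (z := 0) (r := `|r| + 1) (M := M).
- by move=> p; have [] := fMr p.
- move=> p pb; have [_] := fMr p; apply; rewrite ltNge; apply/negP => pr.
  apply: pb; rewrite -ball_normE /= sub0r normrN.
  by apply: le_lt_trans pr _; rewrite ltr_pwDr// ler_norm.
Qed.

Lemma I2D f g : bcs f -> bcs g -> I2 (fun p => f p + g p) = I2 f + I2 g.
Proof. by move=> /bcs_integrable ? /bcs_integrable ?; exact: RintegralD. Qed.

Lemma I2B f g : bcs f -> bcs g -> I2 (fun p => f p - g p) = I2 f - I2 g.
Proof. by move=> /bcs_integrable ? /bcs_integrable ?; exact: RintegralB. Qed.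

Lemma I2Z k f : bcs f -> I2 (fun p => k * f p) = k * I2 f.
Proof. by move=> /bcs_integrable ?; exact: RintegralZl. Qed.

Lemma I2_ge0 f : (forall p, 0 <= f p) -> 0 <= I2 f.
Proof. by move=> f0; exact: Rintegral_ge0. Qed.

Lemma I2_le f g : bcs f -> bcs g -> (forall p, f p <= g p) -> I2 f <= I2 g.
Proof. by move=> /bcs_integrable ? /bcs_integrable ? ?; exact: le_Rintegral. Qed.

Lemma I2_abs f : bcs f -> `|I2 f| <= I2 (fun p => `|f p|).
Proof. by move=> /bcs_integrable ?; exact: le_normr_Rintegral. Qed.

Lemma eq_I2 f g : f =1 g -> I2 f = I2 g.
Proof. by move=> fg; congr I2; apply/funext. Qed.

Definition lbm f := measurable_fun [set: plane] (f : plane -> measurableTypeR R) /\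
  forall r, exists M, forall p, `|p| <= r -> `|f p| <= M.

Lemma bcs_lbm f : bcs f -> lbm f.
Proof. by move=> [mf [M [r h]]]; split => // r'; exists M => p _; have [] := h p. Qed.

Lemma lbm_cst c : lbm (cst c).
Proof. by split; [exact: measurable_cst|move=> r; exists `|c|]. Qed.

Lemma lbmD f g : lbm f -> lbm g -> lbm (fun p => f p + g p).
Proof.
move=> [mf hf] [mg hg]; split; first exact: measurable_funD.
move=> r; have [M1 h1] := hf r; have [M2 h2] := hg r; exists (M1 + M2) => p pr.
by apply: le_trans (ler_normD _ _) _; apply: lerD; [exact: h1|exact: h2].
Qed.

Lemma lbmM f g : lbm f -> lbm g -> lbm (fun p => f p * g p).
Proof.
move=> [mf hf] [mg hg]; split; first exact: measurable_funM.
move=> r; have [M1 h1] := hf r; have [M2 h2] := hg r; exists (M1 * M2) => p pr.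
by rewrite normrM; apply: ler_pM => //; [exact: h1|exact: h2].
Qed.

Lemma lbm_abs f : lbm f -> lbm (fun p => `|f p|).
Proof.
move=> [mf hf]; split; first exact: measurableT_comp.
by move=> r; have [M h] := hf r; exists M => p /h; rewrite normr_id.
Qed.

Lemma bcsMl f g : bcs f -> lbm g -> bcs (fun p => f p * g p).
Proof.
move=> bf lg; have [m _] := lbmM (bcs_lbm bf) lg; split => //.
have [_ [M1 [r h1]]] := bf; have [_ /(_ r) [M2 h2]] := lg.
exists (M1 * `|M2|), r => p; have [h3 h4] := h1 p.
have [pr|pr] := leP `|p| r.
  split; last by [].
  rewrite normrM; apply: ler_pM => //.
  by apply: le_trans (h2 _ pr) _; exact: ler_norm.
by rewrite h4// mul0r normr0; split => //; apply: mulr_ge0 => //; exact: le_trans h3.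
Qed.

Lemma bcsMr f g : lbm f -> bcs g -> bcs (fun p => f p * g p).
Proof.
move=> lf bg; have := bcsMl bg lf.
by congr bcs; apply/funext => p; rewrite mulrC.
Qed.

Lemma bcsZ k f : bcs f -> bcs (fun p => k * f p).
Proof. by move=> bf; apply: bcsMr => //; exact: lbm_cst. Qed.

Lemma bcsD f g : bcs f -> bcs g -> bcs (fun p => f p + g p).
Proof.
move=> bf bg; have [m _] := lbmD (bcs_lbm bf) (bcs_lbm bg); split => //.
have [_ [M1 [r1 h1]]] := bf; have [_ [M2 [r2 h2]]] := bg.
exists (M1 + M2), (Num.max r1 r2) => p.
have [a1 b1] := h1 p; have [a2 b2] := h2 p; split.
  by apply: le_trans (ler_normD _ _) _; apply: lerD.
by rewrite gt_max => /andP[/b1 -> /b2 ->]; rewrite addr0.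
Qed.

Lemma bcsN f : bcs f -> bcs (fun p => - f p).
Proof.
move=> /(bcsZ (- 1)); congr bcs; apply/funext => p; by rewrite mulN1r.
Qed.

Lemma bcsB f g : bcs f -> bcs g -> bcs (fun p => f p - g p).
Proof. by move=> bf /bcsN; exact: bcsD. Qed.

Lemma bcs_abs f : bcs f -> bcs (fun p => `|f p|).
Proof.
move=> bf; have [m _] := lbm_abs (bcs_lbm bf); split => //.
have [_ [M [r h]]] := bf; exists M, r => p; rewrite normr_id.
by have [a b] := h p; split => // /b ->; rewrite normr0.
Qed.

Lemma compact_closed_ball2 (r : R) : compact [set p : R * R | `|p| <= r].
Proof.
have -> : [set p : R * R | `|p| <= r] = (`[- r, r] `*` `[- r, r])%classic.
  apply/seteqP; split => [p|p []] /=.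
    by rewrite prod_normE /= ge_max !in_itv /= -!ler_norml => /andP[].
  by rewrite prod_normE /= ge_max !in_itv /= -!ler_norml => -> ->.
by apply: compact_setX; exact: segment_compact.
Qed.

Lemma continuous_lbm f : continuous f -> lbm f.
Proof.
move=> cf; split; first exact: continuous_measurable2.
move=> r.
have /compact_bounded[M [_ h]] : compact (f @` [set p : R * R | `|p| <= r]).
  apply: continuous_compact; last exact: compact_closed_ball2.
  exact: continuous_subspaceT.
exists (M + 1) => p pr; apply: (h (M + 1)); first by rewrite ltrDl.
by exists p.
Qed.

Lemma bcs_continuous f r : continuous f -> (forall p, r < `|p| -> f p = 0) -> bcs f.
Proof.
move=> /continuous_lbm[mf /(_ r)[M h]] f0; split => //; exists `|M|, r => p; split; last exact: f0.
have [/h pr|/f0 ->] := leP `|p| r; last by rewrite normr0.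
exact: le_trans pr (ler_norm _).
Qed.

End plane_integral.

(** * Smooth functions *)

Section smoothness.
Variables (R : realType) (T : normedModType R).
Implicit Types (f g : T -> R) (p v : T).

(** Stability under products, inverses and composition is an induction on a finite order, which
    [smooth] does not offer directly. The domain is an arbitrary normed module, so that functions of
    one and of two real variables are treated together. *)
Fixpoint Ck n f : Prop := (forall p, differentiable f p) /\
  if n is m.+1 then forall v, Ck m (fun p => 'D_v f p) else True.

Lemma Ck_diff n f : Ck n f -> forall p, differentiable f p.
Proof. by case: n => [|n] []. Qed.

Lemma CkS n f : Ck n.+1 f -> Ck n f.
Proof.
elim: n f => [|n IH] f /= [df h]; split => // v.
exact/IH/h.
Qed.

Lemma Ck_cst n c : Ck n (fun=> c).
Proof.
elim: n c => [|n IH] c /=; split => // v.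
under eq_fun do rewrite derive_cst; exact: IH.
Qed.

Lemma Ck_add n f g : Ck n f -> Ck n g -> Ck n (fun p => f p + g p).
Proof.
elim: n f g => [|n IH] f g hf hg /=; split => //.
- by move=> p; apply: differentiableD;
  [exact: Ck_diff hf _|exact: Ck_diff hg _].
- by move=> p; apply: differentiableD; [exact: Ck_diff hf _|exact: Ck_diff hg _].
move=> v; have -> : (fun p => 'D_v (fun p => f p + g p) p) =
    (fun p => 'D_v f p + 'D_v g p).
  apply/funext => p; rewrite -deriveD//; apply: diff_derivable;
  [exact: Ck_diff hf _|exact: Ck_diff hg _].
apply: IH; [exact: (proj2 hf)|exact: (proj2 hg)].
Qed.

Lemma Ck_mul n f g : Ck n f -> Ck n g -> Ck n (fun p => f p * g p).
Proof.
elim: n f g => [|n IH] f g hf hg /=; split => //.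
- by move=> p; apply: differentiableM;
  [exact: Ck_diff hf _|exact: Ck_diff hg _].
- by move=> p; apply: differentiableM; [exact: Ck_diff hf _|exact: Ck_diff hg _].
move=> v; have -> : (fun p => 'D_v (fun p => f p * g p) p) =
    (fun p => f p * 'D_v g p + g p * 'D_v f p).
  apply/funext => p; rewrite (@deriveM _ _ f g)//; apply: diff_derivable;
  [exact: Ck_diff hf _|exact: Ck_diff hg _].
apply: Ck_add; apply: IH.
- exact: CkS.
- exact: (proj2 hg).
- exact: CkS.
- exact: (proj2 hf).
Qed.

Lemma Ck_inv n f : (forall p, f p != 0) -> Ck n f -> Ck n (fun p => (f p)^-1).
Proof.
move=> f0; elim: n f f0 => [|n IH] f f0 hf /=; split => //.
- by move=> p; apply: differentiableV => //; exact: Ck_diff hf _.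
- by move=> p; apply: differentiableV => //; exact: Ck_diff hf _.
move=> v; have -> : (fun p => 'D_v (fun p => (f p)^-1) p) =
    (fun p => (- 1) * (((f p)^-1 * (f p)^-1) * 'D_v f p)).
  apply/funext => p; rewrite (@deriveV _ _ f)//.
    by rewrite /GRing.scale /= expr2 invfM; ring.
  by apply: diff_derivable; exact: Ck_diff hf _.
apply: Ck_mul; first exact: Ck_cst.
apply: Ck_mul; last exact: (proj2 hf).
by apply: Ck_mul; apply: IH => //; exact: CkS.
Qed.

Lemma derive_comp1 (g : R -> R) f p v : differentiable f p ->
  differentiable g (f p) -> 'D_v (fun q => g (f q)) p = 'D_v f p * 'D_1 g (f p).
Proof.
move=> df dg; rewrite deriveE; last exact: differentiable_comp.
rewrite (diff_comp df dg) /= (deriveE v df) (deriveE (1 : R^o) dg).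
rewrite -[RHS]/('d f p v *: ('d g (f p) 1)) -linearZ.
by rewrite /GRing.scale /= mulr1.
Qed.
End smoothness.

Lemma Ck_comp (R : realType) (T : normedModType R) n (g : R -> R) (f : T -> R) :
  Ck n g -> Ck n f -> Ck n (fun p => g (f p)).
Proof.
elim: n f g => [|n IH] f g hg hf /=; split => //.
- move=> p; apply: (@differentiable_comp _ _ _ _ f g);
  [exact: Ck_diff hf _|exact: Ck_diff hg _].
- move=> p; apply: (@differentiable_comp _ _ _ _ f g);
  [exact: Ck_diff hf _|exact: Ck_diff hg _].
move=> v; have -> : (fun p => 'D_v (fun p => g (f p)) p) =
    (fun p => 'D_v f p * 'D_1 g (f p)).
  apply/funext => p; apply: derive_comp1;
  [exact: Ck_diff hf _|exact: Ck_diff hg _].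
apply: Ck_mul; first exact: (proj2 hf).
apply: (IH f (fun x => 'D_1 g x)); first exact: (proj2 hg).
exact: CkS.
Qed.

Definition sm (R : realType) (T : normedModType R) (f : T -> R) := forall n, Ck n f.

Section smooth_class.
Variables (R : realType) (T : normedModType R).
Implicit Types (f g : T -> R) (p v : T).

Lemma sm_diff f : sm f -> forall p, differentiable f p.
Proof. by move=> /(_ 0%N) /=[]. Qed.

Lemma sm_derivable f : sm f -> forall p v, derivable f p v.
Proof. by move=> sf p v; exact/diff_derivable/sm_diff. Qed.

Lemma sm_cont f : sm f -> continuous f.
Proof. by move=> sf p; exact/differentiable_continuous/sm_diff. Qed.

Lemma smD f v : sm f -> sm (fun p => 'D_v f p).
Proof. by move=> sf n; have [_] := sf n.+1; exact. Qed.

Lemma sm_cst c : sm (fun _ : T => c). Proof. by move=> n; exact: Ck_cst. Qed.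

Lemma sm_add f g : sm f -> sm g -> sm (fun p => f p + g p).
Proof. by move=> sf sg n; exact: Ck_add. Qed.

Lemma sm_mul f g : sm f -> sm g -> sm (fun p => f p * g p).
Proof. by move=> sf sg n; exact: Ck_mul. Qed.

Lemma sm_opp f : sm f -> sm (fun p => - f p).
Proof.
move=> sf; have := sm_mul (sm_cst (- 1)) sf.
by congr sm; apply/funext => p; rewrite mulN1r.
Qed.

Lemma sm_sub f g : sm f -> sm g -> sm (fun p => f p - g p).
Proof. by move=> sf /sm_opp; exact: sm_add. Qed.

Lemma sm_inv f : (forall p, f p != 0) -> sm f -> sm (fun p => (f p)^-1).
Proof. by move=> f0 sf n; exact: Ck_inv. Qed.

Lemma sm_comp (g : R -> R) f : sm g -> sm f -> sm (fun p => g (f p)).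
Proof. by move=> sf sg n; exact: Ck_comp. Qed.

Lemma sm_sum (I : Type) (s : seq I) (F : I -> T -> R) :
  (forall i, sm (F i)) -> sm (fun p => \sum_(i <- s) F i p).
Proof.
move=> sF; elim: s => [|i s IH].
  by under eq_fun do rewrite big_nil; exact: sm_cst.
by under eq_fun do rewrite big_cons; exact: sm_add.
Qed.

Lemma sm_lin (L : {linear T -> R}) : continuous L -> sm L.
Proof.
move=> cL [|n] /=; split => //; first by move=> p; exact: linear_differentiable.
  by move=> p; exact: linear_differentiable.
move=> v; have -> : (fun p => 'D_v L p) = fun=> L v; last exact: Ck_cst.
apply/funext => p; rewrite deriveE ?diff_lin//; exact: linear_differentiable.
Qed.

Lemma DD f g p v : sm f -> sm g -> 'D_v (fun p => f p + g p) p = 'D_v f p + 'D_v g p.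
Proof. by move=> sf sg; rewrite -deriveD//; exact: sm_derivable. Qed.

Lemma DM f g p v : sm f -> sm g ->
  'D_v (fun p => f p * g p) p = f p * 'D_v g p + g p * 'D_v f p.
Proof. by move=> sf sg; rewrite (@deriveM _ _ f g)//; exact: sm_derivable. Qed.

Lemma DZ k f p v : sm f -> 'D_v (fun p => k * f p) p = k * 'D_v f p.
Proof. by move=> sf; rewrite DM//; [rewrite derive_cst mulr0 addr0|exact: sm_cst]. Qed.

Lemma DN f p v : sm f -> 'D_v (fun p => - f p) p = - 'D_v f p.
Proof. by move=> sf; rewrite (@deriveN _ _ _ f)//; exact: sm_derivable. Qed.

Lemma DB f g p v : sm f -> sm g -> 'D_v (fun p => f p - g p) p = 'D_v f p - 'D_v g p.
Proof. by move=> sf sg; rewrite DD ?DN//; exact: sm_opp. Qed.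

Lemma Dcomp (g : R -> R) f p v : sm f -> sm g ->
  'D_v (fun q => g (f q)) p = 'D_v f p * 'D_1 g (f p).
Proof. by move=> sf sg; apply: derive_comp1; [exact: (sm_diff sf)|exact: (Ck_diff (sg 0%N))]. Qed.

Lemma Dsum (I : Type) (s : seq I) (F : I -> T -> R) p v : (forall i, sm (F i)) ->
  'D_v (fun p => \sum_(i <- s) F i p) p = \sum_(i <- s) 'D_v (F i) p.
Proof.
move=> sF; elim: s => [|i s IH].
  by under eq_fun do rewrite big_nil; rewrite big_nil derive_cst.
under eq_fun do rewrite big_cons; rewrite DD ?big_cons ?IH//; exact: sm_sum.
Qed.
End smooth_class.

Section smooth_plane.
Variable R : realType.
Implicit Types (f g : R * R -> R) (p v z : R * R).

Lemma sm_fst : sm (fun p : R * R => p.1).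
Proof.
by apply: (@sm_lin R (R * R)%type fst) => p; exact: cvg_fst.
Qed.

Lemma sm_snd : sm (fun p : R * R => p.2).
Proof.
by apply: (@sm_lin R (R * R)%type snd) => p; exact: cvg_snd.
Qed.

Lemma Dfst p v : 'D_v (fun p : R * R => p.1) p = v.1.
Proof.
rewrite deriveE; last exact: sm_diff sm_fst _.
rewrite (@diff_lin R (R * R)%type R fst)// => q; exact: cvg_fst.
Qed.

Lemma Dsnd p v : 'D_v (fun p : R * R => p.2) p = v.2.
Proof.
rewrite deriveE; last exact: sm_diff sm_snd _.
rewrite (@diff_lin R (R * R)%type R snd)// => q; exact: cvg_snd.
Qed.

Lemma iter_derive_rcons s v f :
  iter_derive (rcons s v) f = iter_derive s (fun p => 'D_v f p).
Proof. by elim: s => //= w s ->. Qed.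

Lemma sm_smooth f : sm f -> smooth f.
Proof.
move=> sf s; have : sm (iter_derive s f) by elim: s => //= v s; exact: smD.
exact: sm_diff.
Qed.

Lemma smooth_sm f : smooth f -> sm f.
Proof.
move=> sf n; elim: n f sf => [|n IH] f sf /=; split => //; try exact: (sf [::]).
by move=> v; apply: IH => s p; rewrite -iter_derive_rcons; exact: sf.
Qed.

Lemma derive_affine f z (k : R) p v : differentiable f (k *: (p - z)) ->
  differentiable (fun q => f (k *: (q - z))) p /\
  'D_v (fun q => f (k *: (q - z))) p = k * 'D_v f (k *: (p - z)).
Proof.
move=> df; pose h (q : R * R) : R * R := k *: (q - z).
have dh : differentiable h p by apply: differentiableZ; apply: differentiableB.
have dfh : differentiable (f \o h) p by exact: differentiable_comp.
split => //; rewrite (deriveE v dfh) (diff_comp dh df) /=.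
rewrite (_ : 'd h p v = k *: v); last first.
  by rewrite -(deriveE v dh) /h deriveZ// (@deriveB _ _ _ id (cst z))// derive_id derive_cst subr0.
rewrite (deriveE v df) -[RHS]/(k *: 'd f (k *: (p - z)) v) -linearZ //.
Qed.

Lemma sm_affine f z k : sm f -> sm (fun p => f (k *: (p - z))).
Proof.
move=> sf n; elim: n f sf => [|n IH] f sf.
  by split; [move=> p; exact: (derive_affine 0 (sm_diff sf _)).1|exact: I].
split; first by move=> p; exact: (derive_affine 0 (sm_diff sf _)).1.
move=> v; have -> : (fun p => 'D_v (fun q => f (k *: (q - z))) p) =
    fun p => k * 'D_v f (k *: (p - z)).
  by apply/funext => p; apply: (derive_affine _ _).2; exact: sm_diff.
apply: Ck_mul; first exact: Ck_cst.
by apply: (IH (fun p => 'D_v f p)); exact: smD.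
Qed.

End smooth_plane.

Section calculus_plane.
Variable R : realType.
Implicit Types (f g : R * R -> R) (p q v z : R * R).

Lemma derive_line f p v t :
  'D_1 (fun s : R => f (p + s *: v)) t = 'D_v f (p + t *: v).
Proof.
rewrite /derive; congr (lim (_ @ 0^')); apply/funext => h /=.
by rewrite scalerDl addrCA [h *: 1]mulr1.
Qed.

Lemma derivable_line f p v t : derivable f (p + t *: v) v ->
  derivable (fun s : R => f (p + s *: v)) t 1.
Proof.
move=> H; rewrite /derivable.
have -> : (fun h : R => h^-1 *: (((fun s : R => f (p + s *: v)) \o shift t) (h *: 1)
      - f (p + t *: v))) =
    (fun h => h^-1 *: ((f \o shift (p + t *: v)) (h *: v) - f (p + t *: v))).
  by apply/funext => h /=; rewrite scalerDl addrCA [h *: 1]mulr1.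
exact: H.
Qed.

Lemma derive_linear f p u v (a b : R) : differentiable f p ->
  'D_(a *: u + b *: v) f p = a * 'D_u f p + b * 'D_v f p.
Proof.
by move=> df; rewrite !deriveE// linearD !linearZ.
Qed.

Lemma derive_coord f p v : differentiable f p ->
  'D_v f p = v.1 * 'D_(1, 0) f p + v.2 * 'D_(0, 1) f p.
Proof.
move=> df; rewrite -(derive_linear _ _ _ _ df); congr derive; case: v => x y.
by congr pair; rewrite /= /GRing.scale /= !(mulr0, mulr1) ?addr0 ?add0r.
Qed.

Lemma supp_derive f z (r : R) v : (forall p, r < `|p - z| -> f p = 0) ->
  forall p, r < `|p - z| -> 'D_v f p = 0.
Proof.
move=> f0 p rp; rewrite -(derive_cst (0 : R) p v); apply: near_eq_derive.
have : \forall q \near p, r < `|q - z|.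
  have cf : continuous (fun q => `|q - z|).
    move=> x; apply: cvg_norm; apply: cvgB => //; exact: cvg_cst.
  by have H := cvgr_gt _ (cf p); exact: (H _ r rp).
by apply: filterS => q /f0 ->.
Qed.

Lemma supp_derive0 f (r : R) v : (forall p, r < `|p| -> f p = 0) ->
  forall p, r < `|p| -> 'D_v f p = 0.
Proof.
move=> f0 p rp; apply: (@supp_derive _ 0 r) => [q|]; rewrite subr0//; exact: f0.
Qed.

Local Open Scope ereal_scope.
Lemma integral_derive1_eq0 (F : R -> R) (r : R) : (0 < r)%R ->
  (forall x, derivable F x 1) -> continuous (fun x => 'D_1 F x) ->
  (forall x, r <= `|x| -> F x = 0)%R ->
  \int[lebesgue_measure]_x ('D_1 F x)%:E = 0.
Proof.
move=> r0 dF cF F0.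
have -> : (fun x => ('D_1 F x)%:E) = (fun x => ('D_1 F x)%:E) \_ `[(- r - 1)%R, (r + 1)%R].
  apply/funext => x; rewrite patchE; case: ifPn => // /negP xr.
  suff -> : 'D_1 F x = 0%R by [].
  rewrite -(derive_cst (0 : R)%R x (1 : R)%R); apply: near_eq_derive.
  have rx : (r < `|x|)%R.
    rewrite ltNge; apply/negP => /ler_normlP[? ?]; apply: xr.
    by rewrite inE /= in_itv /=; apply/andP; split; lra.
  have : \forall q \near x, (r < `|q|)%R.
    by have H := cvgr_gt _ (@norm_continuous _ _ x); exact: (H _ r rx).
  by apply: filterS => q rq; rewrite F0// ltW.
rewrite -integral_mkcond.
have cFF : continuous F by move=> x; apply: differentiable_continuous; apply/derivable1_diffP; exact: dF.
rewrite (@continuous_FTC2 _ (fun x => 'D_1 F x)%R F).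
- rewrite !F0 ?subee// ler_normr; apply/orP; first by right; lra.
  by left; lra.
- by lra.
- exact: continuous_subspaceT.
- split => //.
  + by apply: cvg_at_right_filter; exact: cFF.
  + by apply: cvg_at_left_filter; exact: cFF.
- by move=> x _; rewrite derive1E.
Qed.
Local Close Scope ereal_scope.

(** Fubini and the fundamental theorem of calculus on lines, first for the two coordinate
    directions. The integrations by parts for smooth functions come from here. *)
Lemma int_D f (r : R) v : sm f -> (forall p, r < `|p| -> f p = 0) ->
  I2 (fun p => 'D_v f p) = 0.
Proof.
move=> sf f0.
have bf w : bcs (fun p => 'D_w f p).
  by apply: (@bcs_continuous R (fun p => 'D_w f p) r); [apply: sm_cont; exact: smD|move=> p; exact: supp_derive0].
have cD w : continuous (fun p => 'D_w f p) by apply: sm_cont; exact: smD.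
have lineE (p w : R * R) : `|w| = 1 ->
    (\int[lebesgue_measure]_s ('D_w f (p + s *: w))%:E = 0)%E.
  move=> w1.
  under eq_integral do rewrite -derive_line.
  apply: (@integral_derive1_eq0 (fun s : R => f (p + s *: w)) (`|r| + `|p| + 1)).
  - by rewrite ltr_wpDl// addr_ge0.
  - by move=> x; apply: derivable_line; exact: sm_derivable.
  - under eq_fun do rewrite derive_line.
    move=> x; apply: (@continuous_comp _ _ _ (fun s : R => p + s *: w) (fun q => 'D_w f q) x);
      last exact: cD.
    by apply: cvgD; [exact: cvg_cst|apply: cvgZr_tmp; exact: cvg_id].
  - move=> x hx; apply: f0; rewrite addrC.
    apply: lt_le_trans (lerB_normD _ _); rewrite normrZ w1 mulr1.
    have := ler_norm r; lra.
have h1 : I2 (fun p => 'D_(1, 0) f p) = 0.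
  rewrite /I2 /Rintegral.
  have := integral21_prod_meas1 (bcs_integrable (bf (1, 0))) => <-.
  rewrite (eq_integral (cst 0%E)) ?integral0// => y _.
  rewrite /fubini_G /= -[RHS](lineE (0, y) (1, 0)).
    apply: eq_integral => s _; rewrite (_ : (0, y) + s *: (1, 0) = (s, y))//.
    by congr pair; rewrite /= /GRing.scale /= ?mulr1 ?mulr0 ?addr0 ?add0r.
  by rewrite prod_normE /= normr0 normr1; exact: max_l.
have h2 : I2 (fun p => 'D_(0, 1) f p) = 0.
  rewrite /I2 /Rintegral.
  have := integral12_prod_meas1 (bcs_integrable (bf (0, 1))) => <-.
  rewrite (eq_integral (cst 0%E)) ?integral0// => x _.
  rewrite /fubini_F /= -[RHS](lineE (x, 0) (0, 1)).
    apply: eq_integral => s _; rewrite (_ : (x, 0) + s *: (0, 1) = (x, s))//.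
    by congr pair; rewrite /= /GRing.scale /= ?mulr1 ?mulr0 ?addr0 ?add0r.
  by rewrite prod_normE /= normr0 normr1; exact: max_r.
rewrite (eq_I2 (fun p => derive_coord v (sm_diff sf p))).
rewrite (I2D (bcsZ v.1 (bf _)) (bcsZ v.2 (bf _))) (I2Z _ (bf _)) (I2Z _ (bf _)).
by rewrite h1 h2 !mulr0 addr0.
Qed.

Lemma mvt_line f p w (h : R) : sm f -> 0 < h ->
  exists2 x, 0 < x < h & f (p + h *: w) - f p = h * 'D_w f (p + x *: w).
Proof.
move=> sf h0.
have dl (x : R) : is_derive x (1 : R) (fun s : R => f (p + s *: w)) ('D_w f (p + x *: w)).
  apply: DeriveDef; last exact: derive_line.
  by apply: derivable_line; exact: sm_derivable.
have [|x] := @MVT R (fun s : R => f (p + s *: w)) (fun s => 'D_w f (p + s *: w)) 0 h h0 (fun x _ => dl x).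
  apply: continuous_subspaceT => x; apply: differentiable_continuous.
  by apply/derivable1_diffP; have [] := dl x.
by rewrite in_itv /= scale0r addr0 subr0 => ? ->; exists x; rewrite // mulrC.
Qed.

Lemma mvt_plane f (C : R) p q : sm f ->
  (forall t : R, 0 <= t <= 1 -> `|'D_(1, 0) f (p + t *: (q - p))| <= C) ->
  (forall t : R, 0 <= t <= 1 -> `|'D_(0, 1) f (p + t *: (q - p))| <= C) ->
  `|f q - f p| <= 2 * C * `|q - p|.
Proof.
move=> sf h1 h2; set w := q - p.
have [x /andP[x0 x1]] := mvt_line p w sf ltr01.
rewrite scale1r mul1r (_ : p + w = q); last by rewrite addrC subrK.
move=> ->; rewrite (derive_coord _ (sm_diff sf _)).
have x01 : 0 <= x <= 1 by rewrite !ltW.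
apply: le_trans (ler_normD _ _) _; rewrite (normrM w.1) (normrM w.2).
have w1 : `|w.1| <= `|w| by rewrite [X in _ <= X]prod_normE le_max lexx.
have w2 : `|w.2| <= `|w| by rewrite [X in _ <= X]prod_normE le_max lexx orbT.
have -> : 2 * C * `|w| = `|w| * C + `|w| * C by ring.
by apply: lerD; apply: ler_pM => //; [exact: h1|exact: h2].
Qed.

End calculus_plane.

(** * Convolution *)

(** A way to differentiate without computing a limit: subtract the expected tangent and bound the
    rest quadratically. It serves convolutions and the flat functions at 0. *)
Lemma quadratic_differentiable (R : realType) (T : normedModType R) (g : T -> R) (z : T) (C : R) :
  (forall p, `|p - z| <= 1 -> `|g p| <= C * `|p - z| ^+ 2) ->
  differentiable g z /\ forall v, 'D_v g z = 0.
Proof.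
move=> gC.
have gz : g z = 0.
  have := gC z; rewrite subrr normr0 expr0n /= mulr0 => /(_ ler01).
  by rewrite normr_le0 => /eqP.
have H : g \o shift z = cst (g z) + \0 +o_ (0 : T) id.
  apply/eqaddoP => _/posnumP[e]; near=> h.
  rewrite [X in `|X|](_ : _ = g (h + z)); last first.
    by rewrite -[LHS]/(g (h + z) - (g z + 0)) gz addr0 subr0.
  have h1 : `|h| <= 1 by near: h; exact: nbhs0_le.
  apply: le_trans (gC _ _) _; rewrite ?addrK// expr2 mulrA.
  apply: ler_wpM2r => //.
  have hC : `|h| <= e%:num / (`|C| + 1) by near: h; apply: nbhs0_le; rewrite divr_gt0// ltr_wpDl.
  have C0 : 0 < `|C| + 1 by rewrite ltr_wpDl.
  apply: (@le_trans _ _ ((`|C| + 1) * `|h|)); last by rewrite mulrC -ler_pdivlMr.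
  by apply: ler_wpM2r => //; apply: le_trans (ler_norm _) _; rewrite lerDl.
have d0 : 'd g z = \0 :> (T -> R).
  apply: (@diff_unique _ _ _ g (\0 : {linear T -> R})) => //; exact: cst_continuous.
have dg : differentiable g z.
  by apply/diff_locallyP; rewrite d0; split => //; exact: cst_continuous.
by split => // v; rewrite deriveE// d0.
Unshelve. all: by end_near. Qed.

Section convolution.
Variable R : realType.
Implicit Types (f g m : R * R -> R) (p q v z : R * R) (r : R).

Definition csm r m := sm m /\ forall p, r < `|p| -> m p = 0.

(** The kernel is translated but not reflected, so a derivative in [z] falls on [m] with a minus
    sign. *)
Definition conv f m z : R := I2 (fun q => f q * m (q - z)).

Lemma csmD r m v : csm r m -> csm r (fun p => 'D_v m p).
Proof. by move=> [sm0 m0]; split; [exact: smD|move=> p; exact: supp_derive0]. Qed.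

Lemma csm_bcs r m : csm r m -> bcs m.
Proof. by move=> [sm0 m0]; apply: bcs_continuous m0; exact: sm_cont. Qed.

Lemma csm_bounded r m : csm r m -> exists2 C, 0 <= C & forall p, `|m p| <= C.
Proof.
move=> /csm_bcs[_ [M [s h]]]; exists `|M| => // p; have [h1 _] := h p.
exact: le_trans h1 (ler_norm _).
Qed.

Lemma sm_shift m z : sm m -> sm (fun q => m (q - z)).
Proof.
move=> sm0; have := sm_affine z 1 sm0; congr sm; apply/funext => q.
by rewrite scale1r.
Qed.

Lemma D_shift m z v p : sm m -> 'D_v (fun q => m (q - z)) p = 'D_v m (p - z).
Proof.
move=> sm0; have [_] := @derive_affine _ m z 1 p v (sm_diff sm0 _).
have -> : (fun q => m (1 *: (q - z))) = (fun q => m (q - z)).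
  by apply/funext => q; rewrite scale1r.
by rewrite mul1r scale1r.
Qed.

Lemma csm_shift r m z : csm r m -> csm (r + `|z|) (fun q => m (q - z)).
Proof.
move=> [sm0 m0]; split => [|p rp]; first exact: sm_shift.
apply: m0; have := lerB_normD p (- z); rewrite normrN; lra.
Qed.

Lemma csm_bcs_shift r m z : csm r m -> bcs (fun q => m (q - z)).
Proof. by move=> /(csm_shift z)/csm_bcs. Qed.

Lemma bcs_conv f r m z : lbm f -> csm r m -> bcs (fun q => f q * m (q - z)).
Proof. by move=> lf cm; apply: bcsMr => //; exact: csm_bcs_shift cm. Qed.

Lemma sm_affine_fun (a b c : R) : sm (fun w : R * R => w.1 * a + w.2 * b + c).
Proof.
apply: sm_add; last exact: sm_cst.
apply: sm_add; apply: sm_mul; try exact: sm_cst; [exact: sm_fst|exact: sm_snd].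
Qed.

Lemma D_affine_fun (a b c : R) v p :
  'D_v (fun w : R * R => w.1 * a + w.2 * b + c) p = v.1 * a + v.2 * b.
Proof.
have s1 : sm (fun w : R * R => w.1 * a) by apply: sm_mul; [exact: sm_fst|exact: sm_cst].
have s2 : sm (fun w : R * R => w.2 * b) by apply: sm_mul; [exact: sm_snd|exact: sm_cst].
rewrite DD ?derive_cst ?addr0; [|exact: sm_add|exact: sm_cst].
rewrite DD// !DM ?derive_cst ?mulr0 ?add0r ?Dfst ?Dsnd; try exact: sm_cst;
  try exact: sm_fst; try exact: sm_snd.
by ring.
Qed.

(** The constant is uniform in [u], so the expansion may be integrated against a function that is
    only locally bounded. *)
Lemma taylor2 r m : csm r m -> exists2 C, 0 <= C & forall u h,
  `|m (u - h) - m u + 'D_h m u| <= C * `|h| ^+ 2.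
Proof.
move=> cm; have [sm0 _] := cm.
have bd v : exists2 C, 0 <= C & forall p, `|'D_v (fun p => 'D_(1,0) m p) p| <= C /\
    `|'D_v (fun p => 'D_(0,1) m p) p| <= C.
  have [C1 c1 h1] := csm_bounded (csmD v (csmD (1,0) cm)).
  have [C2 c2 h2] := csm_bounded (csmD v (csmD (0,1) cm)).
  exists (C1 + C2); first exact: addr_ge0.
  by move=> p; split; [apply: le_trans (h1 p) _; rewrite lerDl|
    apply: le_trans (h2 p) _; rewrite lerDr].
have [A A0 hA] := bd (1, 0); have [B B0 hB] := bd (0, 1).
exists (2 * (2 * (A + B))); first lra.
move=> u h.
pose l (w : R * R) := w.1 * - 'D_(1,0) m u + w.2 * - 'D_(0,1) m u + 0.
pose F w := m w + l w.
have sl : sm l by exact: sm_affine_fun.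
have sF : sm F by exact: sm_add.
have lE v w : 'D_v l w = - 'D_v m u.
  by rewrite D_affine_fun (derive_coord v (sm_diff sm0 u)) !mulrN opprD.
have FE v w : 'D_v F w = 'D_v m w - 'D_v m u by rewrite DD// lE.
have -> : m (u - h) - m u + 'D_h m u = F (u - h) - F u.
  rewrite /F /l (derive_coord h (sm_diff sm0 u)) /=.
  by move: ('D_(1, 0) m u) ('D_(0, 1) m u) (m u) (m _) => d1 d2 x y; ring.
have segb (t : R) : 0 <= t <= 1 -> `|t *: - h| <= `|h|.
  by move=> /andP[t0 t1]; rewrite normrZ normrN ger0_norm// ler_piMl.
have key e (t : R) : (forall v p, v = (1,0) \/ v = (0,1) -> `|'D_v (fun p => 'D_e m p) p| <= A + B) ->
    0 <= t <= 1 -> `|'D_e F (u + t *: - h)| <= 2 * (A + B) * `|h|.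
  move=> he t01; rewrite FE.
  have := @mvt_plane R (fun p => 'D_e m p) (A + B) u (u + t *: - h) (smD e sm0).
  rewrite (_ : u + t *: - h - u = t *: - h); last by rewrite addrAC subrr add0r.
  move=> H; apply: le_trans (H _ _) _.
  - by move=> s _; apply: he; left.
  - by move=> s _; apply: he; right.
  - by apply: ler_wpM2l; [lra|exact: segb].
have := @mvt_plane R F (2 * (A + B) * `|h|) u (u - h) sF.
rewrite (_ : u - h - u = - h); last by rewrite addrAC subrr add0r.
rewrite normrN => H.
have -> : 2 * (2 * (A + B)) * `|h| ^+ 2 = 2 * (2 * (A + B) * `|h|) * `|h| by ring.
apply: H => t t01.
- apply: key => // v p [->|->].
    by have [h1 _] := hA p; apply: le_trans h1 _; rewrite lerDl.
  by have [h1 _] := hB p; apply: le_trans h1 _; rewrite lerDr.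
- apply: key => // v p [->|->].
    by have [_ h1] := hA p; apply: le_trans h1 _; rewrite lerDl.
  by have [_ h1] := hB p; apply: le_trans h1 _; rewrite lerDr.
Qed.

Lemma conv_bound f m r z M N : lbm f -> csm r m -> 0 <= r ->
  (forall q, `|q - z| <= r -> `|f q| <= N) -> (forall q, `|m q| <= M) -> 0 <= N ->
  `|conv f m z| <= N * M * (2 * (r + 1)) ^+ 2.
Proof.
move=> lf cm r0 fN mM N0; have bc := bcs_conv z lf cm.
have [] := bcs_bound bc.1 (z := z) (M := N * M) (r := r + 1).
- lra.
- move=> q; have [h|h] := leP `|q - z| r; first by rewrite normrM ler_pM// fN.
  by rewrite cm.2// mulr0 normr0 mulr_ge0// (le_trans (normr_ge0 _) (mM 0)).
- move=> q qz; rewrite cm.2 ?mulr0//; rewrite ltNge; apply/negP => h; apply: qz.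
  by rewrite -ball_normE /= distrC; apply: le_lt_trans h _; rewrite ltrDl.
- by [].
Qed.

(** Subtract the affine function [l] with the expected value and gradient at [z]. What remains is
    the integral of [f] against the Taylor remainder of [m], which is quadratic in the increment. *)
Lemma conv_diff f m r z : lbm f -> csm r m -> differentiable (conv f m) z /\
  forall v, 'D_v (conv f m) z = - conv f (fun p => 'D_v m p) z.
Proof.
move=> lf cm; have [sm0 _] := cm.
pose A := conv f (fun p => 'D_(1, 0) m p) z; pose B := conv f (fun p => 'D_(0, 1) m p) z.
have convD v : conv f (fun p => 'D_v m p) z = v.1 * A + v.2 * B.
  rewrite /A /B /conv -!I2Z; [|exact: bcs_conv lf (csmD _ cm)..].
  rewrite -I2D; [|exact/bcsZ/(bcs_conv _ lf (csmD _ cm))..].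
  by apply: eq_I2 => q; rewrite (derive_coord v (sm_diff sm0 _)); ring.
pose l (w : R * R) := w.1 * - A + w.2 * - B + (z.1 * A + z.2 * B + conv f m z).
have sl : sm l by exact: sm_affine_fun.
have lE v w : 'D_v l w = - conv f (fun p => 'D_v m p) z.
  by rewrite D_affine_fun convD; ring.
pose g w := conv f m w - l w.
have [C C0 hC] := taylor2 cm.
have [N hN] := lf.2 (`|z| + `|r| + 2).
have N0 : 0 <= N by apply: le_trans (hN 0 _); rewrite ?normr0// !addr_ge0.
have gE h : g (z + h) = I2 (fun q => f q * (m (q - z - h) - m (q - z) + 'D_h m (q - z))).
  have b1 := bcs_conv (z + h) lf cm.
  have b2 := bcs_conv z lf cm.
  have b3 := bcs_conv z lf (csmD h cm).
  transitivity (conv f m (z + h) - conv f m z + conv f (fun p => 'D_h m p) z).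
    by rewrite /g /l convD /=; ring.
  rewrite /conv -I2B// -I2D//; last exact: bcsB.
  by apply: eq_I2 => q; rewrite opprD addrA; ring.
have [dg dg0] : differentiable g z /\ forall v, 'D_v g z = 0.
  apply: (@quadratic_differentiable _ _ g z (N * C * (2 * (`|r| + 2)) ^+ 2)) => p p1.
  have -> : p = z + (p - z) by rewrite addrC subrK.
  rewrite [z + _ - z]addrC addKr gE; set h := p - z.
  have -> : N * C * (2 * (`|r| + 2)) ^+ 2 * `|h| ^+ 2 =
     N * (C * `|h| ^+ 2) * (2 * (`|r| + 2)) ^+ 2 by ring.
  have b : bcs (fun q => f q * (m (q - z - h) - m (q - z) + 'D_h m (q - z))).
    have b1 := bcs_conv (z + h) lf cm.
    have b2 := bcs_conv z lf cm.
    have b3 := bcs_conv z lf (csmD h cm).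
    have := bcsD (bcsB b1 b2) b3; congr bcs; apply/funext => q; rewrite opprD addrA; ring.
  have [] := bcs_bound b.1 (z := z) (M := N * (C * `|h| ^+ 2)) (r := `|r| + 2) => //.
  - move=> q; have [hq|hq] := leP `|q - z| (`|r| + 2).
      rewrite normrM ler_pM// hN//; have := ler_normD z (q - z).
      by rewrite [z + _]addrC subrK; lra.
    have rr := ler_norm r.
    have hq2 := lerB_normD (q - z) (- h); rewrite normrN in hq2.
    have p1' : `|h| <= 1 by [].
    by rewrite !cm.2 ?(csmD h cm).2 ?subrr ?addr0 ?mulr0 ?normr0 ?mulr_ge0// ?sqr_ge0//; lra.
  - move=> q hq.
    have {}hq : `|r| + 2 <= `|q - z|.
      by rewrite leNgt; apply/negP => h'; apply: hq; rewrite -ball_normE /= distrC.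
    have rr := ler_norm r.
    have hq2 := lerB_normD (q - z) (- h); rewrite normrN in hq2.
    have p1' : `|h| <= 1 by [].
    by rewrite !cm.2 ?(csmD h cm).2 ?subrr ?addr0 ?mulr0//; lra.
have cE : conv f m = g + l by apply/funext => w; rewrite /g fctE subrK.
split; first by rewrite cE; apply: differentiableD => //; exact: sm_diff.
move=> v.
have dl : differentiable l z by exact: sm_diff.
have gl : 'D_v (g + l) z = 'D_v g z + 'D_v l z.
  by rewrite deriveD//; exact: diff_derivable.
by rewrite cE gl lE dg0 add0r.
Qed.

Lemma sm_conv f m r : lbm f -> csm r m -> sm (conv f m).
Proof.
move=> lf cm n; elim: n m cm => [|n IH] m cm /=; split => //.
- by move=> z; have [] := conv_diff z lf cm.
- by move=> z; have [] := conv_diff z lf cm.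
move=> v; have -> : (fun z => 'D_v (conv f m) z) = fun z => (- 1) * conv f (fun p => 'D_v m p) z.
  by apply/funext => z; rewrite (conv_diff z lf cm).2 mulN1r.
by apply: Ck_mul; [exact: Ck_cst|exact/IH/csmD].
Qed.

Lemma D_conv f m r z v : lbm f -> csm r m -> 'D_v (conv f m) z = - conv f (fun p => 'D_v m p) z.
Proof. by move=> lf cm; rewrite (conv_diff z lf cm).2. Qed.

End convolution.

(** * Radial kernels *)

Section step.
Variable R : realType.
Implicit Types (x y : R) (j n : nat).

(** The family x^-j exp(-1/x) is closed under differentiation up to linear combinations, so
    smoothness of all its members follows from one induction. *)
Definition flat j x : R := if 0 < x then x^-1 ^+ j * expR (- x^-1) else 0.

Lemma flat_pos j x : 0 < x -> flat j x = x^-1 ^+ j * expR (- x^-1).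
Proof. by rewrite /flat => ->. Qed.

Lemma flat_neg j x : x <= 0 -> flat j x = 0.
Proof. by rewrite /flat leNgt => /negbTE ->. Qed.

Lemma flat_gt0 j x : 0 < x -> 0 < flat j x.
Proof. by move=> x0; rewrite flat_pos// mulr_gt0// ?expR_gt0// exprn_gt0// invr_gt0. Qed.

Lemma flat_ge0 j x : 0 <= flat j x.
Proof. by have [x0|x0] := leP x 0; [rewrite flat_neg|exact/ltW/flat_gt0]. Qed.

(** With y = 1/x and n = j + 2, exp y = (exp (y/n))^n is at least (y/n)^n. The quadratic bound
    yields the derivative 0 at the origin. *)
Lemma flat_le j x : flat j x <= j.+2%:R ^+ j.+2 * x ^+ 2.
Proof.
have [x0|x0] := leP x 0.
  by rewrite flat_neg// mulr_ge0// ?sqr_ge0// exprn_ge0.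
rewrite flat_pos//; set y := x^-1; set n := j.+2.
have y0 : 0 < y by rewrite invr_gt0.
have n0 : 0 < n%:R :> R by rewrite ltr0n.
have h1 : (y / n%:R) ^+ n <= expR y.
  have -> : expR y = expR (y / n%:R) ^+ n.
    by rewrite -expRM_natl mulrC divfK ?gt_eqF.
  rewrite ler_pXn2r ?nnegrE ?divr_ge0 ?expR_ge0 ?ltW//.
  by apply: lt_le_trans (expR_ge1Dx _); rewrite ltrDr.
rewrite expRN.
have -> : x = y^-1 by rewrite invrK.
have h2 : (expR y)^-1 <= ((y / n%:R) ^+ n)^-1.
  by rewrite lef_pV2// posrE ?expR_gt0// exprn_gt0// divr_gt0.
have yj : 0 <= y ^+ j by rewrite exprn_ge0// ltW.
apply: le_trans (ler_wpM2l yj h2) _.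
rewrite expr_div_n invf_div mulrCA ler_wpM2l ?exprn_ge0//.
rewrite /n !exprS le_eqVlt; apply/orP; left; apply/eqP.
by field; rewrite ?expf_neq0 gt_eqF.
Qed.

Lemma derive_scale1 (f : R -> R) x v : differentiable f x -> 'D_v f x = v * 'D_1 f x.
Proof.
move=> df; rewrite (deriveE v df) (deriveE (1 : R^o) df).
rewrite -[RHS]/(v *: ('d f x 1)) -linearZ; by rewrite /GRing.scale /= mulr1.
Qed.

Lemma flat_derive j x : differentiable (flat j) x /\
  'D_1 (flat j) x = flat j.+2 x - j%:R * flat j.+1 x.
Proof.
have [x0|x0|x0] := ltgtP x 0.
- have E : \forall y \near x, (cst 0 : R -> R) y = flat j y.
    have : \forall y \near x, y < 0 by exact: lt_nbhsl.
    by apply: filterS => y y0; rewrite flat_neg// ltW.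
  have dx : derivable (flat j) x 1.
    by apply: near_eq_derivable E _ => //; exact: derivable_cst.
  split; first exact/derivable1_diffP.
  rewrite -(near_eq_derive _ E)//; rewrite derive_cst !flat_neg ?(ltW x0)//.
  by rewrite mulr0 subrr.
- have E : \forall y \near x, (fun y => y^-1 ^+ j * expR (- y^-1)) y = flat j y.
    have : \forall y \near x, 0 < y by exact: lt_nbhsr.
    by apply: filterS => y y0; rewrite flat_pos.
  have xn0 : x != 0 by rewrite gt_eqF.
  have d1 : is_derive x (1 : R) (fun y : R => y^-1) (- x^-1 ^+ 2).
    have := @is_deriveV _ id x _ _ xn0 (is_derive_id x (1 : R)).
    by rewrite /GRing.scale /= mulr1 exprVn.
  have d2 : is_derive x (1 : R) (fun y : R => expR (- y^-1)) (expR (- x^-1) * - - x^-1 ^+ 2).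
    exact: (@is_derive1_comp R expR (fun y : R => - y^-1)).
  have d3 : is_derive x (1 : R) (fun y : R => y^-1 ^+ j) ((j%:R * x^-1 ^+ j.-1) *: (- x^-1 ^+ 2)).
    by have := is_deriveX j d1; rewrite exprfctE.
  have d4 := is_deriveM d3 d2.
  have [d5 d6] := near_eq_is_derive E d4.
  split; first exact/derivable1_diffP.
  rewrite d6 !flat_pos// /GRing.scale /= opprK.
  case: (j) => [|i] /=; first by rewrite expr0; ring.
  by rewrite !exprS; ring.
- rewrite x0.
  have [y _|d1 d2] := @quadratic_differentiable R R (flat j) 0 (j.+2%:R ^+ j.+2).
    by rewrite subr0 ger0_norm ?flat_ge0// -normrX ger0_norm ?sqr_ge0// flat_le.
  by split => //; rewrite d2 !flat_neg// mulr0 subrr.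
Qed.

Lemma sm_flat j : sm (flat j).
Proof.
move=> n; elim: n j => [|n IH] j /=; split => //.
- by move=> x; have [] := flat_derive j x.
- by move=> x; have [] := flat_derive j x.
move=> v; have -> : (fun x => 'D_v (flat j) x) =
    fun x => v * (flat j.+2 x + (- j%:R) * flat j.+1 x).
  apply/funext => x; have [d1 d2] := flat_derive j x.
  by rewrite derive_scale1// d2 mulNr.
apply: Ck_mul; first exact: Ck_cst.
apply: Ck_add; first exact: IH.
by apply: Ck_mul; [exact: Ck_cst|exact: IH].
Qed.

Lemma DM1 (f g : R -> R) x : sm f -> sm g ->
  'D_1 (fun y : R => f y * g y) x = f x * 'D_1 g x + g x * 'D_1 f x.
Proof. by move=> sf sg; exact: DM. Qed.

Lemma DB1 (f g : R -> R) x : sm f -> sm g ->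
  'D_1 (fun y : R => f y - g y) x = 'D_1 f x - 'D_1 g x.
Proof. by move=> sf sg; exact: DB. Qed.

Lemma DD1 (f g : R -> R) x : sm f -> sm g ->
  'D_1 (fun y : R => f y + g y) x = 'D_1 f x + 'D_1 g x.
Proof. by move=> sf sg; exact: DD. Qed.

Lemma sm_id : sm (fun x : R => x).
Proof. by apply: (@sm_lin R R idfun) => x; exact: cvg_id. Qed.

Definition den x : R := flat 0 x + flat 0 (1 - x).

Lemma den_gt0 x : 0 < den x.
Proof.
rewrite /den; have [x0|x0] := ltP 0 x.
  by rewrite ltr_pwDl// ?flat_gt0// flat_ge0.
by rewrite ltr_wpDl ?flat_ge0// flat_gt0//; lra.
Qed.

Lemma sm_flip j : sm (fun x => flat j (1 - x)).
Proof.
by apply: (sm_comp (@sm_flat j)); apply: sm_sub; [exact: sm_cst|exact: sm_id].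
Qed.

Lemma sm_den : sm den.
Proof. by apply: sm_add; [exact: sm_flat|exact: sm_flip]. Qed.

(* [step] climbs from 0 at 0 to 1 at 1, and [stepq x = step x / x] stays smooth at 0. *)
Definition step x := flat 0 x * (den x)^-1.
Definition stepq x := flat 1 x * (den x)^-1.

Lemma sm_step : sm step.
Proof.
apply: sm_mul; first exact: sm_flat.
by apply: sm_inv; [move=> x; rewrite gt_eqF// den_gt0|exact: sm_den].
Qed.

Lemma sm_stepq : sm stepq.
Proof.
apply: sm_mul; first exact: sm_flat.
by apply: sm_inv; [move=> x; rewrite gt_eqF// den_gt0|exact: sm_den].
Qed.

Lemma stepE x : step x = x * stepq x.
Proof.
rewrite /step /stepq mulrA; congr (_ * _).
have [x0|x0] := leP x 0; first by rewrite !flat_neg// mulr0.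
by rewrite !flat_pos// expr0 expr1 mulrA divff ?gt_eqF.
Qed.

Lemma step_neg x : x <= 0 -> step x = 0.
Proof. by move=> x0; rewrite /step flat_neg// mul0r. Qed.

Lemma step_ge1 x : 1 <= x -> step x = 1.
Proof.
move=> x1; rewrite /step /den [flat 0 (1 - x)]flat_neg ?addr0 ?subr_le0//.
by rewrite divff// gt_eqF// flat_gt0//; lra.
Qed.

Lemma stepq_ge1 x : 1 <= x -> stepq x = x^-1.
Proof.
move=> x1; have x0 : x != 0 by rewrite gt_eqF//; lra.
by apply: (mulfI x0); rewrite -stepE step_ge1// divff.
Qed.

Lemma step_ge0 x : 0 <= step x.
Proof. by rewrite mulr_ge0 ?flat_ge0// invr_ge0 ltW// den_gt0. Qed.

Lemma step_le1 x : step x <= 1.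
Proof. by rewrite ler_pdivrMr ?den_gt0// mul1r lerDl flat_ge0. Qed.

Definition dstep x := 'D_1 step x.

Lemma sm_dstep : sm dstep. Proof. exact/smD/sm_step. Qed.

Lemma dstepE x : dstep x =
  (flat 2 x * flat 0 (1 - x) + flat 0 x * flat 2 (1 - x)) / (den x) ^+ 2.
Proof.
have df0 y : 'D_1 (flat 0) y = flat 2 y.
  by have [_ ->] := flat_derive 0 y; rewrite mul0r subr0.
have dff y : 'D_1 (fun y : R => flat 0 (1 - y)) y = - flat 2 (1 - y).
  rewrite (Dcomp _ _ (g := flat 0))//; last 2 first.
  - by apply: sm_sub; [exact: sm_cst|exact: sm_id].
  - exact: sm_flat.
  rewrite df0// (@DB1 (fun=> 1) (fun y => y)) ?derive_cst ?derive_id ?sub0r ?mulN1r//.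
  - exact: sm_cst.
  - exact: sm_id.
have d0 := den_gt0 x.
rewrite /dstep /step (@DM1 (flat 0) (fun x => (den x)^-1)); last 2 first.
- exact: sm_flat.
- by apply: sm_inv; [move=> y; rewrite gt_eqF// den_gt0|exact: sm_den].
rewrite df0// (@deriveV _ _ den) ?gt_eqF//; last exact: sm_derivable sm_den _ _.
rewrite {2}/den (@DD1 (flat 0) (fun x => flat 0 (1 - x))); [|exact: sm_flat|exact: sm_flip].
rewrite df0// dff /GRing.scale /= /den; field.
by rewrite gt_eqF.
Qed.

Lemma dstep_ge0 x : 0 <= dstep x.
Proof.
rewrite dstepE divr_ge0 ?exprn_ge0 ?(ltW (den_gt0 _))//.
by rewrite addr_ge0// mulr_ge0 ?flat_ge0.
Qed.

Lemma dstep_neg x : x <= 0 -> dstep x = 0.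
Proof. by move=> x0; rewrite dstepE !(@flat_neg _ x)// !mul0r addr0 mul0r. Qed.

Lemma dstep_ge1 x : 1 <= x -> dstep x = 0.
Proof.
by move=> x0; rewrite dstepE !(@flat_neg _ (1 - x)) ?subr_le0// !mulr0 addr0 mul0r.
Qed.

Lemma dstep_half_gt0 : 0 < dstep 2^-1.
Proof.
have h : 0 < 2^-1 :> R by rewrite invr_gt0.
have h' : 1 - 2^-1 = 2^-1 :> R by field.
rewrite dstepE h' divr_gt0 ?exprn_gt0 ?den_gt0//.
by rewrite addr_gt0// mulr_gt0 ?flat_gt0.
Qed.

(** This makes [dstep] the right radial profile: for a function f of t = |p|^2 the divergence of p
    f(t) is 2 (f + t f')(t), which for f = [stepq] is twice [bump]. *)
Lemma stepq_derive x : stepq x + x * 'D_1 stepq x = dstep x.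
Proof.
rewrite /dstep (_ : step = fun y => y * stepq y); last by apply/funext => y; exact: stepE.
rewrite (@DM1 (fun y => y) stepq); [|exact: sm_id|exact: sm_stepq].
by rewrite derive_id mulr1 addrC.
Qed.

Lemma dstep_bounded : exists2 C, 0 <= C & forall x, dstep x <= C.
Proof.
have : {within `[0, 1], continuous dstep}.
  by apply: continuous_subspaceT; apply: sm_cont; exact: sm_dstep.
move=> /(EVT_max (ler01 : 0 <= 1 :> R))[c _ hc]; exists (dstep c); first exact: dstep_ge0.
move=> x; have [x0|x0] := leP x 0; first by rewrite dstep_neg// dstep_ge0.
have [x1|x1] := leP 1 x; first by rewrite dstep_ge1// dstep_ge0.
by apply: hc; rewrite in_itv /= !ltW.
Qed.

End step.

(** * Symmetry of second derivatives *)

Section schwarz.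
Variable R : realType.
Implicit Types (f : R * R -> R) (p u w : R * R).

Lemma mvt2 f p u w (h : R) : sm f -> 0 < h -> exists x y, [/\ 0 < x < h, 0 < y < h &
  f (p + h *: u + h *: w) - f (p + h *: u) - (f (p + h *: w) - f p) =
  h * (h * 'D_w (fun q => 'D_u f q) (p + x *: u + y *: w))].
Proof.
move=> sf h0; pose g q := f (q - (- (h *: w))) - f q.
have s1 : sm (fun q => f (q - (- (h *: w)))) by exact: sm_shift.
have sg : sm g by exact: sm_sub.
have [x xh gx] := mvt_line p u sg h0.
have [y yh fy] := mvt_line (p + x *: u) w (smD u sf) h0.
exists x, y; split => //.
have gE q : g q = f (q + h *: w) - f q by rewrite /g opprK.
by rewrite -fy -!gE gx (DB _ _ s1 sf) (D_shift _ _ _ sf) opprK.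
Qed.

Lemma continuous_eps f p (e : R) : {for p, continuous f} -> 0 < e ->
  exists2 d, 0 < d & forall q, `|p - q| < d -> `|f p - f q| < e.
Proof.
move=> cf e0; have h0 : \forall q \near p, `|f p - f q| < e by move/cvgrPdist_lt : cf; exact.
have /nbhs_ballP[d /= d0 h] := h0.
by exists d => // q pq; apply: h; rewrite -ball_normE.
Qed.

Lemma half_close (A B C e : R) : `|A - C| < e / 2 -> `|B - C| < e / 2 -> `|A - B| <= e.
Proof.
rewrite [`|B - C|]distrC => h1 h2; have := ler_normD (A - C) (C - B); rewrite addrA subrK => h.
by apply/ltW/(le_lt_trans h); rewrite [e]splitr; exact: ltrD.
Qed.

(** The mixed second difference of [f] is symmetric in [u] and [w]; two mean value steps, taken in
    either order, express it by either mixed derivative near [p]. *)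
Lemma D_sym f p u w : sm f -> 'D_w (fun q => 'D_u f q) p = 'D_u (fun q => 'D_w f q) p.
Proof.
move=> sf; apply/eqP; rewrite -subr_eq0 -normr_le0; apply/ler_addgt0Pr => e e0.
rewrite add0r.
have cA : continuous (fun q => 'D_w (fun q => 'D_u f q) q).
  by apply: sm_cont; do 2 apply: smD.
have cB : continuous (fun q => 'D_u (fun q => 'D_w f q) q).
  by apply: sm_cont; do 2 apply: smD.
have e2 : 0 < e / 2 by rewrite divr_gt0.
have [d1 d10 hA] := continuous_eps (cA p) e2.
have [d2 d20 hB] := continuous_eps (cB p) e2.
pose s := `|u| + `|w| + 1.
have s0 : 0 < s by rewrite ltr_wpDl// addr_ge0.
pose h := Num.min d1 d2 / s.
have h0 : 0 < h by rewrite divr_gt0// lt_min d10.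
have hs : h * s = Num.min d1 d2 by rewrite divfK// gt_eqF.
have near x y : 0 < x < h -> 0 < y < h -> `|p - (p + x *: u + y *: w)| < h * s.
  move=> /andP[x0 xh] /andP[y0 yh]; rewrite -addrA opprD addrA subrr add0r normrN.
  apply: le_lt_trans (ler_normD _ _) _; rewrite !normrZ !gtr0_norm//.
  have h1 : x * `|u| <= h * `|u| by rewrite ler_wpM2r// ltW.
  have h2 : y * `|w| <= h * `|w| by rewrite ler_wpM2r// ltW.
  rewrite /s !mulrDr mulr1; lra.
have [x [y [xh yh E1]]] := mvt2 p u w sf h0.
have [x' [y' [xh' yh' E2]]] := mvt2 p w u sf h0.
have E : 'D_w (fun q => 'D_u f q) (p + x *: u + y *: w) =
         'D_u (fun q => 'D_w f q) (p + x' *: w + y' *: u).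
  have h1 : h != 0 by rewrite gt_eqF.
  apply: (mulfI h1); apply: (mulfI h1).
  apply: etrans (esym E1) (etrans _ E2); rewrite [p + h *: w + _]addrAC.
  move: (f (p + h *: u + h *: w)) (f (p + h *: u)) (f (p + h *: w)) (f p) => a b c d.
  ring.
have := near _ _ xh yh; rewrite hs lt_min => /andP[/hA + _]; rewrite E => h1.
have := near _ _ yh' xh'; rewrite addrAC hs lt_min => /andP[_ /hB h2].
exact: half_close h1 h2.
Qed.

End schwarz.

(** * Truncated Cauchy kernels and the change of averages between dyadic scales *)

Section kernel.
Variable R : realType.
Implicit Types (f g a b : R * R -> R) (p q v z : R * R) (k : R) (s : seq (R * R)).

Lemma csm_iter s r f : csm r f -> csm r (iter_derive s f).
Proof. by elim: s => //= v s IH /IH; exact: csmD. Qed.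

Lemma sm_iter s f : sm f -> sm (iter_derive s f).
Proof. by elim: s => //= v s IH /IH; exact: smD. Qed.

Lemma D_iter s f u p : sm f -> 'D_u (iter_derive s f) p = iter_derive s (fun q => 'D_u f q) p.
Proof.
elim: s p => //= v s IH p sf; rewrite -(D_sym _ u v (sm_iter s sf)).
by congr ('D_v _ p); apply/funext => q; exact: IH.
Qed.

Lemma iter_add s f g p : sm f -> sm g ->
  iter_derive s (fun q => f q + g q) p = iter_derive s f p + iter_derive s g p.
Proof.
move=> sf sg; elim: s p => //= v s IH p; rewrite -DD; [|exact: sm_iter..].
by congr ('D_v _ p); apply/funext.
Qed.

Lemma iter_scale s f (c : R) p : sm f ->
  iter_derive s (fun q => c * f q) p = c * iter_derive s f p.
Proof.
move=> sf; elim: s p => //= v s IH p; rewrite -DZ; last exact: sm_iter.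
by congr ('D_v _ p); apply/funext.
Qed.

Lemma D_dil k f v p : sm f -> 'D_v (fun q => f (k *: q)) p = k * 'D_v f (k *: p).
Proof.
move=> sf; have [_] := @derive_affine _ f 0 k p v (sm_diff sf _).
have -> : (fun q => f (k *: (q - 0))) = (fun q => f (k *: q)).
  by apply/funext => q; rewrite subr0.
by rewrite subr0.
Qed.

Lemma sm_dil k f : sm f -> sm (fun q => f (k *: q)).
Proof.
move=> sf; have := sm_affine 0 k sf; congr sm; apply/funext => q; by rewrite subr0.
Qed.

Lemma csm_dil k r f : 0 < k -> csm r f -> csm (r / k) (fun q => f (k *: q)).
Proof.
move=> k0 [sf f0]; split => [|p]; first exact: sm_dil.
by rewrite ltr_pdivrMr// mulrC => rp; apply: f0; rewrite normrZ gtr0_norm.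
Qed.

Lemma csm_scale r f (c : R) : csm r f -> csm r (fun q => c * f q).
Proof.
move=> [sf f0]; split => [|p /f0 ->]; last by rewrite mulr0.
by apply: sm_mul => //; exact: sm_cst.
Qed.

Lemma iter_dil s k f (c : R) p : sm f ->
  iter_derive s (fun q => c * f (k *: q)) p = c * k ^+ size s * iter_derive s f (k *: p).
Proof.
move=> sf; elim: s p => [|v s IH] p /=; first by rewrite expr0 mulr1.
have -> : iter_derive s (fun q => c * f (k *: q)) =
   fun q => (c * k ^+ size s) * iter_derive s f (k *: q) by exact/funext.
rewrite DZ; last exact/sm_dil/sm_iter.
by rewrite D_dil ?exprS; [ring|exact: sm_iter].
Qed.

Definition sq p := p.1 * p.1 + p.2 * p.2.

Lemma sm_sq : sm sq.
Proof. by apply: sm_add; apply: sm_mul; (exact: sm_fst || exact: sm_snd). Qed.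

Lemma D_sq v p : 'D_v sq p = 2 * (p.1 * v.1 + p.2 * v.2).
Proof.
have s1 := @sm_fst R; have s2 := @sm_snd R.
rewrite /sq DD; [|exact: sm_mul..].
rewrite !DM// Dfst Dsnd; ring.
Qed.

Lemma sq_ge p : `|p| ^+ 2 <= sq p.
Proof.
rewrite /sq -!expr2 -(real_normK (num_real p.1)) -(real_normK (num_real p.2)).
by rewrite prod_normE /=; case: (leP `|p.1| `|p.2|) => _; rewrite ?lerDl ?lerDr sqr_ge0.
Qed.

Lemma sq_dil k p : sq (k *: p) = k ^+ 2 * sq p.
Proof. by rewrite /sq /= /GRing.scale /=; ring. Qed.

Lemma sq_gt p r : 0 <= r -> r < `|p| -> r ^+ 2 < sq p.
Proof. by move=> r0 rp; apply: lt_le_trans (sq_ge p); rewrite ltr_pXn2r// ?nnegrE. Qed.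

Definition bump p := dstep (sq p).
(* The field [(kerx, kery)] is curl free, and its divergence is the difference of the bumps at
   scales 1 and 2. *)
Definition ker0 p := stepq (sq p) - 4^-1 * stepq (4^-1 * sq p).
Definition kerx p := p.1 * ker0 p.
Definition kery p := p.2 * ker0 p.

Lemma sm_ker0 : sm ker0.
Proof.
apply: sm_sub; first exact: (sm_comp (@sm_stepq R) sm_sq).
apply: sm_mul; first exact: sm_cst.
by apply: (sm_comp (@sm_stepq R)); apply: sm_mul; [exact: sm_cst|exact: sm_sq].
Qed.

Lemma csm_bump : csm 1 bump.
Proof.
split=> [|p p1]; first exact: (sm_comp (@sm_dstep R) sm_sq).
by rewrite /bump dstep_ge1// ltW// -(expr1n _ 2) sq_gt.
Qed.

Lemma bump_ge0 p : 0 <= bump p. Proof. exact: dstep_ge0. Qed.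

(** For t >= 1 one has [stepq] t = 1/t, so far out both terms equal 1/|p|^2: they give the Cauchy
    kernel p/|p|^2, and the two scales cancel. *)
Lemma ker0_supp p : 2 < `|p| -> ker0 p = 0.
Proof.
move=> p2; have h : 2 ^+ 2 < sq p by rewrite sq_gt.
have h4 : 4 < sq p by apply: le_lt_trans h; rewrite expr2; lra.
rewrite /ker0 !stepq_ge1; try lra.
Qed.

Lemma csm_kerx : csm 2 kerx.
Proof.
split=> [|p /ker0_supp]; last by rewrite /kerx => ->; rewrite mulr0.
by apply: sm_mul; [exact: sm_fst|exact: sm_ker0].
Qed.

Lemma csm_kery : csm 2 kery.
Proof.
split=> [|p /ker0_supp]; last by rewrite /kery => ->; rewrite mulr0.
by apply: sm_mul; [exact: sm_snd|exact: sm_ker0].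
Qed.

Lemma D_ker0 v p : 'D_v ker0 p = 2 * (p.1 * v.1 + p.2 * v.2) *
  ('D_1 (@stepq R) (sq p) - 16^-1 * 'D_1 (@stepq R) (4^-1 * sq p)).
Proof.
have s4 : sm (fun q => 4^-1 * sq q) by apply: sm_mul; [exact: sm_cst|exact: sm_sq].
have t1 := sm_comp (@sm_stepq R) sm_sq; have t2 := sm_comp (@sm_stepq R) s4.
rewrite /ker0 DB//; last by apply: sm_mul => //; exact: sm_cst.
rewrite (DZ _ _ _ t2) (Dcomp _ _ sm_sq (@sm_stepq R)) (Dcomp _ _ s4 (@sm_stepq R)).
rewrite (DZ _ _ _ sm_sq) D_sq; move: ('D_1 (@stepq R) _) ('D_1 (@stepq R) _) => S W.
by field.
Qed.

Lemma ker_div p : 'D_(1, 0) kerx p + 'D_(0, 1) kery p =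
  2 * (bump p - 4^-1 * bump (2^-1 *: p)).
Proof.
rewrite /kerx /kery !DM; try exact: sm_ker0; [|exact: sm_snd|exact: sm_fst].
rewrite Dfst Dsnd !D_ker0 /bump sq_dil -!stepq_derive /ker0 /=.
have -> : 2^-1 ^+ 2 = 4^-1 :> R by field.
have ht : sq p = p.1 * p.1 + p.2 * p.2 by [].
move: (sq p) ht => t ht.
move: (stepq t) ('D_1 (@stepq R) t) ('D_1 (@stepq R) (4^-1 * t)) (stepq (4^-1 * t)) => S S' W' W.
by rewrite ht; field.
Qed.

Lemma ker_curl p : 'D_(0, 1) kerx p = 'D_(1, 0) kery p.
Proof.
rewrite /kerx /kery !DM; try exact: sm_ker0; [|exact: sm_snd|exact: sm_fst].
rewrite Dfst Dsnd !D_ker0 /=; move: (_ - _) (ker0 p) => S W; ring.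
Qed.

Lemma half_bound (c A B x y d : R) : 2 * c = A + B -> `|A| <= x -> `|B| <= y ->
  x + y <= 2 * d -> `|c| <= d.
Proof.
move=> e hA hB h; have : `|2 * c| = 2 * `|c| by rewrite normrM normr_nat.
rewrite e; have := ler_normD A B; lra.
Qed.

(* [E1 + i E2] is twice the integral of [(a + i b) dbar f]. *)
Definition E1 a b f := I2 (fun q => a q * 'D_(1, 0) f q - b q * 'D_(0, 1) f q).
Definition E2 a b f := I2 (fun q => b q * 'D_(1, 0) f q + a q * 'D_(0, 1) f q).

(** A bound by [M] on the real and imaginary parts of 2 dbar(a + ib), on the whole plane, expressed
    by duality with L^1. No derivative of [a] or [b] has to exist as a function. *)
Definition weakC (M : R) a b := forall r f, csm r f ->
  `|E1 a b f| <= M * I2 (fun q => `|f q|) /\ `|E2 a b f| <= M * I2 (fun q => `|f q|).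

Lemma bcsM_csm r a f : lbm a -> csm r f -> bcs (fun q => a q * f q).
Proof. by move=> la cf; apply: bcsMr => //; exact: csm_bcs cf. Qed.

(** The two differential hypotheses say that dbar(X - iY) = m. Hence averaging a + ib against [m] is
    a pairing of a + ib with the dbar of a test function. *)
Lemma conv_div a b r X Y m z : lbm a -> lbm b -> csm r X -> csm r Y -> csm r m ->
  (forall p, 'D_(1, 0) X p + 'D_(0, 1) Y p = 2 * m p) ->
  (forall p, 'D_(0, 1) X p = 'D_(1, 0) Y p) ->
  2 * conv a m z = E1 a b (fun q => X (q - z)) + E2 a b (fun q => Y (q - z)) /\
  2 * conv b m z = E2 a b (fun q => X (q - z)) - E1 a b (fun q => Y (q - z)).
Proof.
move=> la lb cX cY cm hd hc.
have cXz := csm_shift z cX; have cYz := csm_shift z cY.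
have B c X' v : lbm c -> csm r X' -> bcs (fun q => c q * 'D_v (fun q => X' (q - z)) q).
  by move=> lc cX'; apply: bcsM_csm lc (csmD v (csm_shift z cX')).
have bX1 c v lc := B c X v lc cX; have bY1 c v lc := B c Y v lc cY.
split.
- rewrite /conv -I2Z; last exact: bcs_conv cm.
  rewrite /E1 /E2 -I2D; [|by apply: bcsB; [exact: bX1|exact: bX1]|by apply: bcsD; [exact: bY1|exact: bY1]].
  apply: eq_I2 => q; rewrite !D_shift; try exact: cX.1; try exact: cY.1.
  rewrite mulrCA -hd hc.
  move: ('D_(1, 0) X _) ('D_(0, 1) Y _) ('D_(1, 0) Y _) => A1 B1 B2; ring.
- rewrite /conv -I2Z; last exact: bcs_conv cm.
  rewrite /E1 /E2 -I2B; [|by apply: bcsD; [exact: bX1|exact: bX1]|by apply: bcsB; [exact: bY1|exact: bY1]].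
  apply: eq_I2 => q; rewrite !D_shift; try exact: cX.1; try exact: cY.1.
  rewrite mulrCA -hd hc.
  move: ('D_(1, 0) X _) ('D_(0, 1) Y _) ('D_(1, 0) Y _) => A1 B1 B2; ring.
Qed.

(** Here [k] is a frequency: the kernel lives at scale 1/k. It is not normalised; its mass is shown
    below to be the same at all dyadic scales. *)
Definition moll k q := k ^+ 2 * bump (k *: q).

Lemma csm_moll k : 0 < k -> csm k^-1 (moll k).
Proof. by move=> k0; have := csm_scale (k ^+ 2) (csm_dil k0 csm_bump); rewrite div1r. Qed.

Lemma moll_ge0 k q : 0 <= moll k q.
Proof. by rewrite /moll mulr_ge0 ?sqr_ge0// bump_ge0. Qed.

Lemma I2_norm_bound r r' f (C : R) z : 0 <= r' -> r < r' -> csm r f -> (forall p, `|f p| <= C) ->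
  I2 (fun q => `|f (q - z)|) <= C * (2 * r') ^+ 2.
Proof.
move=> r0 rr cf fC; have bf := bcs_abs (csm_bcs_shift z cf).
have [] := bcs_bound bf.1 (z := z) (M := C) r0.
- by move=> p; rewrite normr_id.
- move=> p pz; rewrite cf.2 ?normr0//; apply: lt_le_trans rr _.
  by rewrite leNgt; apply/negP => h; apply: pz; rewrite -ball_normE /= distrC.
- by move=> _; apply: le_trans (ler_norm _).
Qed.

Lemma csm_bound_seq r f (L : seq (seq (R * R))) : csm r f -> exists2 C, 0 <= C &
  forall s, s \in L -> forall p, `|iter_derive s f p| <= C.
Proof.
move=> cf; elim: L => [|s L [C C0 hC]]; first by exists 0.
have [D D0 hD] := csm_bounded (csm_iter s cf).
exists (C + D); first exact: addr_ge0.
move=> s'; rewrite inE => /orP[/eqP -> p|/hC h p].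
  by apply: le_trans (hD p) _; rewrite lerDr.
by apply: le_trans (h p) _; rewrite lerDl.
Qed.

(* The scale-[k^-1] averages of [a] change by [O(M / k)] when the scale doubles, and each
   derivative costs a factor [k]. *)
Lemma moll_step (L : seq (seq (R * R))) : exists2 C : R, 0 <= C & forall M a b s k z,
  lbm a -> lbm b -> weakC M a b -> 0 <= M -> 0 < k -> s \in L ->
  let m := fun q => moll k q - moll (k / 2) q in
  `|conv a (iter_derive s m) z| <= C * M * (k ^+ size s / k) /\
  `|conv b (iter_derive s m) z| <= C * M * (k ^+ size s / k).
Proof.
have [C1 C10 hX] := csm_bound_seq L csm_kerx.
have [C2 C20 hY] := csm_bound_seq L csm_kery.
(* The supports, of radius 2/k, lie in squares of side 6/k; 18 is 6^2 divided by the factor 2 in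
   [conv_div]. *)
exists ((C1 + C2) * 18); first by rewrite mulr_ge0// addr_ge0.
move=> M a b s k z la lb wC M0 k0 sL m.
(* With this scaling the divergence becomes exactly twice the difference of [moll k] and
   [moll (k / 2)]. *)
pose X q := k * kerx (k *: q); pose Y q := k * kery (k *: q).
have cX : csm (2 / k) X by apply: csm_scale; apply: csm_dil => //; exact: csm_kerx.
have cY : csm (2 / k) Y by apply: csm_scale; apply: csm_dil => //; exact: csm_kery.
have k2 : 0 < k / 2 by rewrite divr_gt0.
have cm : csm (2 / k) m.
  have c1 := csm_moll k0; have c2 := csm_moll k2.
  split; first by apply: sm_sub; [exact: c1.1|exact: c2.1].
  move=> p pk; have pk2 : (k / 2)^-1 < `|p| by rewrite invf_div.
  have pk1 : k^-1 < `|p|.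
    by apply: le_lt_trans pk; rewrite ler_peMl ?invr_ge0 ?(ltW k0)//; lra.
  by rewrite /m c1.2// c2.2// subrr.
have hd p : 'D_(1, 0) X p + 'D_(0, 1) Y p = 2 * m p.
  rewrite /X /Y !DZ; [|exact: sm_dil csm_kery.1|exact: sm_dil csm_kerx.1].
  rewrite !D_dil; [|exact: csm_kery.1|exact: csm_kerx.1].
  have := ker_div (k *: p); rewrite scalerA [2^-1 * k]mulrC /m /moll.
  move: ('D_(1, 0) kerx _) ('D_(0, 1) kery _) (bump _) (bump _) => A B c d /(canRL (addrK _)) ->.
  by field.
have hc p : 'D_(0, 1) X p = 'D_(1, 0) Y p.
  rewrite /X /Y !DZ; [|exact: sm_dil csm_kery.1|exact: sm_dil csm_kerx.1].
  by rewrite !D_dil; [rewrite ker_curl|exact: csm_kery.1|exact: csm_kerx.1].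
have [] := @conv_div a b (2 / k) (iter_derive s X) (iter_derive s Y) (iter_derive s m) z la lb
   (csm_iter s cX) (csm_iter s cY) (csm_iter s cm).
- move=> p; rewrite !D_iter; [|exact: cY.1|exact: cX.1].
  rewrite -iter_add; [|exact/smD/cX.1|exact/smD/cY.1].
  rewrite -iter_scale; last exact: cm.1.
  by congr (iter_derive s _ p); apply/funext => q; exact: hd.
- move=> p; rewrite !D_iter; [|exact: cY.1|exact: cX.1].
  exact: (congr1 (fun g => iter_derive s g p) (funext hc)).
have kb (c : R) C f : 0 <= C -> (forall p, `|iter_derive s f p| <= C) -> sm f ->
    forall p, `|iter_derive s (fun q => k * f (k *: q)) p| <= k ^+ (size s).+1 * C.
  move=> C0 h sf p; rewrite iter_dil// normrM exprS.
  have kk : 0 <= k * k ^+ size s by rewrite mulr_ge0 ?exprn_ge0// ltW.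
  by rewrite ger0_norm// ler_wpM2l.
have kr : 2 / k < 3 / k by rewrite ltr_pM2r ?invr_gt0//; lra.
have kr0 : 0 <= 3 / k by rewrite divr_ge0// ltW.
have := I2_norm_bound z kr0 kr (csm_iter s cX) (kb 0 C1 kerx C10 (hX s sL) csm_kerx.1).
have := I2_norm_bound z kr0 kr (csm_iter s cY) (kb 0 C2 kery C20 (hY s sL) csm_kery.1).
have [x1 x2] := wC _ _ (csm_shift z (csm_iter s cX)).
have [y1 y2] := wC _ _ (csm_shift z (csm_iter s cY)).
move: x1 x2 y1 y2.
move: (I2 (fun q => `|iter_derive s X (q - z)|)) (I2 (fun q => `|iter_derive s Y (q - z)|)).
move: (E1 a b _) (E2 a b _) (E1 a b _) (E2 a b _) => EX1 EX2 EY1 EY2.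
move=> IX IY x1 x2 y1 y2 hIY hIX.
have hI : M * IX + M * IY <= 2 * ((C1 + C2) * 18 * M * (k ^+ size s / k)).
  have -> : 2 * ((C1 + C2) * 18 * M * (k ^+ size s / k)) =
     M * (k ^+ (size s).+1 * C1 * (2 * (3 / k)) ^+ 2) +
     M * (k ^+ (size s).+1 * C2 * (2 * (3 / k)) ^+ 2).
    by rewrite exprS; field; rewrite gt_eqF.
  by apply: lerD; apply: ler_wpM2l.
move=> e1 e2; split; first exact: half_bound e1 x1 y2 hI.
by apply: half_bound e2 x2 _ hI; rewrite normrN.
Qed.

End kernel.

(** * Uniform continuity and the mass of the mollifiers *)

Section mollify.
Variable R : realType.
Implicit Types (f g a b : R * R -> R) (p q v z : R * R) (k : R).
Local Notation plane := (measurableTypeR R * measurableTypeR R)%type.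

Lemma unif_cont f (r e : R) : continuous f -> 0 < e -> exists2 d, 0 < d <= 1 &
  forall z q, `|z| <= r -> `|q - z| <= d -> `|f q - f z| < e.
Proof.
move=> cf e0.
have := @compact_near_coveringP (R * R)%type [set p : R * R | `|p| <= r].
move=> [/(_ (@compact_closed_ball2 R r)) H _].
have : \forall d \near (0 : R)^'+, [set p : R * R | `|p| <= r] `<=`
    (fun z => forall q, `|q - z| <= d -> `|f q - f z| < e).
  apply: H => x _.
  have e2 : 0 < e / 2 by rewrite divr_gt0.
  have [d d0 hd] := continuous_eps (cf x) e2.
  have d2 : 0 < d / 2 by rewrite divr_gt0.
  exists ([set z | `|x - z| < d / 2], [set t | t < d / 2]) => /=.
    split; first by apply/nbhs_ballP; exists (d / 2) => //= z; rewrite -ball_normE.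
    exact: nbhs_right_lt.
  move=> [z t] [/= xz td] q qz.
  have h1 : `|f x - f z| < e / 2 by apply: hd; lra.
  have h2 : `|f x - f q| < e / 2.
    apply: hd; have := ler_normD (x - z) (z - q); rewrite addrA subrK [`|z - q|]distrC; lra.
  have := ler_normD (f q - f x) (f x - f z); rewrite addrA subrK [`|f q - f x|]distrC; lra.
move=> hn; have : \forall d \near (0 : R)^'+, 0 < d /\ d <= 1 /\
   [set p : R * R | `|p| <= r] `<=` (fun z => forall q, `|q - z| <= d -> `|f q - f z| < e).
  near=> d; split; first by near: d; exact: nbhs_right_gt.
  by split; near: d => //; exact: nbhs_right_le.
move=> /filter_ex[d [d0 [d1 h]]]; exists d; rewrite ?d0//.
by move=> z q zr qz; exact: h.
Unshelve. all: by end_near. Qed.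

Lemma I2_indic (T : set (R * R)) : measurable (T : set plane) -> I2 (\1_T) = fine (leb2 R T).
Proof. by move=> mT; rewrite /I2 /Rintegral integral_indic// setIT. Qed.

Lemma bcs_indic (T : set (R * R)) r : measurable (T : set plane) -> (forall p, T p -> `|p| <= r) ->
  bcs (\1_T).
Proof.
move=> mT Tr; split; first exact: measurable_indic.
exists 1, r => p; split; first by rewrite indicE; case: (_ \in _); rewrite ?normr1 ?normr0.
by move=> rp; rewrite indicE memNset// => /Tr; rewrite leNgt rp.
Qed.

Lemma I2_gt0 f p0 : bcs f -> continuous f -> (forall p, 0 <= f p) -> 0 < f p0 -> 0 < I2 f.
Proof.
move=> bf cf f0 fp.
have fp2 : 0 < f p0 / 2 by rewrite divr_gt0.
have [d d0 hd] := continuous_eps (cf p0) fp2.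
have mb := measurable_ballX p0 d.
have bi : bcs (\1_(ball p0 d : set (R * R))).
  apply: (@bcs_indic _ (`|p0| + d)) => // p; rewrite -ball_normE /= => h.
  have := ler_normD p0 (p - p0); rewrite [p0 + _]addrC subrK distrC; lra.
have : 0 < (f p0 / 2) * I2 (\1_(ball p0 d : set (R * R))).
  by rewrite mulr_gt0// I2_indic// leb2_ball ?(ltW d0)//= exprn_gt0// mulr_gt0.
rewrite -I2Z// => h; apply: lt_le_trans h _; apply: I2_le => //; first exact: bcsZ.
move=> p; rewrite indicE; have [|] := boolP (p \in _); last by rewrite mulr0.
rewrite inE -ball_normE /= => /hd; rewrite mulr1 ltr_norml => /andP[_]; lra.
Qed.

Lemma D_const f : sm f -> (forall p v, 'D_v f p = 0) -> forall p q, f p = f q.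
Proof.
move=> sf d0 p q; apply/eqP; rewrite -subr_eq0 -normr_le0.
have := @mvt_plane R f 0 q p sf; rewrite mulr0 mul0r; apply => t _; by rewrite d0 normr0.
Qed.

(** Translation invariance comes out of differentiation: the derivative in [z] is the integral of a
    derivative, hence 0. *)
Lemma mass_const k z : 0 < k -> conv (cst 1) (moll k) z = I2 (moll k).
Proof.
move=> k0; have cm := csm_moll k0.
have -> : I2 (moll k) = conv (cst 1) (moll k) 0.
  by apply: eq_I2 => q; rewrite subr0 mul1r.
apply: D_const; first exact: sm_conv (lbm_cst 1) cm.
move=> p v; rewrite (D_conv _ _ (lbm_cst 1) cm) /conv.
rewrite (_ : (fun q => _) = fun q => 'D_v (fun q => moll k (q - p)) q); last first.
  by apply/funext => q; rewrite (D_shift _ _ _ cm.1) mul1r.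
by rewrite (int_D v (csm_shift p cm).1 (csm_shift p cm).2) oppr0.
Qed.

Lemma mass_gt0 k : 0 < k -> 0 < I2 (moll k).
Proof.
move=> k0; have cm := csm_moll k0.
apply: (@I2_gt0 _ (k^-1 *: (2^-1, 2^-1))).
- exact: csm_bcs cm.
- exact: sm_cont cm.1.
- exact: moll_ge0.
- rewrite /moll scalerA divff ?gt_eqF// scale1r mulr_gt0 ?exprn_gt0//.
  rewrite /bump /sq /= (_ : _ + _ = 2^-1); last by field.
  exact: dstep_half_gt0.
Qed.

Lemma weakC_1 : weakC 0 (cst 1 : R * R -> R) (cst 1).
Proof.
move=> r f cf; rewrite mul0r /E1 /E2.
have b v := csm_bcs (csmD v cf).
have I0 v : I2 (fun q => 1 * 'D_v f q) = 0 by rewrite (I2Z _ (b v)) (int_D v cf.1 cf.2) mulr0.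
by rewrite (I2B (bcsZ 1 (b _)) (bcsZ 1 (b _))) (I2D (bcsZ 1 (b _)) (bcsZ 1 (b _))) !I0 subrr addr0 normr0.
Qed.

(** No change of variables: the constant field satisfies [weakC] with bound 0, so [moll_step] leaves
    no room for its averages to change with the scale. *)
Lemma mass_half k : 0 < k -> I2 (moll k) = I2 (moll (k / 2)).
Proof.
move=> k0; have k2 : 0 < k / 2 by rewrite divr_gt0.
have [C C0 h] := moll_step [:: [:: ] : seq (R * R)].
have [|] := h 0 (cst 1) (cst 1) [::] k 0 (lbm_cst 1) (lbm_cst 1) weakC_1 (lexx _) k0.
  by rewrite inE.
rewrite mulr0 mul0r normr_le0 => /eqP e _; move: e.
rewrite /conv /=.
under eq_I2 do rewrite subr0 mul1r.
rewrite I2B; [|exact: csm_bcs (csm_moll k0)|exact: csm_bcs (csm_moll k2)].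
by move/eqP; rewrite subr_eq0 => /eqP.
Qed.

End mollify.

(** * Extension by zero *)

Section energy.
Variable R : realType.
Implicit Types (f g u w : R * R -> R) (p q v z : R * R).

(** The pointwise form of a Caccioppoli inequality. The squared gradient is twice the Jacobian plus
    |2 dbar|^2, and half of it absorbs the cross terms with the gradient of [f]. *)
Lemma energy_pt (f fx fy c g u w ux uy wx wy N : R) : 0 <= c <= g ->
  f * f * g * ((ux - wy) * (ux - wy) + (uy + wx) * (uy + wx)) <= f * f * g * N ->
  2^-1 * (f * f * g * (ux * ux + uy * uy + wx * wx + wy * wy)) <=
  (f * f * (2 * g * (ux * wy - uy * wx)) + 2 * f * fx * (c * (u * wy - w * uy))
    - 2 * f * fy * (c * (u * wx - w * ux)))
  + (2 * (fx * fx + fy * fy) * (u * u + w * w) * c + f * f * g * N).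
Proof.
move=> /andP[c0 cg]; set P := f * f * g * N; set gr := ux * ux + _ + _ + _.
move=> h.
have h1 : f * f * c * gr <= f * f * g * gr.
  rewrite ler_wpM2r//; first by rewrite /gr; nra.
  by rewrite ler_wpM2l// -expr2 sqr_ge0.
(* Completing squares: the expansion in [h4] gives the weighted gradient together with the cross
   terms and the error in the gradient of [f]. *)
have h2 : 0 <= c * ((f * wy + 2 * fx * u) ^+ 2 + (f * uy - 2 * fx * w) ^+ 2
   + (f * wx - 2 * fy * u) ^+ 2 + (f * ux + 2 * fy * w) ^+ 2).
  by rewrite mulr_ge0// !addr_ge0// sqr_ge0.
have h3 : f * f * g * gr = f * f * g * (2 * (ux * wy - uy * wx)) +
  f * f * g * ((ux - wy) * (ux - wy) + (uy + wx) * (uy + wx)) by rewrite /gr; ring.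
have h4 : c * ((f * wy + 2 * fx * u) ^+ 2 + (f * uy - 2 * fx * w) ^+ 2
   + (f * wx - 2 * fy * u) ^+ 2 + (f * ux + 2 * fy * w) ^+ 2) =
  f * f * c * gr + 2 * (2 * f * fx * (c * (u * wy - w * uy))
    - 2 * f * fy * (c * (u * wx - w * ux)) + 2 * (fx * fx + fy * fy) * (u * u + w * w) * c).
  by rewrite /gr; ring.
rewrite h4 in h2.
have h5 : f * f * (2 * g * (ux * wy - uy * wx)) = f * f * g * (2 * (ux * wy - uy * wx)) by ring.
rewrite h5.
move: h h1 h2 h3; move: (f * f * g * gr) (f * f * c * gr) (f * f * g * (2 * _)) (_ * (_ + _)).
clear h4 h5.
move: (2 * f * fx * _) (2 * f * fy * _) (2 * _ * _ * c) P => A B C P E1 E2 E3 E4.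
lra.
Qed.

Variables (u w : R * R -> R) (s : R).
Hypotheses (su : sm u) (sw : sm w) (s0 : 0 < s).

Definition tv p := u p * u p + w p * w p.
(** A cutoff in the values of the field: 0 for |V|^2 <= s and 1 for |V|^2 >= 2s. As functions of t =
    |V|^2, [dchi] is the derivative of [chi] and [gam] that of t [chi]. *)
Definition chi p := step (s^-1 * tv p - 1).
Definition dchi p := s^-1 * dstep (s^-1 * tv p - 1).
Definition gam p := chi p + tv p * dchi p.
Definition grad2 p := 'D_(1, 0) u p * 'D_(1, 0) u p + 'D_(0, 1) u p * 'D_(0, 1) u p
  + 'D_(1, 0) w p * 'D_(1, 0) w p + 'D_(0, 1) w p * 'D_(0, 1) w p.

Lemma sm_tv : sm tv.
Proof. by apply: sm_add; exact: sm_mul. Qed.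

Lemma sm_arg : sm (fun p => s^-1 * tv p - 1).
Proof. by apply: sm_sub; [apply: sm_mul; [exact: sm_cst|exact: sm_tv]|exact: sm_cst]. Qed.

Lemma sm_chi : sm chi. Proof. exact: (sm_comp (@sm_step R) sm_arg). Qed.

Lemma sm_dchi : sm dchi.
Proof. by apply: sm_mul; [exact: sm_cst|exact: (sm_comp (@sm_dstep R) sm_arg)]. Qed.

Lemma sm_gam : sm gam.
Proof. by apply: sm_add; [exact: sm_chi|apply: sm_mul; [exact: sm_tv|exact: sm_dchi]]. Qed.

Lemma sm_grad2 : sm grad2.
Proof. by apply: sm_add; [apply: sm_add; [apply: sm_add|]|]; apply: sm_mul; exact: smD. Qed.

Lemma tv_ge0 p : 0 <= tv p.
Proof. by rewrite addr_ge0// -expr2 sqr_ge0. Qed.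

Lemma dchi_ge0 p : 0 <= dchi p.
Proof. by rewrite mulr_ge0 ?dstep_ge0// invr_ge0 ltW. Qed.

Lemma chi_ge0 p : 0 <= chi p. Proof. exact: step_ge0. Qed.

Lemma chi_le_gam p : 0 <= chi p <= gam p.
Proof. by rewrite chi_ge0 lerDl mulr_ge0 ?tv_ge0 ?dchi_ge0. Qed.

Lemma D_chi v p : 'D_v chi p = dchi p * (2 * (u p * 'D_v u p + w p * 'D_v w p)).
Proof.
rewrite (Dcomp _ _ sm_arg (@sm_step R)) DB; [|by apply: sm_mul; [exact: sm_cst|exact: sm_tv]|exact: sm_cst].
rewrite (DZ _ _ _ sm_tv) derive_cst subr0 /tv DD; [|exact: sm_mul..].
by rewrite (DM _ _ su su) (DM _ _ sw sw) /dchi /dstep; ring.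
Qed.

Lemma gam_small p : tv p <= s -> gam p = 0 /\ dchi p = 0.
Proof.
move=> h; have h' : s^-1 * tv p - 1 <= 0 by rewrite subr_le0 mulrC ler_pdivrMr// mul1r.
by rewrite /gam /chi /dchi step_neg// dstep_neg// !mulr0 addr0.
Qed.

Lemma dchi_large p : 2 * s <= tv p -> dchi p = 0.
Proof.
move=> h; rewrite /dchi dstep_ge1 ?mulr0//.
have : 2 <= s^-1 * tv p by rewrite mulrC ler_pdivlMr.
lra.
Qed.

Lemma chi_large p : 2 * s <= tv p -> chi p = 1.
Proof.
move=> h; rewrite /chi step_ge1//.
have : 2 <= s^-1 * tv p by rewrite mulrC ler_pdivlMr.
lra.
Qed.

(** The factor 1/s in [dchi] is compensated by [tv] <= 2s on its support, so the bound does not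
    depend on [s]. *)
Lemma gam_le C p : 0 <= C -> (forall x : R, dstep x <= C) -> gam p <= 1 + 2 * C.
Proof.
move=> C0 hC; rewrite /gam lerD ?step_le1//.
have [h|h] := leP (2 * s) (tv p); first by rewrite dchi_large// mulr0 mulr_ge0.
rewrite /dchi mulrA; apply: ler_pM.
- by rewrite divr_ge0 ?tv_ge0// ltW.
- exact: dstep_ge0.
- by rewrite ler_pdivrMr// ltW.
- exact: hC.
Qed.

(* [gam] is chosen so that [2 gam J], with [J] the Jacobian of [(u, w)], is a divergence. *)
Lemma energy_div f p : sm f ->
  'D_(1, 0) (fun p => f p * f p * (chi p * (u p * 'D_(0, 1) w p - w p * 'D_(0, 1) u p))) p -
  'D_(0, 1) (fun p => f p * f p * (chi p * (u p * 'D_(1, 0) w p - w p * 'D_(1, 0) u p))) p =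
  f p * f p * (2 * gam p * ('D_(1, 0) u p * 'D_(0, 1) w p - 'D_(0, 1) u p * 'D_(1, 0) w p))
  + 2 * f p * 'D_(1, 0) f p * (chi p * (u p * 'D_(0, 1) w p - w p * 'D_(0, 1) u p))
  - 2 * f p * 'D_(0, 1) f p * (chi p * (u p * 'D_(1, 0) w p - w p * 'D_(1, 0) u p)).
Proof.
move=> sf.
have sm1 v : sm (fun p => u p * 'D_v w p - w p * 'D_v u p).
  by apply: sm_sub; apply: sm_mul => //; exact: smD.
pose D2 g x y := 'D_x (fun q => 'D_y g q) p.
have E x y : 'D_x (fun p => f p * f p * (chi p * (u p * 'D_y w p - w p * 'D_y u p))) p =
   f p * f p * (chi p * (u p * D2 w x y + 'D_y w p * 'D_x u p
      - (w p * D2 u x y + 'D_y u p * 'D_x w p))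
    + (u p * 'D_y w p - w p * 'D_y u p) * (dchi p * (2 * (u p * 'D_x u p + w p * 'D_x w p))))
   + (chi p * (u p * 'D_y w p - w p * 'D_y u p)) * (2 * f p * 'D_x f p).
  rewrite DM; [|exact: sm_mul|by apply: sm_mul; [exact: sm_chi|exact: sm1]].
  rewrite DM; [|exact: sm_chi|exact: sm1].
  rewrite DB; [|by apply: sm_mul => //; exact: smD..].
  rewrite !(DM _ _ su) ?(DM _ _ sw) ?(DM _ _ sf); try exact: smD; try exact: sf.
  by rewrite D_chi; congr (_ + _ * _); ring.
apply: etrans (congr2 (fun x y => x - y) (E (1, 0) (0, 1)) (E (0, 1) (1, 0))) _.
rewrite [D2 u (1, 0) _](D_sym _ _ _ su) [D2 w (1, 0) _](D_sym _ _ _ sw) -!/(D2 _ _ _) /gam.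
have ht : tv p = u p * u p + w p * w p by [].
move: (tv p) (dchi p) (chi p) ht => t d c ->.
move: ('D_(1, 0) u p) ('D_(0, 1) u p) ('D_(1, 0) w p) ('D_(0, 1) w p) (u p) (w p)
  => ux uy wx wy U W.
move: ('D_(1, 0) f p) ('D_(0, 1) f p) (D2 u _ _) (D2 w _ _) (f p) => A1 A2 A3 A4 A5.
by ring.
Qed.

End energy.

Section energy_estimate.
Variable R : realType.
Implicit Types (f g u w a b : R * R -> R) (p q v z : R * R).
Local Notation plane := (measurableTypeR R * measurableTypeR R)%type.

Lemma div_zero r f g : csm r f -> csm r g ->
  bcs (fun p => 'D_(1, 0) f p - 'D_(0, 1) g p) /\
  I2 (fun p => 'D_(1, 0) f p - 'D_(0, 1) g p) = 0.
Proof.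
move=> cf cg; have b1 := csm_bcs (csmD (1, 0) cf); have b2 := csm_bcs (csmD (0, 1) cg).
split; first exact: bcsB.
by rewrite I2B// (int_D _ cf.1 cf.2) (int_D _ cg.1 cg.2) subrr.
Qed.

Lemma energy_bound r f (B M : R) : csm r f -> exists2 C, 0 <= C & forall u w s,
  sm u -> sm w -> 0 < s -> (forall p, `|p| <= r -> `|u p| <= B /\ `|w p| <= B) ->
  (forall p, f p != 0 -> s < tv u w p -> `|'D_(1, 0) u p - 'D_(0, 1) w p| <= M /\
     `|'D_(0, 1) u p + 'D_(1, 0) w p| <= M) ->
  I2 (fun p => f p * f p * gam u w s p * grad2 u w p) <= C.
Proof.
move=> cf; have [D D0 hD] := @dstep_bounded R.
pose fx p := 'D_(1, 0) f p; pose fy p := 'D_(0, 1) f p.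
(* [Q] collects the two errors of [energy_pt], with |V|^2 <= 2B^2, [gam] <= 1 + 2D and |2 dbar|^2 <=
   2M^2. *)
pose Q p := 2 * (2 * (B * B)) * (fx p * fx p + fy p * fy p) +
  (1 + 2 * D) * (2 * (M * M)) * (f p * f p).
have bf := csm_bcs cf; have bx : bcs fx := csm_bcs (csmD _ cf).
have by_ : bcs fy := csm_bcs (csmD _ cf).
have bQ : bcs Q.
  by apply: bcsD; apply: bcsZ; [apply: bcsD|]; apply: bcsMl => //; exact: bcs_lbm.
have xx0 (x : R) : 0 <= x * x by rewrite -expr2 sqr_ge0.
have sqM (x y : R) : `|x| <= y -> x * x <= y * y.
  by move=> xM; rewrite -expr2 -(real_normK (num_real x)) expr2 ler_pM.
have D1 : 0 <= 1 + 2 * D by rewrite addr_ge0// mulr_ge0.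
have Q0 p : 0 <= Q p.
  have k1 : 0 <= 2 * (2 * (B * B)) by rewrite mulr_ge0// mulr_ge0// xx0.
  have k2 : 0 <= (1 + 2 * D) * (2 * (M * M)) by rewrite mulr_ge0// mulr_ge0// xx0.
  by rewrite /Q addr_ge0// mulr_ge0// ?xx0// addr_ge0// xx0.
exists (2 * I2 Q); first by rewrite mulr_ge0// I2_ge0.
move=> u w s su sw s0 hB hM.
pose G1 p := f p * f p * (chi u w s p * (u p * 'D_(0, 1) w p - w p * 'D_(0, 1) u p)).
pose G2 p := f p * f p * (chi u w s p * (u p * 'D_(1, 0) w p - w p * 'D_(1, 0) u p)).
have cG v : csm r (fun p => f p * f p * (chi u w s p * (u p * 'D_v w p - w p * 'D_v u p))).
  split=> [|p /cf.2 ->]; last by rewrite !mul0r.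
  apply: sm_mul; first by apply: sm_mul; exact: cf.1.
  apply: sm_mul; first exact: sm_chi.
  by apply: sm_sub; apply: sm_mul => //; exact: smD.
have cG1 : csm r G1 := cG (0, 1).
have cG2 : csm r G2 := cG (1, 0).
have [bG iG] := div_zero cG1 cG2.
have bE : bcs (fun p => f p * f p * gam u w s p * grad2 u w p).
  apply: (csm_bcs (r := r)); split => [|p /cf.2 ->]; last by rewrite !mul0r.
  apply: sm_mul; last exact: sm_grad2.
  apply: sm_mul; last exact: sm_gam.
  by apply: sm_mul; exact: cf.1.
have pt p : 2^-1 * (f p * f p * gam u w s p * grad2 u w p) <=
    'D_(1, 0) G1 p - 'D_(0, 1) G2 p + Q p.
  have cp := chi_le_gam u w s0 p.
  have hN : f p * f p * gam u w s p *
     (('D_(1, 0) u p - 'D_(0, 1) w p) * ('D_(1, 0) u p - 'D_(0, 1) w p) +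
      ('D_(0, 1) u p + 'D_(1, 0) w p) * ('D_(0, 1) u p + 'D_(1, 0) w p)) <=
     f p * f p * gam u w s p * (2 * (M * M)).
    have [->|fp] := eqVneq (f p) 0; first by rewrite !mul0r.
    have [ts|ts] := leP (tv u w p) s; first by rewrite (gam_small s0 ts).1 mulr0 !mul0r.
    have [h1 h2] := hM p fp ts.
    have g0 : 0 <= gam u w s p by move: cp => /andP[/le_trans]; exact.
    apply: ler_wpM2l; first by rewrite mulr_ge0// -expr2 sqr_ge0.
    by rewrite [2 * _]mulr_natl mulr2n; apply: lerD; exact: sqM.
  apply: le_trans (energy_pt ('D_(1, 0) f p) ('D_(0, 1) f p) (u p) (w p) cp hN) _.
  rewrite energy_div; [|exact: su|exact: sw|exact: cf.1].
  rewrite lerD2l /Q; apply: lerD; last first.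
    have g1 := gam_le u w s0 p D0 hD.
    rewrite -[X in X <= _]mulrA [X in X <= _]mulrC; apply: ler_wpM2r => //.
    by apply: ler_wpM2r => //; rewrite mulr_ge0// xx0.
  have [pr|pr] := leP `|p| r; last first.
    by rewrite /fx /fy !(csmD _ cf).2// !(mulr0, mul0r, addr0).
  have [h1 h2] := hB p pr.
  have c1 : chi u w s p <= 1 by exact: step_le1.
  have c0 : 0 <= chi u w s p by exact: chi_ge0.
  have t1 : (u p * u p + w p * w p) * chi u w s p <= 2 * (B * B).
    apply: (@le_trans _ _ (u p * u p + w p * w p)).
      by rewrite ler_piMr// addr_ge0.
    by rewrite [2 * _]mulr_natl mulr2n; apply: lerD; exact: sqM.
  rewrite -[X in X <= _]mulrA [X in _ <= X](_ : _ =
    2 * (fx p * fx p + fy p * fy p) * (2 * (B * B))); last by ring.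
  by apply: ler_wpM2l => //; rewrite mulr_ge0// addr_ge0.
rewrite mulrC -ler_pdivrMr// mulrC -I2Z//.
have -> : I2 Q = I2 (fun p => 'D_(1, 0) G1 p - 'D_(0, 1) G2 p + Q p).
  by have := I2D bG bQ; rewrite iG add0r => ->.
by apply: I2_le => //; [exact: bcsZ|exact: bcsD].
Qed.

End energy_estimate.

(** * Smooth approximation away from the zeros *)

Section approximation.
Variable R : realType.
Implicit Types (f g u w a b : R * R -> R) (p q v z : R * R).
Local Notation plane := (measurableTypeR R * measurableTypeR R)%type.

(** The local version of [weakC]: only test functions with compact support inside [A], which is all
    that a competitor provides. *)
Definition weakA (A : set (R * R)) (M : R) a b := forall r f (L : set (R * R)), csm r f ->
  compact L -> L `<=` A -> (forall p, ~ L p -> f p = 0) ->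
  `|E1 a b f| <= M * I2 (fun q => `|f q|) /\ `|E2 a b f| <= M * I2 (fun q => `|f q|).

Lemma avg_close a r d k p : continuous a -> 0 < k ->
  (forall q, `|q - p| <= k^-1 -> `|a q - a p| < d) -> 0 <= d -> csm r (moll k) ->
  `|(I2 (moll k))^-1 * conv a (moll k) p - a p| <= d.
Proof.
move=> ca k0 h d0 cm; have la := continuous_lbm ca.
have m0 := mass_gt0 k0; have cmk := csm_moll k0.
have b1 := bcs_conv p la cmk; have b2 := bcs_conv p (lbm_cst 1) cmk.
have mE := mass_const p k0.
have E : (I2 (moll k))^-1 * conv a (moll k) p - a p =
  (I2 (moll k))^-1 * I2 (fun q => a q * moll k (q - p) - a p * (1 * moll k (q - p))).
  rewrite I2B//; last exact: bcsZ.
  rewrite (I2Z _ b2) -[I2 (fun q => 1 * _)]/(conv (cst 1) (moll k) p) mE -/(conv a (moll k) p).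
  by rewrite mulrBr mulrCA mulVf ?mulr1// gt_eqF.
rewrite E normrM gtr0_norm ?invr_gt0// mulrC ler_pdivrMr//.
have b3 := bcsB b1 (bcsZ (a p) b2).
apply: le_trans (I2_abs b3) _.
rewrite -[X in _ <= _ * X]mE /conv -(I2Z _ b2).
apply: I2_le; [exact: bcs_abs|exact: bcsZ|move=> q].
rewrite mul1r -mulrBl normrM (ger0_norm (moll_ge0 _ _)).
have [hq|hq] := leP `|q - p| k^-1.
  by rewrite ler_wpM2r ?moll_ge0// ltW// h.
by rewrite cmk.2// !mulr0.
Qed.

Lemma ball_shift_compact (p : R * R) (r : R) : compact [set q : R * R | `|q - p| <= r].
Proof.
have -> : [set q : R * R | `|q - p| <= r] = (fun q => q + p) @` [set q : R * R | `|q| <= r].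
  apply/seteqP; split => [q /= h|_ [q /= h <-]]; last by rewrite /= addrK.
  by exists (q - p) => //; rewrite subrK.
apply: continuous_compact; last exact: compact_closed_ball2.
by apply: continuous_subspaceT => q; apply: cvgD; [exact: cvg_id|exact: cvg_cst].
Qed.

Lemma E_conv a b m r p : lbm a -> lbm b -> csm r m ->
  E1 a b (fun q => m (q - p)) = - ('D_(1, 0) (conv a m) p - 'D_(0, 1) (conv b m) p) /\
  E2 a b (fun q => m (q - p)) = - ('D_(0, 1) (conv a m) p + 'D_(1, 0) (conv b m) p).
Proof.
move=> la lb cm; rewrite !(D_conv _ _ la cm) !(D_conv _ _ lb cm).
have bb v g (lg : lbm g) : bcs (fun q => g q * 'D_v m (q - p)) := bcs_conv p lg (csmD v cm).
have b1 := bb (1, 0) a la; have b2 := bb (0, 1) b lb.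
have b3 := bb (1, 0) b lb; have b4 := bb (0, 1) a la.
split.
  rewrite -opprD !opprK; apply: etrans (I2B b1 b2); apply: eq_I2 => q.
  by rewrite (D_shift _ _ _ cm.1) (D_shift _ _ _ cm.1).
rewrite -opprD !opprK addrC; apply: etrans (I2D b3 b4); apply: eq_I2 => q.
by rewrite (D_shift _ _ _ cm.1) (D_shift _ _ _ cm.1).
Qed.

(** Mollify at a scale where [a] and [b] oscillate by less than [d]. Where one of them exceeds [d]
    the mollifying square cannot meet their zeros, so it lies in [A] and the weak bound becomes
    pointwise. *)
Lemma approx (A : set (R * R)) M a b r d : continuous a -> continuous b -> 0 <= M -> 0 < d ->
  (forall p, ~ A p -> a p = 0 /\ b p = 0) -> weakA A M a b ->
  exists u w, [/\ sm u, sm w,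
    forall p, `|p| <= r -> `|u p - a p| <= d /\ `|w p - b p| <= d &
    forall p, `|p| <= r -> d < `|a p| \/ d < `|b p| ->
      `|'D_(1, 0) u p - 'D_(0, 1) w p| <= M /\ `|'D_(0, 1) u p + 'D_(1, 0) w p| <= M].
Proof.
move=> ca cb M0 d0 ab0 wA.
have [e1 /andP[e10 e11] h1] := unif_cont r ca d0.
have [e2 /andP[e20 e21] h2] := unif_cont r cb d0.
pose e := Num.min e1 e2; pose k := e^-1.
have e0 : 0 < e by rewrite lt_min e10.
have k0 : 0 < k by rewrite invr_gt0.
have ke : k^-1 = e by rewrite invrK.
have la := continuous_lbm ca; have lb := continuous_lbm cb.
have cm := csm_moll k0; have m0 := mass_gt0 k0.
pose c := (I2 (moll k))^-1; have c0 : 0 < c by rewrite invr_gt0.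
have su := sm_conv la cm; have sw := sm_conv lb cm.
exists (fun p => c * conv a (moll k) p), (fun p => c * conv b (moll k) p); split.
- by apply: sm_mul; [exact: sm_cst|].
- by apply: sm_mul; [exact: sm_cst|].
- move=> p pr; split.
    apply: (avg_close ca k0 _ (ltW d0) cm) => q; rewrite ke le_min => /andP[hq _].
    exact: h1.
  apply: (avg_close cb k0 _ (ltW d0) cm) => q; rewrite ke le_min => /andP[_ hq].
  exact: h2.
- move=> p pr hp.
  rewrite !(DZ _ _ _ su) !(DZ _ _ _ sw).
  have cmp := csm_shift p cm.
  have sub : [set q : R * R | `|q - p| <= e] `<=` A.
    move=> q /= qp; apply: contrapT => /ab0[aq bq].
    have := qp; rewrite le_min => /andP[qp1 qp2].
    case: hp => hp.
      by have := h1 _ _ pr qp1; rewrite aq sub0r normrN ltNge (ltW hp).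
    by have := h2 _ _ pr qp2; rewrite bq sub0r normrN ltNge (ltW hp).
  have sup q : ~ `|q - p| <= e -> moll k (q - p) = 0.
    by move=> h; rewrite cm.2// ke ltNge; exact/negP.
  have [w1 w2] := wA _ _ _ cmp (@ball_shift_compact p e) sub sup.
  have I1 : I2 (fun q => `|moll k (q - p)|) = I2 (moll k).
    rewrite -(mass_const p k0); apply: eq_I2 => q.
    by rewrite mul1r ger0_norm// moll_ge0.
  have [E1E E2E] := E_conv p la lb cm.
  move: w1 w2; rewrite I1 E1E E2E !normrN.
  move: ('D_(1, 0) _ p) ('D_(0, 1) _ p) ('D_(0, 1) _ p) ('D_(1, 0) _ p) => x1 x2 x3 x4 w1 w2.
  have fin (x : R) : `|x| <= M * I2 (moll k) -> `|c * x| <= M.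
    by move=> hx; rewrite normrM gtr0_norm// mulrC ler_pdivrMr.
  by rewrite -mulrBr -mulrDr; split; exact: fin.
Qed.

Definition thin a b (r d : R) : set (R * R) :=
  [set p | [/\ `|p| <= r, 0 < Num.max `|a p| `|b p| & Num.max `|a p| `|b p| <= d]].

Lemma measurable_thin a b r d : continuous a -> continuous b ->
  measurable (thin a b r d : set plane).
Proof.
move=> ca cb; pose N p := Num.max `|a p| `|b p|.
have cN : continuous N.
  move=> p; have : (fun q => `|(a q, b q)| : R) @ p --> (`|(a p, b p)| : R).
    by apply: cvg_norm; exact: (cvg_pair (ca p) (cb p)).
  exact.
have -> : thin a b r d = [set p : R * R | `|p| <= r] `&` N @^-1` [set x | 0 < x] `&` N @^-1` [set x | x <= d].
  by apply/seteqP; split => [p [h1 h2 h3]|p [[h1 h2] h3]].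
apply: measurableI; first apply: measurableI.
- apply: closed_measurable2; apply: compact_closed (@compact_closed_ball2 R r).
  exact: norm_hausdorff.
- by apply: open_measurable2; apply: open_comp; [move=> ? _; exact: cN|exact: open_gt].
- by apply: closed_measurable2; apply: closed_comp; [move=> ? _; exact: cN|exact: closed_le].
Qed.

(** The zeros are excluded from [thin], so these sets decrease to the empty set even if the zero set
    has positive measure. *)
Lemma thin_small a b r e : continuous a -> continuous b -> 0 < e ->
  exists2 d0, 0 < d0 & forall d, d <= d0 -> I2 (\1_(thin a b r d)) <= e.
Proof.
move=> ca cb e0.
have mT d := measurable_thin r d ca cb.
have Tr d p : thin a b r d p -> `|p| <= r by case.
have bT d : bcs (\1_(thin a b r d)) := bcs_indic (mT d) (@Tr d).
pose F n := thin a b r n.+1%:R^-1.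
have fin d : (leb2 R (thin a b r d) < +oo)%E.
  apply: (@le_lt_trans _ _ (leb2 R (ball (0 : R * R) (`|r| + 1)))).
    apply: le_measure; rewrite ?inE.
    - exact: (mT d).
    - exact: measurable_ballX.
    move=> p /Tr pr; rewrite -ball_normE /= sub0r normrN.
    by have := ler_norm r; lra.
  by rewrite leb2_ball ?ltry// addr_ge0.
have F0 : \bigcap_n F n = set0.
  apply/seteqP; split => // p h.
  have [_ h1 _] := h 0%N I.
  have [n _ /(_ _ (leqnn _)) ne] := near_infty_natSinv_lt (PosNum h1).
  by have [_ _] := h n I; rewrite leNgt ne.
have niF : nonincreasing_seq F.
  apply/nonincreasing_seqP => n; apply/subsetPset => p [h1 h2 h3]; split => //.
  by apply: le_trans h3 _; rewrite lef_pV2 ?posrE ?ltr0n// ler_nat.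
have h : leb2 R \o F @ \oo --> 0%E.
  rewrite -(measure0 (leb2 R)) -F0; apply: nonincreasing_cvg_mu => //.
  - exact: fin.
  - by move=> n; exact: mT.
  - by apply: bigcap_measurable => // n _; exact: mT.
have /fine_cvgP[_ h2] := h.
have [n _ /(_ _ (leqnn _)) hn] := (cvgrPdist_lt _ _).1 h2 _ e0.
exists n.+1%:R^-1; first by rewrite invr_gt0.
move=> d dn.
apply: (@le_trans _ _ (I2 (\1_(F n)))).
  apply: I2_le; [exact: (bT d)|exact: (bT n.+1%:R^-1)|move=> p].
  rewrite !indicE; have [|] := boolP (p \in thin _ _ _ _).
    rewrite inE => -[h3 h4 h5]; rewrite mem_set//; split => //; exact: le_trans dn.
  by case: (_ \in _).
move: hn; rewrite /= sub0r normrN I2_indic; last exact: mT.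
by rewrite ger0_norm ?fine_ge0// => /ltW.
Qed.

End approximation.

(** * A Rado theorem for fields with bounded dbar *)

Section rado.
Variable R : realType.
Implicit Types (f g u w a b : R * R -> R) (p q v z : R * R).
Local Notation plane := (measurableTypeR R * measurableTypeR R)%type.

(** The error made by replacing [f] with [f] times the cutoff [c]. The three terms are the smallness
    of the field where [c] is not 1, a small multiple [k] of the energy density, and a quantity to
    be integrated over a thin set. *)
Lemma cut_pt (f fx fy a b c u w ux uy wx wy d k t D g F : R) :
  0 <= c <= 1 -> `|a| <= 3 * t -> `|b| <= 3 * t -> `|u| <= 2 * t -> `|w| <= 2 * t ->
  0 <= d -> t ^+ 2 * d <= D -> t ^+ 2 * d <= g -> 0 < k -> 0 <= t -> `|fx| <= F -> `|fy| <= F ->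
  `|(a * fx - b * fy) - (a * (f * (d * (2 * (u * ux + w * wx))) + c * fx) -
      b * (f * (d * (2 * (u * uy + w * wy))) + c * fy))| <=
  6 * t * F + (12 * k) * (f * f * g * (ux * ux + uy * uy + wx * wx + wy * wy)) + 12 * D / k.
Proof.
move=> /andP[c0 c1] ha hb hu hw d0 dD dg k0 t0 hfx hfy.
have yy x : 0 <= x * x :> R by rewrite -expr2 sqr_ge0.
(* The derivative of the cutoff is of size 1/t times the gradient and meets a field of size t; this
   trades the resulting first power of the gradient for the energy. *)
have amgm (x : R) : `|f| * `|x| <= k * (f * f * (x * x)) + (4 * k)^-1.
  rewrite -normrM; set y := f * x.
  have -> : f * f * (x * x) = `|y| ^+ 2 by rewrite real_normK ?num_real// /y; ring.
  have : 0 <= (2 * k * `|y| - 1) ^+ 2 / (4 * k) by rewrite divr_ge0 ?sqr_ge0// ltW// mulr_gt0.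
  have -> : (2 * k * `|y| - 1) ^+ 2 / (4 * k) = k * `|y| ^+ 2 + (4 * k)^-1 - `|y|.
    by field; rewrite gt_eqF.
  lra.
have term (x y z : R) : `|x| <= 3 * t ->
    `|f * (x * (d * (2 * (u * y + w * z))))| <= 12 * (t ^+ 2 * d) * (`|f| * `|y| + `|f| * `|z|).
  move=> hx; rewrite !normrM (ger0_norm d0) normr_nat.
  have h1 : `|u * y + w * z| <= 2 * t * (`|y| + `|z|).
    apply: le_trans (ler_normD _ _) _; rewrite !normrM mulrDr.
    by apply: lerD; apply: ler_wpM2r.
  have -> : 12 * (t ^+ 2 * d) * (`|f| * `|y| + `|f| * `|z|) =
     `|f| * ((3 * t) * (d * (2 * (2 * t * (`|y| + `|z|))))) by ring.
  apply: ler_wpM2l => //; apply: ler_pM => //; first by rewrite !mulr_ge0.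
  by apply: ler_wpM2l => //; apply: ler_wpM2l.
have -> : (a * fx - b * fy) - (a * (f * (d * (2 * (u * ux + w * wx))) + c * fx) -
      b * (f * (d * (2 * (u * uy + w * wy))) + c * fy)) =
   (1 - c) * (a * fx - b * fy) + (f * (b * (d * (2 * (u * uy + w * wy)))) -
      f * (a * (d * (2 * (u * ux + w * wx))))) by ring.
apply: le_trans (ler_normD _ _) _; rewrite -addrA; apply: lerD.
  rewrite normrM ger0_norm ?subr_ge0//.
  have h1 : `|a * fx - b * fy| <= 3 * t * F + 3 * t * F.
    by apply: le_trans (ler_normB _ _) _; rewrite !normrM; apply: lerD; apply: ler_pM.
  have -> : 6 * t * F = 1 * (3 * t * F + 3 * t * F) by ring.
  by apply: ler_pM => //; [rewrite subr_ge0|rewrite gerBl].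
apply: le_trans (ler_normB _ _) _.
apply: le_trans (lerD (term _ uy wy hb) (term _ ux wx ha)) _.
rewrite -mulrDr; set S := _ + _.
have hS : S <= k * (f * f * (ux * ux + uy * uy + wx * wx + wy * wy)) + k^-1.
  have := amgm ux; have := amgm uy; have := amgm wx; have := amgm wy.
  rewrite /S.
  have -> : k^-1 = (4 * k)^-1 + (4 * k)^-1 + (4 * k)^-1 + (4 * k)^-1.
    by field; rewrite gt_eqF.
  move: (_^-1) (`|f| * `|ux|) (`|f| * `|uy|) (`|f| * `|wx|) (`|f| * `|wy|) => i x1 x2 x3 x4.
  rewrite !mulrDr; lra.
have e0 : 0 <= t ^+ 2 * d by rewrite mulr_ge0// sqr_ge0.
set G := ux * ux + _ + _ + _ in hS *.
have G0 : 0 <= f * f * G by rewrite mulr_ge0// !addr_ge0.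
apply: (@le_trans _ _ (12 * (t ^+ 2 * d) * (k * (f * f * G) + k^-1))).
  by apply: ler_wpM2l => //; rewrite mulr_ge0.
rewrite mulrDr; apply: lerD.
  have -> : 12 * (t ^+ 2 * d) * (k * (f * f * G)) = 12 * k * (f * f * G) * (t ^+ 2 * d) by ring.
  have -> : 12 * k * (f * f * g * G) = 12 * k * (f * f * G) * g by ring.
  by apply: ler_wpM2l => //; rewrite mulr_ge0// mulr_ge0// ltW.
apply: ler_wpM2r; first by rewrite invr_ge0 ltW.
by apply: ler_wpM2l.
Qed.

Lemma closed_ball_meas r : measurable ([set p | `|p| <= r] : set plane).
Proof.
by apply: closed_measurable2; apply: compact_closed (@compact_closed_ball2 R r);
  exact: norm_hausdorff.
Qed.

Lemma continuous_pairnorm a b : continuous a -> continuous b ->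
  continuous (fun p => `|(a p, b p)| : R).
Proof. by move=> ca cb p; apply: cvg_norm; exact: (cvg_pair (ca p) (cb p)). Qed.

Lemma E1_cut a b r f c : lbm a -> lbm b -> csm r f -> csm r (fun p => f p * c p) ->
  bcs (fun p => (a p * 'D_(1, 0) f p - b p * 'D_(0, 1) f p) -
    (a p * 'D_(1, 0) (fun q => f q * c q) p - b p * 'D_(0, 1) (fun q => f q * c q) p)) /\
  E1 a b f = E1 a b (fun p => f p * c p) +
    I2 (fun p => (a p * 'D_(1, 0) f p - b p * 'D_(0, 1) f p) -
    (a p * 'D_(1, 0) (fun q => f q * c q) p - b p * 'D_(0, 1) (fun q => f q * c q) p)).
Proof.
move=> la lb cf; move: (fun p => f p * c p) => g cg.
have B h (ch : csm r h) : bcs (fun p => a p * 'D_(1, 0) h p - b p * 'D_(0, 1) h p).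
  by apply: bcsB; [exact: bcsM_csm la (csmD _ ch)|exact: bcsM_csm lb (csmD _ ch)].
by split; [apply: bcsB; exact: B|rewrite (I2B (B _ cf) (B _ cg)) addrC subrK].
Qed.

(** As in Rado's theorem, the zero set of a continuous field is removable without any assumption on
    its geometry: cut the field off near its zeros and let the level [t] tend to 0. *)
Lemma rado_E1 (A : set (R * R)) M a b : continuous a -> continuous b -> 0 <= M ->
  (forall p, ~ A p -> a p = 0 /\ b p = 0) -> weakA A M a b ->
  forall r f, csm r f -> `|E1 a b f| <= M * I2 (fun q => `|f q|).
Proof.
move=> ca cb M0 ab0 wA r f cf; apply/ler_addgt0Pr => e e0.
have la := continuous_lbm ca; have lb := continuous_lbm cb.
have [F1 F10 hF1] := csm_bounded (csmD (1, 0) cf).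
have [F2 F20 hF2] := csm_bounded (csmD (0, 1) cf).
pose F := F1 + F2.
have [B1 hB1] := la.2 r; have [B2 hB2] := lb.2 r.
pose B := `|B1| + `|B2| + 1.
have [D D0 hD] := @dstep_bounded R.
have [C C0 hC] := energy_bound B M cf.
have bT0 := @bcs_indic R _ r (closed_ball_meas r) (fun p h => h).
pose Ar := I2 (\1_[set p : R * R | `|p| <= r]).
have Ar0 : 0 <= Ar by apply: I2_ge0 => p; rewrite indicE; case: (_ \in _).
have p1 (x : R) : 0 <= x -> 0 < x + 1 by move=> x0; rewrite ltr_wpDl.
have e3 : 0 < e / 3 by rewrite divr_gt0.
(* The order of choices matters: [k] makes the energy term at most e/3, then [e'] is the measure of
   the thin set that this [k] tolerates, and only then is the level fixed. *)
pose k := e / 3 / (12 * (C + 1)).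
have k0 : 0 < k by apply: divr_gt0 => //; apply: mulr_gt0 => //; exact: p1.
pose e' := e / 3 * k / (12 * (D + 1)).
have e'0 : 0 < e' by apply: divr_gt0; apply: mulr_gt0 => //; exact: p1.
have [t1 t10 ht1] := thin_small r ca cb e'0.
have F0 : 0 <= F by rewrite addr_ge0.
pose t2 := e / 3 / (6 * (F + 1) * (Ar + 1)).
have t20 : 0 < t2.
  by apply: divr_gt0 => //; apply: mulr_gt0; [apply: mulr_gt0 => //|]; exact: p1.
(* In the transition region the field is at most 3t, so t <= t1/3 places that region in the thin set
   of level [t1]; t <= t2 handles the term linear in [t]. *)
pose t := Num.min 1 (Num.min (t1 / 3) t2).
have t0 : 0 < t by rewrite !lt_min ltr01 t20 divr_gt0.
have [tl1 tl2 tl3] : [/\ t <= 1, t <= t1 / 3 & t <= t2].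
  by have := lexx t; rewrite {2}/t !le_min => /and3P.
have kE : k * (12 * (C + 1)) = e / 3 by rewrite divfK// gt_eqF// mulr_gt0 ?p1.
have t2E : t2 * (6 * (F + 1) * (Ar + 1)) = e / 3.
  by rewrite divfK// gt_eqF// mulr_gt0 ?mulr_gt0 ?p1.
clearbody k t t2.
have e'E : 12 * (D + 1) / k * e' = e / 3 by rewrite /e'; field; rewrite !gt_eqF ?p1.
have BE : `|B1| + `|B2| + 1 <= B by [].
have ArE : Ar = I2 (\1_[set p : R * R | `|p| <= r]) by [].
have [FE1 FE2] : F1 <= F /\ F2 <= F by rewrite lerDl lerDr.
clearbody e' F B Ar.
(* With an approximation error of t/8, |(u, w)| > t forces one of |a|, |b| above t/4, since 2
   (3t/8)^2 < t^2. So the cut off test function has compact support in [A]. *)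
have t80 : 0 < t / 8 by rewrite divr_gt0.
have [u [w [su sw uw hM]]] := approx r ca cb M0 t80 ab0 wA.
have s0 : 0 < t ^+ 2 by rewrite exprn_gt0.
have bnd (x y z : R) : `|x - y| <= t / 8 -> `|y| <= z -> `|x| <= z + t / 8.
  by move=> h1 h2; have := ler_normD (x - y) y; rewrite subrK; move: h1 h2; clear; lra.
have big p : `|p| <= r -> t ^+ 2 < tv u w p -> t / 4 < `|a p| \/ t / 4 < `|b p|.
  move=> pr ht; have [u1 w1] := uw p pr.
  have [ha|ha] := leP `|a p| (t / 4); last by left.
  have [hb|hb] := leP `|b p| (t / 4); last by right.
  have := bnd _ _ _ u1 ha; have := bnd _ _ _ w1 hb => h1 h2.
  exfalso; move: ht; apply/negP; rewrite -leNgt /tv -!expr2.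
  have sqr (x : R) : `|x| <= t / 4 + t / 8 -> x ^+ 2 <= (t / 4 + t / 8) ^+ 2.
    move=> hx; rewrite -(real_normK (num_real x)) ler_pXn2r ?nnegrE//.
    by move: t0; clear; lra.
  by apply: le_trans (lerD (sqr _ h2) (sqr _ h1)) _; move: (sqr_ge0 t); clear; nra.
have cfc : csm r (fun p => f p * chi u w (t ^+ 2) p).
  split=> [|p /cf.2 ->]; last by rewrite mul0r.
  by apply: sm_mul; [exact: cf.1|exact: sm_chi].
pose N p : R := `|(a p, b p)|.
have cN : continuous N by exact: continuous_pairnorm.
have cL : compact ([set p : R * R | `|p| <= r] `&` N @^-1` [set x | t / 4 <= x]).
  apply: compact_closedI; first exact: compact_closed_ball2.
  by apply: closed_comp; [move=> ? _; exact: cN|exact: closed_ge].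
have LA : [set p : R * R | `|p| <= r] `&` N @^-1` [set x | t / 4 <= x] `<=` A.
  move=> p [_ /= hp]; apply: contrapT => /ab0[ap bp]; move: hp.
  by rewrite /N ap bp prod_normE /= normr0 maxxx; move: t0; clear; lra.
have L0 p : ~ ([set p : R * R | `|p| <= r] `&` N @^-1` [set x | t / 4 <= x]) p ->
    f p * chi u w (t ^+ 2) p = 0.
  move=> hL; have [pr|pr] := leP `|p| r; last by rewrite cf.2// mul0r.
  have [hs|hs] := leP (tv u w p) (t ^+ 2).
    have [g0 _] := gam_small s0 hs; have := chi_le_gam u w s0 p.
    by rewrite g0 => /le_anti <-; rewrite mulr0.
  exfalso; apply: hL; split => //=; rewrite /N prod_normE /= le_max.
  by apply/orP; have [/ltW|/ltW] := big p pr hs; [left|right].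
have [E1c _] := wA _ _ _ cfc cL LA L0.
have [bd ->] := E1_cut la lb cf cfc.
apply: le_trans (ler_normD _ _) _; apply: lerD.
  apply: le_trans E1c _; apply: ler_wpM2l => //; apply: I2_le.
  - exact: bcs_abs (csm_bcs cfc).
  - exact: bcs_abs (csm_bcs cf).
  - move=> p; rewrite normrM ler_piMr// ger0_norm ?chi_ge0//; exact: step_le1.
apply: le_trans (I2_abs bd) _.
have bthin := @bcs_indic R _ r (measurable_thin r t1 ca cb) (fun p h => let: And3 h1 _ _ := h in h1).
have bE : bcs (fun p => f p * f p * gam u w (t ^+ 2) p * grad2 u w p).
  apply: (csm_bcs (r := r)); split => [|p /cf.2 ->]; last by rewrite !mul0r.
  apply: sm_mul; last exact: sm_grad2.
  apply: sm_mul; last exact: sm_gam.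
  by apply: sm_mul; exact: cf.1.
have hE : I2 (fun p => f p * f p * gam u w (t ^+ 2) p * grad2 u w p) <= C.
  apply: hC => // [p pr|p fp ts].
    have [u1 w1] := uw p pr; split.
      have := bnd _ _ _ u1 (hB1 p pr); have := ler_norm B1; have := normr_ge0 B2.
      by move: BE tl1; clear; lra.
    have := bnd _ _ _ w1 (hB2 p pr); have := ler_norm B2; have := normr_ge0 B1.
    by move: BE tl1; clear; lra.
  have pr : `|p| <= r by rewrite leNgt; apply: contra fp => /cf.2 ->.
  by apply: hM => //; have := big p pr ts => -[h|h]; [left|right]; move: h t0; clear; lra.
have bR := bcsD (bcsD (bcsZ (6 * t * F) bT0) (bcsZ (12 * k) bE)) (bcsZ (12 * D / k) bthin).
apply: le_trans (I2_le (bcs_abs bd) bR _) _; last first.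
  rewrite I2D; [|exact: (bcsD (bcsZ (6 * t * F) bT0) (bcsZ (12 * k) bE))|exact: bcsZ].
  rewrite I2D; [|exact: bcsZ|exact: bcsZ].
  rewrite !I2Z//.
  have := ht1 t1 (lexx _).
  move: hE; rewrite -ArE; move: (I2 _) (I2 _) => y x hx hy.
  have h1 : 6 * t * F * Ar <= e / 3.
    rewrite -t2E; have -> : 6 * t * F * Ar = t * (6 * F * Ar) by ring.
    apply: ler_pM => //; [exact: ltW|by apply: mulr_ge0 => //; apply: mulr_ge0|].
    apply: ler_pM => //; [by apply: mulr_ge0| |by rewrite lerDl].
    by apply: ler_wpM2l => //; rewrite lerDl.
  have h2 : 12 * k * x <= e / 3.
    rewrite -kE; have -> : 12 * k * x = k * (12 * x) by ring.
    apply: ler_wpM2l; [exact: ltW|apply: ler_wpM2l => //; move: hx; clear; lra].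
  have h3 : 12 * D / k * y <= e / 3.
    rewrite -e'E; have kp : 0 <= k^-1 by rewrite invr_ge0 ltW.
    have -> : 12 * D / k * y = k^-1 * (12 * D * y) by ring.
    have -> : 12 * (D + 1) / k * e' = k^-1 * (12 * (D + 1) * e') by ring.
    apply: ler_wpM2l => //; apply: (@le_trans _ _ (12 * D * e')).
      by apply: ler_wpM2l => //; rewrite mulr_ge0.
    by apply: ler_wpM2r; [exact: ltW|apply: ler_wpM2l => //; rewrite lerDl].
  by move: h1 h2 h3; clear; lra.
move=> p; rewrite !(DM _ _ cf.1 (@sm_chi R u w (t ^+ 2) su sw)).
have f0 := cf.2 p; have [dx dy] := ((csmD (1, 0) cf).2 p, (csmD (0, 1) cf).2 p).
have gE0 : 0 <= f p * f p * gam u w (t ^+ 2) p * grad2 u w p.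
  apply: mulr_ge0; last by rewrite /grad2 -!expr2 !addr_ge0 ?sqr_ge0.
  apply: mulr_ge0; first by rewrite -expr2 sqr_ge0.
  by case/andP: (chi_le_gam u w s0 p) => /le_trans; exact.
have rhs0 : 0 <= 6 * t * F * \1_[set p : R * R | `|p| <= r] p +
    12 * k * (f p * f p * gam u w (t ^+ 2) p * grad2 u w p) +
    12 * D / k * \1_(thin a b r t1) p.
  move: gE0; move: (_ * grad2 u w p) => E hE0.
  apply: addr_ge0; first apply: addr_ge0.
  - apply: mulr_ge0; first by apply: mulr_ge0 => //; apply: mulr_ge0 => //; exact: ltW.
    by rewrite indicE; case: (_ \in _).
  - by apply: mulr_ge0 => //; apply: mulr_ge0 => //; exact: ltW.
  - apply: mulr_ge0; last by rewrite indicE; case: (_ \in _).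
    by apply: divr_ge0; [exact: mulr_ge0|exact: ltW].
have zero (X Y c a' b' : R) :
   `|a' * 0 - b' * 0 - (a' * (0 * X + c * 0) - b' * (0 * Y + c * 0))| = 0.
  by rewrite !(mul0r, mulr0, subr0, addr0) normr0.
have zero2 (f' x y a' b' : R) :
   `|a' * x - b' * y - (a' * (f' * 0 + 1 * x) - b' * (f' * 0 + 1 * y))| = 0.
  by rewrite !(mulr0, mul1r, add0r) subrr normr0.
have [pr|pr] := leP `|p| r; last first.
  by move: rhs0; rewrite (f0 pr) (dx pr) (dy pr) zero.
have fx : `|'D_(1, 0) f p| <= F := le_trans (hF1 p) FE1.
have fy : `|'D_(0, 1) f p| <= F := le_trans (hF2 p) FE2.
have c01 : 0 <= chi u w (t ^+ 2) p <= 1 by rewrite chi_ge0 step_le1.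
have cg := chi_le_gam u w s0 p.
have [hs|hs] := leP (2 * t ^+ 2) (tv u w p).
  have -> : 'D_(1, 0) (chi u w (t ^+ 2)) p = 0.
    by rewrite D_chi// (dchi_large s0 hs) mul0r.
  have -> : 'D_(0, 1) (chi u w (t ^+ 2)) p = 0.
    by rewrite D_chi// (dchi_large s0 hs) mul0r.
  by rewrite (chi_large s0 hs) zero2.
have -> : \1_[set p : R * R | `|p| <= r] p = 1 :> R by rewrite indicE mem_set.
rewrite mulr1.
have [u1 w1] := uw p pr.
have uv2 : `|u p| <= 2 * t /\ `|w p| <= 2 * t.
  have sqr (x : R) : x ^+ 2 <= 2 * t ^+ 2 -> `|x| <= 2 * t.
    move=> hx; rewrite -(@ler_pXn2r _ 2)// ?nnegrE ?mulr_ge0 ?(ltW t0)//.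
    by rewrite real_normK ?num_real//; move: hx (sqr_ge0 t); clear; nra.
  split; apply: sqr; apply: le_trans (ltW hs); rewrite /tv -!expr2.
    by rewrite lerDl sqr_ge0.
  by rewrite lerDr sqr_ge0.
have ab3 : `|a p| <= 3 * t /\ `|b p| <= 3 * t.
  have [h1 h2] := uv2; rewrite distrC in u1; rewrite distrC in w1.
  by have := bnd _ _ _ u1 h1; have := bnd _ _ _ w1 h2; move: t0; clear; lra.
have d0 := dchi_ge0 u w s0 p.
have ind0 : 0 <= \1_(thin a b r t1) p :> R by rewrite indicE; case: (_ \in _).
have dD : t ^+ 2 * dchi u w (t ^+ 2) p <= D * \1_(thin a b r t1) p.
  have [hs2|hs2] := leP (tv u w p) (t ^+ 2).
    by rewrite (gam_small s0 hs2).2 mulr0 mulr_ge0.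
  have -> : \1_(thin a b r t1) p = 1 :> R.
    rewrite indicE mem_set//; split => //.
      by rewrite lt_max; apply/orP; have [h|h] := big p pr hs2; [left|right];
        apply: lt_trans h; rewrite divr_gt0.
    rewrite ge_max; have [h1 h2] := ab3.
    by apply/andP; split; [apply: le_trans h1 _|apply: le_trans h2 _]; move: tl2; clear; lra.
  rewrite mulr1 /dchi mulrA divff ?gt_eqF// mul1r; exact: hD.
have dg : t ^+ 2 * dchi u w (t ^+ 2) p <= gam u w (t ^+ 2) p.
  have [hs2|hs2] := leP (tv u w p) (t ^+ 2).
    by have [-> ->] := gam_small s0 hs2; rewrite mulr0.
  rewrite /gam; apply: (@le_trans _ _ (tv u w p * dchi u w (t ^+ 2) p)).
    by apply: ler_wpM2r => //; exact: ltW.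
  by rewrite lerDr chi_ge0.
have := @cut_pt (f p) ('D_(1, 0) f p) ('D_(0, 1) f p) (a p) (b p) (chi u w (t ^+ 2) p)
  (u p) (w p) ('D_(1, 0) u p) ('D_(0, 1) u p) ('D_(1, 0) w p) ('D_(0, 1) w p)
  (dchi u w (t ^+ 2) p) k t (D * \1_(thin a b r t1) p) (gam u w (t ^+ 2) p) F
  c01 ab3.1 ab3.2 uv2.1 uv2.2 d0 dD dg k0 (ltW t0) fx fy.
rewrite !D_chi// -/(grad2 u w p).
have -> : 12 * (D * \1_(thin a b r t1) p) / k = 12 * D / k * \1_(thin a b r t1) p by ring.
by [].
Qed.

(* Exchanging [(a, b)] with [(b, - a)] exchanges [E1] and [E2] up to sign. *)
Lemma rado (A : set (R * R)) M a b : continuous a -> continuous b -> 0 <= M ->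
  (forall p, ~ A p -> a p = 0 /\ b p = 0) -> weakA A M a b -> weakC M a b.
Proof.
move=> ca cb M0 ab0 wA r f cf; split; first exact: rado_E1 ab0 wA _ _ cf.
have E2E g : E2 a b g = E1 b (fun p => - a p) g.
  by apply: eq_I2 => p; rewrite mulNr opprK.
have E1E g s : csm s g -> E2 b (fun p => - a p) g = - E1 a b g.
  move=> cg; have b1 := bcsM_csm (continuous_lbm ca) (csmD (1, 0) cg).
  have b2 := bcsM_csm (continuous_lbm cb) (csmD (0, 1) cg).
  rewrite -mulN1r /E1 /E2 -(I2Z _ (bcsB b1 b2)); apply: eq_I2 => p.
  by rewrite mulN1r opprB mulNr addrC.
rewrite E2E; apply: (@rado_E1 A _ _ _ cb _ M0 _ _ _ _ cf).
- by move=> p; apply: cvgN; exact: ca.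
- by move=> p /ab0[-> ->]; rewrite oppr0.
- move=> s g L cg cL LA L0; have [h1 h2] := wA s g L cg cL LA L0.
  by rewrite -E2E (E1E _ _ cg) normrN.
Qed.

End rado.

(** * Averages and the log-Lipschitz estimate *)

Section averages.
Variable R : realType.
Implicit Types (f g a b : R * R -> R) (p q u v z w : R * R) (s : seq (R * R)).

(** Coordinate derivatives up to order two: values for the limit at fine scales, gradients for the
    logarithm, second derivatives for affinity at unit scale. A finite list gives [moll_step] one
    constant for all. *)
Definition dirs : seq (seq (R * R)) := [:: [::]; [:: (1, 0)]; [:: (0, 1)];
  [:: (1, 0); (1, 0)]; [:: (1, 0); (0, 1)]; [:: (0, 1); (1, 0)]; [:: (0, 1); (0, 1)]].

Definition avg a s (k : R) z := conv a (iter_derive s (moll k)) z.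

Lemma iter_sub s f g p : sm f -> sm g ->
  iter_derive s (fun q => f q - g q) p = iter_derive s f p - iter_derive s g p.
Proof.
move=> sf sg.
have -> : (fun q => f q - g q) = (fun q => f q + (-1) * g q).
  by apply/funext => q; rewrite mulN1r.
rewrite iter_add// ?iter_scale ?mulN1r//.
by apply: sm_mul => //; exact: sm_cst.
Qed.

Lemma avg_half (C M : R) a b : lbm a ->
  (forall s k z, 0 < k -> s \in dirs ->
  `|conv a (iter_derive s (fun q => moll k q - moll (k / 2) q)) z| <= C * M * (k ^+ size s / k)) ->
  forall s k z, 0 < k -> s \in dirs -> `|avg a s k z - avg a s (k / 2) z| <= C * M * (k ^+ size s / k).
Proof.
move=> la h s k z k0 sd; have k20 : 0 < k / 2 by rewrite divr_gt0.
rewrite /avg; have c1 := csm_iter s (csm_moll k0); have c2 := csm_iter s (csm_moll k20).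
have := h s k z k0 sd; congr (`|_| <= _).
rewrite /conv -(I2B (bcs_conv z la c1) (bcs_conv z la c2)).
apply: eq_I2 => q; rewrite iter_sub; [by rewrite mulrBr|exact: (csm_moll k0).1|exact: (csm_moll k20).1].
Qed.

Lemma avg_D a k : lbm a -> 0 < k -> sm (conv a (moll k)) /\
  (forall v z, 'D_v (conv a (moll k)) z = - avg a [:: v] k z) /\
  (forall u v z, 'D_u (fun z => 'D_v (conv a (moll k)) z) z = avg a [:: u; v] k z).
Proof.
move=> la k0; have cm := csm_moll k0; have sc := sm_conv la cm.
split => //; split => [v z|u v z]; first exact: D_conv la cm.
have -> : (fun z => 'D_v (conv a (moll k)) z) = fun z => - conv a (fun p => 'D_v (moll k) p) z.
  by apply/funext => y; exact: D_conv la cm.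
rewrite DN; last exact: sm_conv la (csmD v cm).
by rewrite (D_conv _ _ la (csmD v cm)) opprK.
Qed.

Lemma dist_trans (x y t k e : R) : `|x - y| <= k -> `|x - t| <= e -> `|y - t| <= k + e.
Proof.
by have := ler_normD (y - x) (x - t); rewrite addrA subrK [`|y - x|]distrC; lra.
Qed.

Lemma dist_eq (x y x' y' k : R) : x = x' -> y = y' -> `|x' - y'| <= k -> `|x - y| <= k.
Proof. by move=> -> ->. Qed.

Lemma pow2_big (y : R) : exists n, forall m, (n <= m)%N -> y <= 2 ^+ m.
Proof.
have y0 : 0 < (`|y| + 1)^-1 by rewrite invr_gt0 ltr_wpDl.
have [n _ hn] := near_infty_natSinv_expn_lt (PosNum y0).
exists n => m /hn /=; rewrite mul1r ltf_pV2 ?posrE ?exprn_gt0 ?ltr_wpDl// => h.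
by have := ler_norm y; lra.
Qed.

Lemma telescope_geo (x : nat -> R) (K : R) : (forall n, `|x n.+1 - x n| <= K / 2 ^+ n.+1) ->
  0 <= K -> forall n m, `|x (n + m)%N - x n| <= K / 2 ^+ n.
Proof.
move=> h K0 n m; apply: (@le_trans _ _ (K / 2 ^+ n - K / 2 ^+ (n + m))); last first.
  by rewrite gerBl divr_ge0.
elim: m => [|m IH]; first by rewrite addn0 !subrr normr0.
rewrite addnS; have := h (n + m)%N.
have E : K / 2 ^+ (n + m) = 2 * (K / 2 ^+ (n + m).+1).
  by rewrite exprS; field; rewrite expf_neq0.
rewrite E in IH.
have := ler_normD (x (n + m).+1 - x (n + m)%N) (x (n + m)%N - x n).
rewrite addrA subrK; move: IH; move: (K / _) (K / _) `|_| `|_| `|_| => A B X Y Z; lra.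
Qed.

Lemma telescope_lin (x : nat -> R) (K : R) : (forall n, `|x n.+1 - x n| <= K) ->
  forall n, `|x n - x 0%N| <= n%:R * K.
Proof.
move=> h; elim=> [|n IH]; first by rewrite subrr normr0 mul0r.
have := ler_normD (x n.+1 - x n) (x n - x 0%N); rewrite addrA subrK => h1.
apply: le_trans h1 _; rewrite -natr1 mulrDl mul1r addrC; exact: lerD.
Qed.

Lemma pow_half (n : nat) : 2 ^+ n.+1 / 2 = 2 ^+ n :> R.
Proof. by rewrite exprS mulrAC divff ?mul1r// pnatr_eq0. Qed.

Section estimates.
Variables (C M : R) (a : R * R -> R).
Hypotheses (C0 : 0 <= C) (M0 : 0 <= M) (ca : continuous a).
Hypothesis hstep : forall s k z, 0 < k -> s \in dirs ->
  `|avg a s k z - avg a s (k / 2) z| <= C * M * (k ^+ size s / k).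
Hypothesis growth : forall e : R, 0 < e -> exists T, forall p, T <= `|p| -> `|a p| <= e * `|p| ^+ 2.

Let c := I2 (moll (1 : R)).

Lemma mass_pow n : I2 (moll (2 ^+ n : R)) = c.
Proof.
elim: n => [|n IH]; first by rewrite expr0.
have := mass_half (exprn_gt0 n.+1 (ltr0n R 2)).
by rewrite pow_half => E; apply: etrans E _; exact: IH.
Qed.

Lemma fine_step n s z : s \in dirs ->
  `|avg a s (2 ^+ n.+1) z - avg a s (2 ^+ n) z| <= C * M * ((2 ^+ n.+1) ^+ size s / 2 ^+ n.+1).
Proof.
move=> sd; have := @hstep s (2 ^+ n.+1) z (exprn_gt0 n.+1 (ltr0n R 2)) sd.
by rewrite pow_half.
Qed.

Let la := continuous_lbm ca.

(** The changes from scale to scale form a geometric series, and by continuity the averages converge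
    to [c] times the value at [z]. *)
Lemma fine_val n z : `|conv a (moll (2 ^+ n)) z - c * a z| <= C * M / 2 ^+ n.
Proof.
have m0 : 0 < c by exact: mass_gt0.
apply/ler_addgt0Pr => e e0.
have ec : 0 < e / c by rewrite divr_gt0.
have [d d0 hd] := continuous_eps (@ca z) ec.
have [m _ /(_ _ (leqnn _)) hm] := near_infty_natSinv_expn_lt (PosNum d0).
set N := (n + m.+1)%N.
have N0 : 0 < 2 ^+ N :> R by exact: exprn_gt0.
have Nd : (2 ^+ N)^-1 < d.
  apply: le_lt_trans hm; rewrite mul1r lef_pV2 ?posrE ?exprn_gt0//.
  by rewrite ler_eXn2l ?ltr1n// /N addnS leqW// leq_addl.
have h1 : `|conv a (moll (2 ^+ N)) z - c * a z| <= e.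
  have hq q : `|q - z| <= (2 ^+ N)^-1 -> `|a q - a z| < e / c.
    by move=> h; rewrite distrC; apply: hd; rewrite distrC; apply: le_lt_trans h Nd.
  have := @avg_close R a _ (e / c) (2 ^+ N) z ca N0 hq (ltW ec) (csm_moll N0).
  rewrite mass_pow.
  have -> : c^-1 * conv a (moll (2 ^+ N)) z - a z = c^-1 * (conv a (moll (2 ^+ N)) z - c * a z).
    by rewrite mulrBr mulKf// gt_eqF.
  by rewrite normrM gtr0_norm ?invr_gt0// mulrC ler_pM2r ?invr_gt0.
have CM0 : 0 <= C * M by rewrite mulr_ge0.
have h2 := @telescope_geo (fun n => conv a (moll (2 ^+ n)) z) (C * M) _ CM0 n m.+1.
have {}h2 : `|conv a (moll (2 ^+ N)) z - conv a (moll (2 ^+ n)) z| <= C * M / 2 ^+ n.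
  apply: h2 => j; have := @fine_step j [::] z; rewrite inE eqxx => /(_ isT).
  by rewrite expr0 mul1r.
exact: dist_trans h2 h1.
Qed.

(** The origin of the logarithm: each derivative costs a factor [k], which cancels the gain 1/k, so
    every one of the [n] scales contributes the same amount. *)
Lemma fine_grad n u z : [:: u] \in dirs ->
  `|'D_u (conv a (moll (2 ^+ n))) z - 'D_u (conv a (moll 1)) z| <= n%:R * (C * M).
Proof.
move=> ud.
have E0 : 'D_u (conv a (moll 1)) z = - avg a [:: u] 1 z := (avg_D la (ltr01 : 0 < 1 :> R)).2.1 u z.
have En := (avg_D la (exprn_gt0 n (ltr0n R 2))).2.1 u z.
have h j : `|- avg a [:: u] (2 ^+ j.+1) z - - avg a [:: u] (2 ^+ j) z| <= C * M.
  rewrite -opprD normrN.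
  by have := fine_step j z ud; rewrite expr1 divff ?mulr1// expf_neq0 ?pnatr_eq0.
exact: dist_eq En E0 (@telescope_lin (fun j => - avg a [:: u] (2 ^+ j) z) (C * M) h n).
Qed.

Lemma coarse_step n s z : s \in dirs -> size s = 2%N ->
  `|avg a s ((2 ^+ n)^-1) z - avg a s ((2 ^+ n.+1)^-1) z| <= C * M * 2 / 2 ^+ n.+1.
Proof.
move=> sd s2; have k0 : 0 < (2 ^+ n)^-1 :> R by rewrite invr_gt0 exprn_gt0.
have := @hstep s ((2 ^+ n)^-1) z k0 sd.
have -> : (2 ^+ n)^-1 / 2 = (2 ^+ n.+1)^-1 :> R by rewrite exprS invfM mulrC.
rewrite s2 expr2 mulfK ?gt_eqF//.
have -> : C * M * 2 / 2 ^+ n.+1 = C * M * (2 ^+ n)^-1.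
  by rewrite exprS; field; rewrite expf_neq0 ?pnatr_eq0.
exact.
Qed.

(** Here the growth condition enters. The field z^2 shows that O(|z|^2) in place of o(|z|^2) would
    not do. *)
Lemma coarse_limit s z e : size s = 2%N -> 0 < e ->
  exists n, forall m, (n <= m)%N -> `|avg a s ((2 ^+ m)^-1) z| <= e.
Proof.
move=> s2 e0.
have [D D0 hD] := csm_bounded (csm_iter s (@csm_bump R)).
(* For large m the bound is at most 64 d D plus a term that decays with the scale; each is to be at
   most e/2. *)
pose d := e / (128 * (D + 1)).
have D1 : 0 < D + 1 by rewrite ltr_wpDl.
have d0 : 0 < d by apply: divr_gt0 => //; exact: mulr_gt0.
have [T hT] := growth d0.
have [S hS] := la.2 T.
(* average of a function of size [d * r^2 + S] over a ball of radius [r] against a second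
   derivative of size [D / r^4] *)
have bnd m : `|avg a s ((2 ^+ m)^-1) z| <=
    (d * (`|z| + 2 ^+ m) ^+ 2 + `|S|) * (D / (2 ^+ m) ^+ 4) * (2 * (2 ^+ m + 1)) ^+ 2.
  have k0 : 0 < (2 ^+ m)^-1 :> R by rewrite invr_gt0 exprn_gt0.
  have cm := csm_iter s (csm_moll k0); rewrite invrK in cm.
  apply: conv_bound la cm _ _ _ _.
  - by rewrite exprn_ge0.
  - move=> q qz; have [Tq|qT] := leP T `|q|.
      apply: le_trans (hT _ Tq) _; rewrite -[X in X <= _]addr0; apply: lerD => //.
      apply: ler_wpM2l; first exact: ltW.
      rewrite ler_pXn2r ?nnegrE ?addr_ge0// ?exprn_ge0//.
      by have := ler_normD z (q - z); rewrite [z + _]addrC subrK => h; apply: le_trans h _; rewrite lerD2l.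
    apply: le_trans (hS _ (ltW qT)) _; apply: le_trans (ler_norm _) _.
    by rewrite lerDr mulr_ge0 ?sqr_ge0// ltW.
  - move=> q; rewrite /moll iter_dil; last exact: (@csm_bump R).1.
    rewrite s2 normrM ger0_norm; last by rewrite mulr_ge0 ?exprn_ge0// ltW.
    rewrite -exprD exprVn mulrC; apply: ler_wpM2r; last exact: hD.
    by rewrite invr_ge0 exprn_ge0// exprn_ge0.
  - by rewrite addr_ge0// mulr_ge0 ?sqr_ge0// ltW.
have [n hn] := pow2_big (`|z| + 1 + 32 * `|S| * D / e).
exists n => m nm; apply: le_trans (bnd m) _.
have y0 : 0 <= 32 * `|S| * D / e.
  by apply: divr_ge0; [apply: mulr_ge0 => //; exact: mulr_ge0|exact: ltW].
have x1m : 1 <= 2 ^+ m :> R by apply: exprn_ege1; rewrite ler1n.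
move: (hn m nm) x1m.
move: (2 ^+ m) => x hx x1; clear bnd hn hT hS.
have x0 : 0 < x by apply: lt_le_trans x1.
have zx : `|z| <= x by move: y0 hx; move: (_ / e) => y ? ?; lra.
have yx : 32 * `|S| * D / e <= x by have := normr_ge0 z; move: hx; move: (_ / e) => y ? ?; lra.
have yx' : 32 * `|S| * D <= e * x by move: yx; rewrite ler_pdivrMr// [e * x]mulrC.
have x0' := ltW x0.
have D4 : 0 <= D / x ^+ 4 by apply: divr_ge0 => //; exact: exprn_ge0.
apply: (@le_trans _ _ ((d * (2 * x) ^+ 2 + `|S|) * (D / x ^+ 4) * (4 * x) ^+ 2)).
  apply: ler_pM.
  - apply: mulr_ge0 => //; apply: addr_ge0 => //; apply: mulr_ge0; [exact: ltW|exact: sqr_ge0].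
  - exact: sqr_ge0.
  - apply: ler_wpM2r => //; rewrite lerD2r; apply: ler_wpM2l; first exact: ltW.
    by rewrite ler_pXn2r// ?nnegrE; [lra|apply: addr_ge0|apply: mulr_ge0].
  - rewrite ler_pXn2r// ?nnegrE; [lra| |by apply: mulr_ge0].
    by apply: mulr_ge0 => //; apply: addr_ge0.
have -> : (d * (2 * x) ^+ 2 + `|S|) * (D / x ^+ 4) * (4 * x) ^+ 2 =
   64 * d * D + 16 * `|S| * D / x ^+ 2 by field; rewrite gt_eqF.
have h1 : 64 * d * D <= e / 2.
  have -> : e / 2 = 64 * d * (D + 1) by rewrite /d; field; rewrite gt_eqF.
  by apply: ler_wpM2l; [rewrite mulr_ge0// ltW|rewrite lerDl].
have h2 : 16 * `|S| * D / x ^+ 2 <= e / 2.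
  rewrite ler_pdivrMr ?exprn_gt0//.
  have : e * x <= e * x ^+ 2 by rewrite ler_pM2l// expr2 ler_peMr// ltW.
  have -> : e / 2 * x ^+ 2 = (e * x ^+ 2) / 2 by ring.
  move: yx'; have -> : 32 * `|S| * D = 2 * (16 * `|S| * D) by ring.
  move: (e * x) (e * x ^+ 2) (16 * `|S| * D) => A B E ? ?; lra.
lra.
Qed.

(** For second derivatives the changes are summable towards coarse scales, where the averages tend
    to 0; summing back to scale 1 gives the bound. *)
Lemma coarse_bound s z : s \in dirs -> size s = 2%N -> `|avg a s 1 z| <= 2 * (C * M).
Proof.
move=> sd s2; apply/ler_addgt0Pr => e e0.
have [n /(_ n (leqnn n)) hn] := coarse_limit z s2 e0.
have K0 : 0 <= C * M * 2 by rewrite !mulr_ge0.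
have h j : `|avg a s (2 ^+ j.+1)^-1 z - avg a s (2 ^+ j)^-1 z| <= C * M * 2 / 2 ^+ j.+1.
  by rewrite distrC; exact: coarse_step.
have := @telescope_geo (fun j => avg a s (2 ^+ j)^-1 z) (C * M * 2) h K0 0%N n.
rewrite add0n expr0 invr1 mulr1.
move: hn; move: (avg a s (2 ^+ n)^-1 z) (avg a s 1 z) => x y hx hxy.
have := ler_normD (y - x) x; rewrite subrK [`|y - x|]distrC; lra.
Qed.

Lemma grad_lip u p q : [:: (1, 0); u] \in dirs -> [:: (0, 1); u] \in dirs ->
  `|'D_u (conv a (moll 1)) q - 'D_u (conv a (moll 1)) p| <= 4 * (C * M) * `|q - p|.
Proof.
move=> d1 d2; have [sA [_ A2]] := avg_D la (ltr01 : 0 < 1 :> R).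
have h1 := fun z => coarse_bound z d1 erefl; have h2 := fun z => coarse_bound z d2 erefl.
move: (fun z => A2 (1, 0) u z) (fun z => A2 (0, 1) u z) h1 h2.
move: (avg a [:: (1, 0); u] 1) (avg a [:: (0, 1); u] 1) sA; move: (conv a (moll 1)) => f g1 g2 sf e1 e2 h1 h2.
have -> : 4 * (C * M) = 2 * (2 * (C * M)) by ring.
apply: (@mvt_plane R (fun z => 'D_u f z) (2 * (C * M)) p q (smD u sf)) => t _.
  by rewrite e1.
by rewrite e2.
Qed.

Lemma taylor_line p q : `|conv a (moll 1) q - conv a (moll 1) p - ((q - p).1 *
    'D_(1, 0) (conv a (moll 1)) p + (q - p).2 * 'D_(0, 1) (conv a (moll 1)) p)|
  <= 8 * (C * M) * `|q - p| ^+ 2.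
Proof.
have [sA _] := avg_D la (ltr01 : 0 < 1 :> R).
have d11 : [:: (1, 0); (1, 0)] \in dirs by rewrite !inE !eqxx ?orbT.
have d12 : [:: (1, 0); (0, 1)] \in dirs by rewrite !inE !eqxx ?orbT.
have d21 : [:: (0, 1); (1, 0)] \in dirs by rewrite !inE !eqxx ?orbT.
have d22 : [:: (0, 1); (0, 1)] \in dirs by rewrite !inE !eqxx ?orbT.
move: sA (fun q => @grad_lip (1, 0) p q d11 d21) (fun q => @grad_lip (0, 1) p q d12 d22); move: (conv a (moll 1)) => f sf g1 g2.
set P := 'D_(1, 0) f p; set Q := 'D_(0, 1) f p.
pose l (x : R * R) := x.1 * - P + x.2 * - Q + 0.
have sl : sm l by exact: sm_affine_fun.
have sF : sm (fun x => f x + l x) by exact: sm_add.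
have h1 t : 0 <= t <= 1 -> `|'D_(1, 0) (fun x => f x + l x) (p + t *: (q - p))| <= 4 * (C * M) * `|q - p|.
  move=> t01; rewrite DD// D_affine_fun mul1r mul0r addr0.
  apply: le_trans (g1 _) _; rewrite [p + _]addrC addrK.
  apply: ler_wpM2l; first by rewrite !mulr_ge0.
  by case/andP: t01 => t0 t1; rewrite normrZ ger0_norm// ler_piMl.
have h2 t : 0 <= t <= 1 -> `|'D_(0, 1) (fun x => f x + l x) (p + t *: (q - p))| <= 4 * (C * M) * `|q - p|.
  move=> t01; rewrite DD// D_affine_fun mul1r mul0r add0r.
  apply: le_trans (g2 _) _; rewrite [p + _]addrC addrK.
  apply: ler_wpM2l; first by rewrite !mulr_ge0.
  by case/andP: t01 => t0 t1; rewrite normrZ ger0_norm// ler_piMl.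
have := mvt_plane sF h1 h2; rewrite /l /=.
have -> : 8 * (C * M) * `|q - p| ^+ 2 = 2 * (4 * (C * M) * `|q - p|) * `|q - p| by ring.
by congr (`|_| <= _); ring.
Qed.

End estimates.
End averages.

(** * Two zeros and the log-Lipschitz estimate *)

Section two_zeros.
Variable R : realType.
Implicit Types (f g a b : R * R -> R) (p q u v z w : R * R) (s : seq (R * R)).

(** (P, Q) and (P', Q') are the gradients of the real and imaginary parts. Up to the error [m] in
    the Cauchy-Riemann equations the differential is multiplication by a complex number, so one
    small directional derivative, along a vector of length at least [d], bounds all of it. *)
Lemma grad_solve (P Q P' Q' x y k m X d : R) : `|x * P + y * Q| <= k -> `|x * P' + y * Q'| <= k ->
  `|P - Q'| <= m -> `|Q + P'| <= m -> `|x| <= X -> `|y| <= X -> 0 < d -> d <= Num.max `|x| `|y| ->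
  [/\ `|P| <= 2 * (k + 2 * X * m) / d, `|Q| <= 2 * (k + 2 * X * m) / d,
   `|P'| <= 2 * (k + 2 * X * m) / d + m & `|Q'| <= 2 * (k + 2 * X * m) / d + m].
Proof.
move=> h1 h2 h3 h4 hx hy d0 hd.
set K := k + 2 * X * m.
have k0 : 0 <= k by exact: le_trans h1.
have m0 : 0 <= m by exact: le_trans h3.
have X0 : 0 <= X by exact: le_trans hx.
have K0 : 0 <= K by rewrite addr_ge0// mulr_ge0// mulr_ge0.
have hS : `|x * P + y * Q| <= K by apply: le_trans h1 _; rewrite lerDl mulr_ge0// mulr_ge0.
have hT : `|y * P - x * Q| <= K.
  have -> : y * P - x * Q = x * P' + y * Q' + (y * (P - Q') - x * (Q + P')) by ring.
  apply: le_trans (ler_normD _ _) _; apply: lerD => //.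
  apply: le_trans (ler_normB _ _) _; rewrite !normrM.
  have -> : 2 * X * m = X * m + X * m by ring.
  by apply: lerD; apply: ler_pM.
have sqK (t : R) : `|t| <= K -> t ^+ 2 <= K ^+ 2.
  by move=> ht; rewrite -(real_normK (num_real t)) ler_pXn2r// nnegrE.
have E : (x * P + y * Q) ^+ 2 + (y * P - x * Q) ^+ 2 = (P ^+ 2 + Q ^+ 2) * (x ^+ 2 + y ^+ 2) by ring.
have xy : d ^+ 2 <= x ^+ 2 + y ^+ 2.
  have sqd (t : R) : d <= `|t| -> d ^+ 2 <= t ^+ 2.
    by move=> ht; rewrite -[t ^+ 2](real_normK (num_real t)) ler_pXn2r// nnegrE// ltW.
  move: hd; rewrite le_max => /orP[/sqd h|/sqd h]; apply: le_trans h _.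
    by rewrite lerDl sqr_ge0.
  by rewrite lerDr sqr_ge0.
have PQ : (P ^+ 2 + Q ^+ 2) * d ^+ 2 <= 2 * K ^+ 2.
  apply: (@le_trans _ _ ((P ^+ 2 + Q ^+ 2) * (x ^+ 2 + y ^+ 2))).
    by apply: ler_wpM2l => //; rewrite addr_ge0// sqr_ge0.
  by rewrite -E [2 * _]mulr_natl mulr2n; apply: lerD; exact: sqK.
have fin (t : R) : t ^+ 2 <= P ^+ 2 + Q ^+ 2 -> `|t| <= 2 * K / d.
  move=> ht; rewrite ler_pdivlMr// -(@ler_pXn2r _ 2)// ?nnegrE ?mulr_ge0 ?(ltW d0)//.
  rewrite exprMn real_normK ?num_real//.
  apply: (@le_trans _ _ ((P ^+ 2 + Q ^+ 2) * d ^+ 2)).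
    by apply: ler_wpM2r => //; exact: sqr_ge0.
  apply: le_trans PQ _; rewrite exprMn; apply: ler_wpM2r; first exact: sqr_ge0.
  by rewrite expr2; lra.
have hP := fin P; have hQ := fin Q.
have {}hP : `|P| <= 2 * K / d by apply: hP; rewrite lerDl sqr_ge0.
have {}hQ : `|Q| <= 2 * K / d by apply: hQ; rewrite lerDr sqr_ge0.
split => //.
- have := ler_normB (Q + P') Q; rewrite addrC addKr; move: (2 * K / d) hQ => t hQ; lra.
- have := ler_normB P (P - Q'); rewrite opprB addrC subrK; move: (2 * K / d) hP => t hP; lra.
Qed.

Lemma segmentE q z w (t : R) : q + t *: (z - q) - w = (1 - t) *: (q - w) + t *: (z - w).
Proof.
by case: q z w => [? ?] [? ?] [? ?]; congr pair; rewrite /= /GRing.scale /=; ring.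
Qed.

Definition subquadratic a :=
  forall e : R, 0 < e -> exists T, forall p, T <= `|p| -> `|a p| <= e * `|p| ^+ 2.

(** The averaging scale is matched to the distance of [z] and [q]: replacing values by averages [f]
    costs O(M / 2^n), and the gradient of [f] is that of the unit-scale average [g] plus [n] steps
    of size O(M). *)
Lemma log_lipschitz_pt (C M K c : R) f g a w D n z q : 0 <= C -> 0 <= M -> 0 <= K -> 0 < c -> sm f ->
  (forall p, `|'D_(1, 0) f p - 'D_(1, 0) g p| <= n%:R * (C * M)) ->
  (forall p, `|'D_(0, 1) f p - 'D_(0, 1) g p| <= n%:R * (C * M)) ->
  `|f z - c * a z| <= C * M / 2 ^+ n -> `|f q - c * a q| <= C * M / 2 ^+ n ->
  (forall p, `|p - w| <= D -> `|'D_(1, 0) g p| <= K * M /\ `|'D_(0, 1) g p| <= K * M) ->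
  `|z - w| <= D -> `|q - w| <= D -> `|z - q| <= (2 ^+ n)^-1 ->
  c * `|a z - a q| <= (2 * K + 2 * C) * M * n.+1%:R / 2 ^+ n.
Proof.
move=> C0 M0 K0 c0 sf g1 g2 v1 v2 hG zw qw zq.
have k0 : 0 < 2 ^+ n :> R by rewrite exprn_gt0.
have tri (x y k l : R) : `|x - y| <= k -> `|y| <= l -> `|x| <= l + k.
  by move=> h1 h2; have := ler_normD (x - y) y; rewrite subrK; lra.
have cvx (t : R) : 0 <= t <= 1 -> `|q + t *: (z - q) - w| <= D.
  move=> /andP[t0 t1]; rewrite segmentE.
  apply: le_trans (ler_normD _ _) _; rewrite !normrZ !ger0_norm ?subr_ge0//.
  have -> : D = (1 - t) * D + t * D by ring.
  by apply: lerD; apply: ler_wpM2l => //; rewrite subr_ge0.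
have h1 t : 0 <= t <= 1 -> `|'D_(1, 0) f (q + t *: (z - q))| <= K * M + n%:R * (C * M).
  by move=> /cvx /hG[G1 G2]; exact: tri (g1 _) G1.
have h2 t : 0 <= t <= 1 -> `|'D_(0, 1) f (q + t *: (z - q))| <= K * M + n%:R * (C * M).
  by move=> /cvx /hG[G1 G2]; exact: tri (g2 _) G2.
have h3 := mvt_plane sf h1 h2.
rewrite -[c](gtr0_norm c0) -normrM mulrBr.
have KM : 0 <= K * M + n%:R * (C * M) by rewrite addr_ge0 ?mulr_ge0.
have h4 : `|f z - f q| <= 2 * (K * M + n%:R * (C * M)) * (2 ^+ n)^-1.
  by apply: le_trans h3 _; apply: ler_wpM2l; rewrite ?mulr_ge0.
have h5 : `|c * a z - c * a q| <= 2 * (K * M + n%:R * (C * M)) * (2 ^+ n)^-1 + 2 * (C * M / 2 ^+ n).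
  have -> : c * a z - c * a q = (f z - f q) - (f z - c * a z) + (f q - c * a q) by ring.
  have := ler_normD (f z - f q - (f z - c * a z)) (f q - c * a q).
  have := ler_normB (f z - f q) (f z - c * a z).
  move: (2 * (K * M + _) * _) (C * M / _) h4 v1 v2 => A B h4 v1 v2; lra.
apply: le_trans h5 _; rewrite -[n.+1%:R]natr1.
have i0 : 0 <= (2 ^+ n)^-1 :> R by rewrite invr_ge0 ltW.
move: (2 ^+ n)^-1 i0 => i i0.
have -> : 2 * (K * M + n%:R * (C * M)) * i + 2 * (C * M * i) =
   ((2 * K + 2 * C) * M * (n%:R + 1) - 2 * K * M * n%:R) * i by ring.
by apply: ler_wpM2r => //; rewrite gerBl !mulr_ge0.
Qed.

Lemma log_lipschitz_aux (C M K : R) a w D : 0 <= C -> 0 <= M -> 0 <= K -> continuous a ->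
  (forall s k z, 0 < k -> s \in dirs R ->
  `|avg a s k z - avg a s (k / 2) z| <= C * M * (k ^+ size s / k)) ->
  (forall p, `|p - w| <= D -> `|'D_(1, 0) (conv a (moll 1)) p| <= K * M /\
     `|'D_(0, 1) (conv a (moll 1)) p| <= K * M) ->
  forall n z q, `|z - w| <= D -> `|q - w| <= D -> `|z - q| <= (2 ^+ n)^-1 ->
  I2 (moll 1) * `|a z - a q| <= (2 * K + 2 * C) * M * n.+1%:R / 2 ^+ n.
Proof.
move=> C0 M0 K0 ca hstep hG n z q zw qw zq.
have la := continuous_lbm ca.
have k0 : 0 < 2 ^+ n :> R by rewrite exprn_gt0.
have d1 : [:: (1, 0)] \in dirs R by rewrite !inE !eqxx ?orbT.
have d2 : [:: (0, 1)] \in dirs R by rewrite !inE !eqxx ?orbT.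
exact: (log_lipschitz_pt C0 M0 K0 (mass_gt0 ltr01) (avg_D la k0).1
  (fun p => @fine_grad R C M a ca hstep n (1, 0) p d1)
  (fun p => @fine_grad R C M a ca hstep n (0, 1) p d2)
  (fine_val C0 M0 ca hstep n z) (fine_val C0 M0 ca hstep n q) hG zw qw zq).
Qed.

(** At both zeros the averages are O(M), so the Taylor expansion from [z1] to [z2] has a small
    linear part and [grad_solve] applies at [z1]. The Lipschitz bounds on the gradients carry the
    estimate to the whole square about [w]. *)
Lemma slope_bound (C M c D d : R) f g w z1 z2 : 0 <= C -> 0 <= M -> 0 <= D -> 0 < d -> 0 <= c ->
  `|z1 - w| <= D -> `|z2 - w| <= D -> d <= `|z2 - z1| ->
  `|f z2 - f z1 - ((z2 - z1).1 * 'D_(1, 0) f z1 + (z2 - z1).2 * 'D_(0, 1) f z1)|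
    <= 8 * (C * M) * `|z2 - z1| ^+ 2 ->
  `|g z2 - g z1 - ((z2 - z1).1 * 'D_(1, 0) g z1 + (z2 - z1).2 * 'D_(0, 1) g z1)|
    <= 8 * (C * M) * `|z2 - z1| ^+ 2 ->
  `|f z1| <= C * M -> `|f z2| <= C * M -> `|g z1| <= C * M -> `|g z2| <= C * M ->
  `|'D_(1, 0) f z1 - 'D_(0, 1) g z1| <= M * c -> `|'D_(0, 1) f z1 + 'D_(1, 0) g z1| <= M * c ->
  (forall p, `|'D_(1, 0) f p - 'D_(1, 0) f z1| <= 4 * (C * M) * `|p - z1|) ->
  (forall p, `|'D_(0, 1) f p - 'D_(0, 1) f z1| <= 4 * (C * M) * `|p - z1|) ->
  (forall p, `|'D_(1, 0) g p - 'D_(1, 0) g z1| <= 4 * (C * M) * `|p - z1|) ->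
  (forall p, `|'D_(0, 1) g p - 'D_(0, 1) g z1| <= 4 * (C * M) * `|p - z1|) ->
  let K := 2 * (2 * C + 8 * C * (2 * D) ^+ 2 + 2 * (2 * D) * c) / d + c + 8 * C * D in
  forall p, `|p - w| <= D ->
   (`|'D_(1, 0) f p| <= K * M /\ `|'D_(0, 1) f p| <= K * M) /\
   (`|'D_(1, 0) g p| <= K * M /\ `|'D_(0, 1) g p| <= K * M).
Proof.
move=> C0 M0 D0 d0 c0 z1w z2w db ta tb f1 f2 g1 g2 cr1 cr2 lf1 lf2 lg1 lg2 K p pw.
have dist2 (u v : R * R) : `|u - w| <= D -> `|v - w| <= D -> `|u - v| <= 2 * D.
  by move=> h1 h2; have := ler_normB (u - w) (v - w); rewrite opprB addrA subrK => /le_trans;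
    apply; rewrite mulr_natl mulr2n; exact: lerD.
have z21 := dist2 _ _ z2w z1w; have pz := dist2 _ _ pw z1w.
have CM0 : 0 <= C * M by rewrite mulr_ge0.
pose k1 := 2 * (C * M) + 8 * (C * M) * (2 * D) ^+ 2.
have small (x y l : R) : `|y| <= C * M -> `|x| <= C * M ->
    `|y - x - l| <= 8 * (C * M) * `|z2 - z1| ^+ 2 -> `|l| <= k1.
  move=> hy hx hl.
  have h8 : 8 * (C * M) * `|z2 - z1| ^+ 2 <= 8 * (C * M) * (2 * D) ^+ 2.
    apply: ler_wpM2l; first by rewrite mulr_ge0.
    by rewrite ler_pXn2r// ?nnegrE// mulr_ge0.
  have -> : l = (y - x) - (y - x - l) by ring.
  have := ler_normB (y - x) (y - x - l); have := ler_normB y x.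
  move: (8 * _ * _) (8 * _ * _) hl h8 @k1 => A B hl h8 k1; rewrite /k1; clear - hl h8 hy hx; lra.
have x1 : `|(z2 - z1).1| <= 2 * D.
  by apply: le_trans z21; rewrite [X in _ <= X]prod_normE le_max lexx.
have y1 : `|(z2 - z1).2| <= 2 * D.
  by apply: le_trans z21; rewrite [X in _ <= X]prod_normE le_max lexx orbT.
have dm : d <= Num.max `|(z2 - z1).1| `|(z2 - z1).2|.
  by apply: le_trans db _; rewrite [X in X <= _]prod_normE.
have [h1 h2 h3 h4] := grad_solve (small _ _ _ f2 f1 ta) (small _ _ _ g2 g1 tb) cr1 cr2 x1 y1 d0 dm.
have lip (x y : R) : `|x - y| <= 4 * (C * M) * `|p - z1| ->
    `|y| <= 2 * (k1 + 2 * (2 * D) * (M * c)) / d + M * c -> `|x| <= K * M.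
  move=> hxy hy; have h8 : 4 * (C * M) * `|p - z1| <= 8 * C * D * M.
    have -> : 8 * C * D * M = 4 * (C * M) * (2 * D) by ring.
    by apply: ler_wpM2l => //; rewrite mulr_ge0.
  have -> : K * M = (2 * (k1 + 2 * (2 * D) * (M * c)) / d + M * c) + 8 * C * D * M.
    by rewrite /K /k1; field; rewrite gt_eqF.
  have := ler_normD (x - y) y; rewrite subrK => /le_trans; apply; rewrite addrC.
  by apply: lerD => //; exact: le_trans h8.
have Mc : 0 <= M * c by rewrite mulr_ge0.
have wk (x t : R) : `|x| <= t -> `|x| <= t + M * c by move=> h; apply: le_trans h _; rewrite lerDl.
by split; split; [apply: lip (lf1 p) (wk _ _ h1)|apply: lip (lf2 p) (wk _ _ h2)|
  apply: lip (lg1 p) h3|apply: lip (lg2 p) h4].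
Qed.

(* The dbar bound makes the unit-scale average of [a + ib] almost complex affine, and the two
   zeros [z1], [z2] then control its slope. *)
Lemma log_lipschitz (D d : R) : 0 <= D -> 0 < d -> exists2 C, 0 <= C &
  forall M a b w z1 z2, 0 <= M -> continuous a -> continuous b -> weakC M a b ->
  subquadratic a -> subquadratic b -> `|z1 - w| <= D -> `|z2 - w| <= D -> d <= `|z2 - z1| ->
  [/\ a z1 = 0, b z1 = 0, a z2 = 0 & b z2 = 0] ->
  forall n z q, `|z - w| <= D -> `|q - w| <= D -> `|z - q| <= (2 ^+ n)^-1 ->
  `|a z - a q| <= C * M * n.+1%:R / 2 ^+ n /\ `|b z - b q| <= C * M * n.+1%:R / 2 ^+ n.
Proof.
move=> D0 d0; have [C C0 hC] := moll_step (dirs R).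
have c0 := @mass_gt0 R 1 ltr01.
pose c := I2 (moll (1 : R)).
pose k1 := 2 * C + 8 * C * (2 * D) ^+ 2.
pose K := 2 * (k1 + 2 * (2 * D) * c) / d + c + 8 * C * D.
have k10 : 0 <= k1 by rewrite /k1 addr_ge0 ?mulr_ge0 ?sqr_ge0.
have K0 : 0 <= K.
  rewrite /K addr_ge0 ?mulr_ge0// addr_ge0 ?(ltW c0)// divr_ge0 ?(ltW d0)//.
  by rewrite mulr_ge0// addr_ge0// !mulr_ge0// ltW.
exists ((2 * K + 2 * C) / c); first by rewrite divr_ge0 ?(ltW c0)// addr_ge0 ?mulr_ge0.
move=> M a b w z1 z2 M0 ca cb wC ga gb z1w z2w db [ab1 bb1 ab2 bb2].
have la := continuous_lbm ca; have lb := continuous_lbm cb.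
have stepa : forall s k z, 0 < k -> s \in dirs R ->
    `|avg a s k z - avg a s (k / 2) z| <= C * M * (k ^+ size s / k).
  apply: avg_half => // s k z k0 sd.
  by have [] := hC M a b s k z la lb wC M0 k0 sd.
have stepb : forall s k z, 0 < k -> s \in dirs R ->
    `|avg b s k z - avg b s (k / 2) z| <= C * M * (k ^+ size s / k).
  apply: avg_half => // s k z k0 sd.
  by have [] := hC M a b s k z la lb wC M0 k0 sd.
have grad : forall p, `|p - w| <= D ->
   (`|'D_(1, 0) (conv a (moll 1)) p| <= K * M /\ `|'D_(0, 1) (conv a (moll 1)) p| <= K * M) /\
   (`|'D_(1, 0) (conv b (moll 1)) p| <= K * M /\ `|'D_(0, 1) (conv b (moll 1)) p| <= K * M).
  have ta := taylor_line C0 M0 ca stepa ga z1 z2.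
  have tb := taylor_line C0 M0 cb stepb gb z1 z2.
  have va1 := fine_val C0 M0 ca stepa 0 z1; have va2 := fine_val C0 M0 ca stepa 0 z2.
  have vb1 := fine_val C0 M0 cb stepb 0 z1; have vb2 := fine_val C0 M0 cb stepb 0 z2.
  rewrite ab1 mulr0 subr0 expr0 invr1 mulr1 in va1.
  rewrite ab2 mulr0 subr0 expr0 invr1 mulr1 in va2.
  rewrite bb1 mulr0 subr0 expr0 invr1 mulr1 in vb1.
  rewrite bb2 mulr0 subr0 expr0 invr1 mulr1 in vb2.
  have cm := csm_moll (ltr01 : 0 < 1 :> R).
  have cmz := csm_shift z1 cm.
  have [w1 w2] := wC _ _ cmz; have [e1 e2] := E_conv z1 la lb cm.
  have mE : I2 (fun q => `|moll 1 (q - z1)|) = c.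
    rewrite /c -(mass_const z1 ltr01); apply: eq_I2 => q.
    by rewrite mul1r ger0_norm// moll_ge0.
  rewrite e1 mE normrN in w1; rewrite e2 mE normrN in w2.
  have d11 : [:: (1, 0); (1, 0)] \in dirs R by rewrite !inE !eqxx ?orbT.
  have d12 : [:: (1, 0); (0, 1)] \in dirs R by rewrite !inE !eqxx ?orbT.
  have d21 : [:: (0, 1); (1, 0)] \in dirs R by rewrite !inE !eqxx ?orbT.
  have d22 : [:: (0, 1); (0, 1)] \in dirs R by rewrite !inE !eqxx ?orbT.
  exact: (slope_bound C0 M0 D0 d0 (ltW c0) z1w z2w db ta tb va1 va2 vb1 vb2 w1 w2
    (fun p => @grad_lip R C M a C0 M0 ca stepa ga (1, 0) z1 p d11 d21)
    (fun p => @grad_lip R C M a C0 M0 ca stepa ga (0, 1) z1 p d12 d22)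
    (fun p => @grad_lip R C M b C0 M0 cb stepb gb (1, 0) z1 p d11 d21)
    (fun p => @grad_lip R C M b C0 M0 cb stepb gb (0, 1) z1 p d12 d22)).
move=> n z q zw qw zq.
have ha := log_lipschitz_aux C0 M0 K0 ca stepa (fun p h => (grad p h).1) zw qw zq.
have hb := log_lipschitz_aux C0 M0 K0 cb stepb (fun p h => (grad p h).2) zw qw zq.
have fin (x y : R) : c * x <= (2 * K + 2 * C) * M * n.+1%:R / 2 ^+ n ->
    x <= (2 * K + 2 * C) / c * M * n.+1%:R / 2 ^+ n.
  move=> h; rewrite -(ler_pM2l c0); apply: le_trans h _.
  rewrite le_eqVlt; apply/orP; left; apply/eqP; rewrite -/c; move: c0; rewrite -/c.
  move: (2 ^+ n)^-1 => i c0; field; rewrite gt_eqF//.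
by split; apply: fin.
Qed.

End two_zeros.

(** * The cutoff *)

Section cutoff.
Variable R : realType.
Implicit Types (A : set (R * R)) (f g a b : R * R -> R) (p q u v z w : R * R) (r : R).
Local Notation plane := (measurableTypeR R * measurableTypeR R)%type.

(** Points at sup distance at least [r] from the complement; in this form an empty complement needs
    no convention. *)
Definition inn A r : set (R * R) := [set z | forall q, `|q - z| < r -> A q].

Lemma innN A r z : ~ inn A r z -> exists2 q, ~ A q & `|q - z| < r.
Proof. by move=> /existsNP[q /not_implyP[h1 h2]]; exists q. Qed.

Lemma innS A r r' z : r <= r' -> inn A r' z -> inn A r z.
Proof. by move=> rr h q hq; apply: h; exact: lt_le_trans hq rr. Qed.

Lemma inn_sub A r z : 0 < r -> inn A r z -> A z.
Proof. by move=> r0; apply; rewrite subrr normr0. Qed.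

Lemma closed_inn A r : closed (inn A r).
Proof.
rewrite -[inn A r]setCK; apply: open_closedC; rewrite openE => z /= /innN[q Aq qz].
apply/nbhs_ballP; exists (r - `|q - z|); first by rewrite /= subr_gt0.
move=> y; rewrite -ball_normE /= => zy hy; apply: Aq; apply: hy.
by have := ler_normD (q - z) (z - y); rewrite addrA subrK; lra.
Qed.

Lemma conv_local f g m r z : csm r m -> (forall q, `|q - z| <= r -> f q = g q) ->
  conv f m z = conv g m z.
Proof.
move=> cm h; apply: eq_I2 => q; have [/h ->//|qz] := leP `|q - z| r.
by rewrite cm.2// !mulr0.
Qed.

Lemma lbm_indic (T : set (R * R)) : measurable (T : set plane) -> lbm (\1_T).
Proof.
move=> mT; split; first exact: measurable_indic.
by move=> r; exists 1 => p _; rewrite indicE; case: (_ \in _); rewrite ?normr1 ?normr0.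
Qed.

(** Mollifying the indicator of the set at depth 3r/4 with a kernel of radius r/4 confines the
    transition to depths between r/2 and r. The factor 64 is the cube of K r = 4. *)
Lemma soft_gen (C1 C2 : R) : 0 <= C1 -> 0 <= C2 ->
  (forall p, `|'D_(1, 0) (@bump R) p| <= C1) -> (forall p, `|'D_(0, 1) (@bump R) p| <= C2) ->
  forall A (K r c : R), 0 < K -> 0 < r -> K^-1 = 4^-1 * r -> 0 < c -> I2 (moll K) = c ->
  let s p := c^-1 * conv (\1_(inn A (3 / 4 * r))) (moll K) p in
  [/\ sm s, (forall z, 0 <= s z <= 1),
   (forall z, inn A r z -> s z = 1 /\ forall v, 'D_v s z = 0),
   (forall z, ~ inn A (2^-1 * r) z -> s z = 0 /\ forall v, 'D_v s z = 0) &
   (forall z, `|'D_(1, 0) s z| <= c^-1 * ((C1 + C2) * 64) / r /\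
              `|'D_(0, 1) s z| <= c^-1 * ((C1 + C2) * 64) / r)].
Proof.
move=> C10 C20 h1 h2 A K r c K0 r0 Kr c0 mE s.
have cm := csm_moll K0.
have li := lbm_indic (closed_measurable2 (@closed_inn A (3 / 4 * r))).
have sc := sm_conv li cm.
have ic0 : 0 < c^-1 by rewrite invr_gt0.
have ind01 q : 0 <= (\1_(inn A (3 / 4 * r)) q : R) <= 1.
  by rewrite indicE; case: (_ \in _); rewrite ?lexx ?ler01.
have inE z : inn A r z -> forall q, `|q - z| <= K^-1 ->
    \1_(inn A (3 / 4 * r)) q = cst 1 q :> R.
  move=> hz q qz; have hq : inn A (3 / 4 * r) q.
    move=> y hy; apply: hz.
    have := ler_normD (y - q) (q - z); rewrite addrA subrK.
    by move: qz hy; rewrite Kr; lra.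
  by rewrite indicE mem_set.
have outE z : ~ inn A (2^-1 * r) z -> forall q, `|q - z| <= K^-1 ->
    \1_(inn A (3 / 4 * r)) q = cst 0 q :> R.
  move=> /innN[y Ay hy] q qz; have hq : ~ inn A (3 / 4 * r) q.
    move=> hq; apply: Ay; apply: hq.
    have := ler_normB (y - z) (q - z); rewrite opprB addrA subrK.
    by move: qz hy; rewrite Kr; lra.
  by rewrite indicE memNset.
have c1E z : conv (cst 1) (moll K) z = c by rewrite mass_const.
have d1E z v : conv (cst 1) (fun p => 'D_v (moll K) p) z = 0.
  apply: oppr_inj; rewrite oppr0 -(D_conv z v (lbm_cst 1) cm).
  by rewrite (_ : conv (cst 1) (moll K) = fun=> c) ?derive_cst//; apply/funext.
have c0E m z : conv (cst 0) m z = 0.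
  rewrite /conv (eq_I2 (g := fun q => 0 * cst 0 q)) => [|q]; last by rewrite !mul0r.
  by rewrite I2Z ?mul0r//; apply: (@bcs_continuous R _ 0) => //; exact: cst_continuous.
have DE z v : 'D_v s z = c^-1 * - conv (\1_(inn A (3 / 4 * r))) (fun p => 'D_v (moll K) p) z.
  by rewrite /s (DZ _ _ _ sc) (D_conv _ _ li cm).
split.
- by apply: sm_mul; [exact: sm_cst|exact: sc].
- move=> z; apply/andP; split.
    apply: mulr_ge0; first exact: ltW.
    by apply: I2_ge0 => q; rewrite mulr_ge0 ?moll_ge0//; case/andP: (ind01 q).
  rewrite /s mulrC ler_pdivrMr// mul1r -(c1E z).
  apply: I2_le; [exact: bcs_conv li cm|exact: bcs_conv (lbm_cst 1) cm|move=> q].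
  by apply: ler_wpM2r; [exact: moll_ge0|case/andP: (ind01 q)].
- move=> z /inE hz; split.
    by rewrite /s (conv_local cm hz) c1E mulVf// gt_eqF.
  by move=> v; rewrite DE (conv_local (csmD v cm) hz) d1E oppr0 mulr0.
- move=> z /outE hz; split; first by rewrite /s (conv_local cm hz) c0E mulr0.
  by move=> v; rewrite DE (conv_local (csmD v cm) hz) c0E oppr0 mulr0.
- move=> z.
  have bd v C : 0 <= C -> (forall p, `|'D_v (@bump R) p| <= C) -> C <= C1 + C2 ->
      `|'D_v s z| <= c^-1 * ((C1 + C2) * 64) / r.
    move=> C0 hC CC; rewrite DE normrM normrN gtr0_norm// -[X in _ <= X]mulrA.
    apply: ler_wpM2l; first exact: ltW.
    have bcv := bcs_conv z li (csmD v cm).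
    apply: le_trans (I2_abs bcv) _.
    have r3 : 0 <= 2^-1 * r by rewrite mulr_ge0// ltW.
    have r4 : K^-1 < 2^-1 * r by rewrite Kr; lra.
    have dK p : `|'D_v (moll K) p| <= K ^+ 3 * C.
      have := @iter_dil R [:: v] K (@bump R) (K ^+ 2) p (@csm_bump R).1.
      rewrite /= => E; rewrite E expr1 -exprSr normrM ger0_norm ?exprn_ge0 ?(ltW K0)//.
      by apply: ler_wpM2l; [rewrite exprn_ge0// ltW|exact: hC].
    have := I2_norm_bound z r3 r4 (csmD v cm) dK.
    have Ki : K = 4 / r by rewrite -[K]invrK Kr invfM invrK.
    have -> : K ^+ 3 * C * (2 * (2^-1 * r)) ^+ 2 = C * 64 / r.
      by rewrite Ki; field; rewrite gt_eqF.
    move=> h; apply: (@le_trans _ _ (C * 64 / r)); last first.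
      by rewrite ler_pM2r ?invr_gt0// ler_pM2r.
    apply: le_trans h; apply: I2_le; [exact: bcs_abs|exact: bcs_abs (csm_bcs_shift z (csmD v cm))|].
    move=> q; rewrite normrM ler_piMl//; case/andP: (ind01 q) => i0 i1.
    by rewrite ger0_norm.
  by split; [apply: bd C10 h1 _; rewrite lerDl|apply: bd C20 h2 _; rewrite lerDr].
Qed.

Lemma soft_exists : exists2 C : R, 0 <= C & forall A n, exists s, [/\ sm s, (forall z, 0 <= s z <= 1),
   (forall z, inn A (2 ^+ n)^-1 z -> s z = 1 /\ forall v, 'D_v s z = 0),
   (forall z, ~ inn A (2 ^+ n.+1)^-1 z -> s z = 0 /\ forall v, 'D_v s z = 0) &
   (forall z, `|'D_(1, 0) s z| <= C * 2 ^+ n /\ `|'D_(0, 1) s z| <= C * 2 ^+ n)].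
Proof.
have [C1 C10 h1] := csm_bounded (csmD (1, 0) (@csm_bump R)).
have [C2 C20 h2] := csm_bounded (csmD (0, 1) (@csm_bump R)).
have c0 : 0 < I2 (moll (1 : R)) by exact: mass_gt0.
exists ((I2 (moll (1 : R)))^-1 * ((C1 + C2) * 64)).
  by rewrite mulr_ge0 ?invr_ge0 ?(ltW c0)// mulr_ge0// addr_ge0.
move=> A n.
have K0 : 0 < 2 ^+ n.+2 :> R by rewrite exprn_gt0.
have i0 : 0 < (2 ^+ n)^-1 :> R by rewrite invr_gt0 exprn_gt0.
have Kn : (2 ^+ n.+2)^-1 = 4^-1 * (2 ^+ n)^-1 :> R.
  by rewrite !exprS; field; rewrite expf_neq0 ?pnatr_eq0.
have := soft_gen C10 C20 h1 h2 A K0 i0 Kn c0 (mass_pow R n.+2).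
have -> : 2^-1 * (2 ^+ n)^-1 = (2 ^+ n.+1)^-1 :> R by rewrite exprS invfM.
by rewrite invrK => h; eexists; exact: h.
Qed.

End cutoff.

(** * The weighted sum over scales *)

Section cutoff_sum.
Variable R : realType.
Implicit Types (A : set (R * R)) (f g a b : R * R -> R) (p q u v z w : R * R) (r : R).

Definition harm m l : R := \sum_(k <- iota m l) k%:R^-1.

Lemma harm_gt0 m l : (0 < m)%N -> (0 < l)%N -> 0 < harm m l.
Proof.
move=> m0; case: l => // l _; rewrite /harm /= big_cons ltr_pwDl ?invr_gt0 ?ltr0n//.
by apply: sumr_ge0 => i _; rewrite invr_ge0 ler0n.
Qed.

(* Ahlfors' double-logarithmic cutoff: the transition at distance [4^-k] has weight [1 / k]. *)
Lemma cutoff_exists : exists2 C : R, 0 <= C & forall A m l, (0 < m)%N -> (0 < l)%N ->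
  exists h, [/\ sm h, (forall z, 0 <= h z <= 1),
   (forall z, inn A (2 ^+ (2 * m))^-1 z -> h z = 1),
   (forall z, ~ inn A (2 ^+ (2 * (m + l)))^-1 z -> h z = 0 /\ forall v, 'D_v h z = 0) &
   (forall z, (forall v, 'D_v h z = 0) \/ exists k, [/\ (0 < k)%N, ~ inn A (2 ^+ (2 * k))^-1 z,
     `|'D_(1, 0) h z| <= C * 2 ^+ (2 * k) / k%:R / harm m l &
     `|'D_(0, 1) h z| <= C * 2 ^+ (2 * k) / k%:R / harm m l])].
Proof.
have [C C0 hs] := soft_exists R; exists C => // A m l m0 l0.
have [s {}hs] := choice (hs A).
have S0 := harm_gt0 m0 l0; set S := harm m l in S0 *.
have Si0 : 0 <= S^-1 by rewrite invr_ge0 ltW.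
have ss k : sm (s k) by have [] := hs k.
have st k : sm (fun p => k%:R^-1 * s (2 * k)%N p) by apply: sm_mul => //; exact: sm_cst.
pose g p := \sum_(k <- iota m l) k%:R^-1 * s (2 * k)%N p.
have sg : sm g by exact: sm_sum.
have i01 z k : 0 <= s (2 * k)%N z <= 1 by have [_] := hs (2 * k)%N.
have ki (k : nat) : 0 <= k%:R^-1 :> R by rewrite invr_ge0 ler0n.
have Dg v z : 'D_v g z = \sum_(k <- iota m l) k%:R^-1 * 'D_v (s (2 * k)%N) z.
  rewrite /g Dsum//; apply: eq_bigr => k _; exact: DZ.
(* The exponents are even so that the transition bands, between depths 2^-(2k+1) and 2^-2k, are
   disjoint: at each point at most one summand has a nonzero gradient. *)
have gap k k' z : (k < k')%N -> inn A (2 ^+ (2 * k).+1)^-1 z -> inn A (2 ^+ (2 * k'))^-1 z.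
  move=> kk; apply: innS; rewrite lef_pV2 ?posrE ?exprn_gt0//.
  by rewrite ler_eXn2l ?ltr1n// -(ltn_pmul2l (m := 2)) in kk *.
exists (fun p => S^-1 * g p); split.
- by apply: sm_mul => //; exact: sm_cst.
- move=> z; have g0 : 0 <= g z.
    by apply: sumr_ge0 => k _; apply: mulr_ge0 => //; case/andP: (i01 z k).
  rewrite mulr_ge0//= mulrC ler_pdivrMr// mul1r; apply: ler_sum => k _.
  by rewrite ler_piMr//; case/andP: (i01 z k).
- move=> z hz; rewrite (_ : g z = S) ?mulVf ?gt_eqF//.
  rewrite /g /S /harm !big_seq; apply: eq_bigr => k; rewrite mem_iota => /andP[mk _].
  have [_ _ h1 _ _] := hs (2 * k)%N; rewrite (h1 z _).1 ?mulr1//.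
  apply: innS hz; rewrite lef_pV2 ?posrE ?exprn_gt0// ler_eXn2l ?ltr1n//.
  by rewrite leq_mul2l mk orbT.
- move=> z hz.
  have h k : k \in iota m l -> s (2 * k)%N z = 0 /\ forall v, 'D_v (s (2 * k)%N) z = 0.
    rewrite mem_iota => /andP[_ kl]; have [_ _ _ h2 _] := hs (2 * k)%N; apply: h2 => h3.
    by apply: hz; apply: gap h3.
  split.
    rewrite /g big_seq big1 ?mulr0// => k /h[-> _]; exact: mulr0.
  move=> v; rewrite DZ// Dg big_seq big1 ?mulr0// => k /h[_ ->]; exact: mulr0.
- move=> z.
  have [[k [kI k1 k2]]|no] := pselect (exists k, [/\ k \in iota m l,
    inn A (2 ^+ (2 * k).+1)^-1 z & ~ inn A (2 ^+ (2 * k))^-1 z]); [right|left].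
    have k0 : (0 < k)%N by move: kI; rewrite mem_iota => /andP[mk _]; exact: leq_trans mk.
    exists k.
    have other k' v : k' != k -> 'D_v (s (2 * k')%N) z = 0.
      rewrite neq_ltn => kk; have [_ _ h1 h2 _] := hs (2 * k')%N.
      case/orP: kk => kk.
        apply: (h2 z _).2 => h3; exact: k2 (gap _ _ _ kk h3).
      by apply: (h1 z _).2; exact: gap kk k1.
    have E v : 'D_v (fun p => S^-1 * g p) z = S^-1 * (k%:R^-1 * 'D_v (s (2 * k)%N) z).
      rewrite DZ// Dg (bigD1_seq k)//=; last exact: iota_uniq.
      by rewrite big1 ?addr0// => k' /other ->; rewrite mulr0.
    have fin x : `|x| <= C * 2 ^+ (2 * k) -> `|S^-1 * (k%:R^-1 * x)| <= C * 2 ^+ (2 * k) / k%:R / S.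
      move=> hx; rewrite !normrM (ger0_norm Si0) (ger0_norm (ki k)).
      rewrite (_ : C * _ / _ / _ = S^-1 * (k%:R^-1 * (C * 2 ^+ (2 * k)))); last first.
        by rewrite mulrC (mulrC _ k%:R^-1).
      by apply: ler_wpM2l => //; apply: ler_wpM2l.
    have [_ _ _ _ h3] := hs (2 * k)%N.
    have [g1 g2] := h3 z; split; [exact: k0|exact: k2|rewrite E; exact: fin g1|].
    by rewrite E; exact: fin g2.
  move=> v; rewrite DZ// Dg big_seq big1 ?mulr0// => k kI.
  have [_ _ h1 h2 _] := hs (2 * k)%N.
  have [k2|k2] := pselect (inn A (2 ^+ (2 * k))^-1 z); first by rewrite (h1 z k2).2 mulr0.
  rewrite (h2 z _).2 ?mulr0// => k1; apply: no; exists k; split => //.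
Qed.

End cutoff_sum.

(** * The complex plane *)

Section complex_plane.
Variable R : realType.
Implicit Types (A S : set R[i]^o) (p q z w : R * R) (r : R).

Definition frC (c : R[i]^o) : R * R := (complex.Re c, complex.Im c).

Lemma toCK : cancel (toC R) frC. Proof. by case. Qed.
Lemma frCK : cancel frC (toC R). Proof. by case. Qed.

Lemma toCB p q : toC R p - toC R q = toC R (p - q). Proof. by case: p; case: q. Qed.

Lemma normC_sq p : Normc.normc (toC R p) = Num.sqrt (p.1 ^+ 2 + p.2 ^+ 2).
Proof. by []. Qed.

Lemma norm_le_normc p : `|p| <= Normc.normc (toC R p).
Proof.
rewrite normC_sq prod_normE /= ge_max -!sqrtr_sqr !ler_sqrt ?addr_ge0 ?sqr_ge0//.
by rewrite lerDl lerDr !sqr_ge0.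
Qed.

Lemma normc_le_norm p : Normc.normc (toC R p) <= 2 * `|p|.
Proof.
rewrite normC_sq -[leRHS]ger0_norm ?mulr_ge0// -sqrtr_sqr ler_sqrt ?sqr_ge0//.
have h (x : R) : `|x| <= `|p| -> x ^+ 2 <= `|p| ^+ 2.
  by move=> hx; rewrite -real_normK ?num_real// ler_pXn2r ?nnegrE.
have h1 : `|p.1| <= `|p| by rewrite prod_normE le_max lexx.
have h2 : `|p.2| <= `|p| by rewrite prod_normE le_max lexx orbT.
by have := h _ h1; have := h _ h2; have := sqr_ge0 `|p|; rewrite exprMn; lra.
Qed.

Lemma nbhs_toC p S : nbhs (toC R p) S <-> nbhs p (toC R @^-1` S).
Proof.
have E (c : R[i]^o) : `|c| = (Normc.normc c)%:C%C by [].
split=> /nbhs_ballP[e e0 h]; apply/nbhs_ballP.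
(* Radii of balls in [R[i]] are themselves complex numbers; positivity makes them real. The factor 2
   is the comparison of modulus and sup norm. *)
- have e0' : 0 < complex.Re e by move: e0; rewrite /= ltcE => /andP[].
  have Ee : e = (complex.Re e)%:C%C.
    by move: e0; rewrite /= ltcE; case: (e) => x y /= /andP[/eqP ->].
  exists (2^-1 * complex.Re e); first by rewrite /= mulr_gt0.
  move=> q; rewrite -ball_normE /= => pq; apply: h.
  rewrite -ball_normE /= toCB E Ee ltcR.
  by have := normc_le_norm (p - q); lra.
- exists (e%:C)%C; first by rewrite /= ltcR.
  move=> c; rewrite -ball_normE /= -[c]frCK => pc; apply: h.
  rewrite -ball_normE /=; move: pc; rewrite toCB E ltcR; apply: le_lt_trans; exact: norm_le_normc.
Qed.

Lemma nbhs_frC (c : R[i]^o) (T : set (R * R)) : nbhs (frC c) T <-> nbhs c (frC @^-1` T).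
Proof.
rewrite -[c in X in _ <-> X]frCK nbhs_toC.
by rewrite (_ : toC R @^-1` (frC @^-1` T) = T)//; apply/seteqP; split=> x /=; rewrite toCK.
Qed.

Lemma toC_cont : continuous (toC R).
Proof. by move=> p S /= /nbhs_toC. Qed.
Lemma frC_cont : continuous frC.
Proof. by move=> c T /= /nbhs_frC. Qed.

Lemma open_toC A : open A -> open (toC R @^-1` A).
Proof. by move=> oA; apply: open_comp => // p _; exact: toC_cont. Qed.

Lemma frC_image A : frC @` A = toC R @^-1` A.
Proof.
apply/seteqP; split=> [p [c Ac <-]|p Ap] /=; first by rewrite frCK.
by exists (toC R p) => //; exact: toCK.
Qed.

Lemma compact_toC A : compact A -> compact (toC R @^-1` A).
Proof.
move=> cA; rewrite -frC_image; apply: continuous_compact => //.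
by apply: continuous_subspaceT => c; exact: frC_cont.
Qed.

Lemma compact_frC (T : set (R * R)) : compact T -> compact (frC @^-1` T).
Proof.
move=> cT; rewrite (_ : _ @^-1` _ = toC R @` T).
  by apply: continuous_compact => //; apply: continuous_subspaceT => c; exact: toC_cont.
apply/seteqP; split=> [c Tc|c [p Tp <-]] /=; last by rewrite toCK.
by exists (frC c) => //; exact: frCK.
Qed.

(** From here to [distr_rdist] the distributional derivatives are rewritten for real functions on
    [R * R], one component at a time, where the calculus above applies. *)
Definition rtest (T : set (R * R)) phi :=
  sm phi /\ exists L, [/\ compact L, L `<=` T & forall p, ~ L p -> phi p = 0].

Lemma test_rtest A phi : test_function A phi -> rtest (toC R @^-1` A) phi.
Proof.
move=> [s [L [cL LA L0]]]; split; first exact: smooth_sm.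
exists (toC R @^-1` L); split => //; first exact: compact_toC.
by move=> p /LA.
Qed.

Lemma rtest_test A phi : rtest (toC R @^-1` A) phi -> test_function A phi.
Proof.
move=> [s [L [cL LA L0]]]; split; first exact: sm_smooth.
exists (frC @^-1` L); split; first exact: compact_frC.
  by move=> c /= /LA; rewrite /= frCK.
by move=> p /=; rewrite toCK; exact: L0.
Qed.

Definition locint (T : set (R * R)) (P : R * R -> R) :=
  forall L, compact L -> L `<=` T -> (leb2 R).-integrable L (EFin \o P).

Definition rdist T v (u P : R * R -> R) := locint T P /\
  forall phi, rtest T phi ->
    \int[leb2 R]_(p in T) (u p * 'D_v phi p) = - \int[leb2 R]_(p in T) (P p * phi p).

Lemma distr_rdist A v V P : distr_derivative A v V P <->
  rdist (toC R @^-1` A) v (fun p => complex.Re (V (toC R p))) (fun p => complex.Re (P (toC R p))) /\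
  rdist (toC R @^-1` A) v (fun p => complex.Im (V (toC R p))) (fun p => complex.Im (P (toC R p))).
Proof.
have H L : toC R @^-1` (frC @^-1` L) = L.
  by apply/seteqP; split=> p /=; rewrite toCK.
split.
  move=> [lP t]; split; split.
  - move=> L cL LA; have [|] := lP _ (compact_frC cL); first by move=> c /LA; rewrite /= frCK.
    by rewrite H.
  - by move=> phi /rtest_test/t[].
  - move=> L cL LA; have [|_] := lP _ (compact_frC cL); first by move=> c /LA; rewrite /= frCK.
    by rewrite H.
  - by move=> phi /rtest_test/t[].
move=> [[l1 t1] [l2 t2]]; split.
  move=> L cL LA; split; [apply: l1|apply: l2]; try exact: compact_toC.
    by move=> p /LA.
  by move=> p /LA.
by move=> phi /test_rtest tp; split; [exact: t1|exact: t2].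
Qed.

End complex_plane.

(** * Distributional derivatives of cut off fields *)

Section transplant.
Variable R : realType.
Implicit Types (T A B L : set (R * R)) (p q z w v : R * R) (r : R) (u P f g h phi : R * R -> R).
Local Notation plane := (measurableTypeR R * measurableTypeR R)%type.

Lemma compact_radius L : compact L -> exists r, forall p, L p -> `|p| <= r.
Proof.
move=> /compact_bounded[M [_ h]]; exists (M + 1) => p Lp.
by apply: (h (M + 1)) => //; rewrite ltrDl.
Qed.

Lemma compact_closed2 L : compact L -> closed L.
Proof. by apply: compact_closed; exact: norm_hausdorff. Qed.

Lemma compact_meas L : compact L -> measurable (L : set plane).
Proof. by move=> /compact_closed2; exact: closed_measurable2. Qed.

Lemma supp_compact_derive L f v : compact L -> (forall p, ~ L p -> f p = 0) ->
  forall p, ~ L p -> 'D_v f p = 0.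
Proof.
move=> /compact_closed2 cL f0 p Lp.
have oL : open (~` L) by exact: closed_openC.
have /nbhs_ballP[e e0 he] := open_nbhs_nbhs (conj oL Lp).
rewrite (near_eq_derive (g := cst 0)); last first.
  by near=> q; rewrite f0//; near: q; apply/nbhs_ballP; exists e.
exact: derive_cst.
Unshelve. all: by end_near. Qed.

Lemma rtest_csm T phi : rtest T phi -> exists r, csm r phi.
Proof.
move=> [s [L [cL LT h]]]; have [r hr] := compact_radius cL.
exists r; split => // p rp; apply: h => /hr; rewrite leNgt; by rewrite rp.
Qed.

Lemma bcs_compact f L : compact L -> (forall p, ~ L p -> f p = 0) -> lbm f -> bcs f.
Proof.
move=> cL f0 lf; have [r hr] := compact_radius cL.
rewrite (_ : f = fun p => \1_L p * f p).
  by apply: bcsMl => //; apply: bcs_indic hr; exact: compact_meas.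
apply/funext => p; rewrite indicE; have [pL|pL] := boolP (p \in L); first by rewrite mul1r.
by rewrite mul0r f0// => Lp; move: pL; rewrite mem_set.
Qed.

Lemma int_off T f : (forall p, ~ T p -> f p = 0) -> \int[leb2 R]_(p in T) f p = I2 f.
Proof.
move=> h; rewrite Rintegral_mkcond; apply: eq_I2 => p; rewrite patchE.
by case: ifPn => // /negP pT; rewrite h// => Tp; apply: pT; exact/mem_set.
Qed.

Lemma locint_mul T L P g : locint T P -> compact L -> L `<=` T -> lbm g ->
  (forall p, ~ L p -> g p = 0) ->
  (leb2 R).-integrable [set: plane] (EFin \o (fun p => P p * g p)).
Proof.
move=> lP cL LT lg g0; have iP := lP _ cL LT; have mL := compact_meas cL.
have [mg bg] := lg; have [r hr] := compact_radius cL; have [M hM] := bg r.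
have h : (leb2 R).-integrable L ((EFin \o P) \* (EFin \o g))%E.
  apply: integrableMl => //; first exact: measurable_funTS.
  exists M; split; first exact: num_real.
  by move=> x Mx p Lp; apply: le_trans (hM _ (hr _ Lp)) (ltW Mx).
move/(integrable_mkcond _ mL) : h; apply: eq_integrable => // p _.
rewrite patchE; case: ifPn => //= /negP pL; rewrite g0 ?mulr0// => Lp.
by apply: pL; exact/mem_set.
Qed.

Lemma rdist_I2 T v u P phi : rdist T v u P -> rtest T phi ->
  I2 (fun p => u p * 'D_v phi p) = - I2 (fun p => P p * phi p).
Proof.
move=> [_ h] tphi; have [_ [L [cL LT p0]]] := tphi; have := h _ tphi.
by rewrite !int_off// => p pT; rewrite ?(supp_compact_derive v cL p0) ?p0 ?mulr0// => /LT.
Qed.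

(** A test function on [B] times [h] is a test function on [A], because [h] vanishes close to the
    complement of [A]. So the Leibniz formula holds on an arbitrary set [B]. *)
Lemma rdist_cut A B v a u P h r : 0 < r -> continuous a -> (forall p, A p -> u p = a p) ->
  sm h -> (forall p, ~ inn A r p -> h p = 0 /\ 'D_v h p = 0) ->
  rdist A v u P ->
  rdist B v (fun p => h p * a p) (fun p => h p * P p + a p * 'D_v h p).
Proof.
move=> r0 ca ua sh h0 d; have [lP _] := d.
have lh : lbm h by apply: continuous_lbm; exact: sm_cont.
have la : lbm a by exact: continuous_lbm.
have lDh : lbm (fun p => 'D_v h p) by apply: continuous_lbm; apply: sm_cont; exact: smD.
have cut L : compact L -> compact (L `&` inn A r).
  by move=> cL; apply: compact_closedI => //; exact: closed_inn.
have LA L : L `&` inn A r `<=` A by move=> p [_ hp]; exact: inn_sub hp.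
split.
  move=> L cL LB; have mL := compact_meas cL.
  have mL' := compact_meas (cut _ cL).
  (* [P] is integrable only on compact subsets of [A]; inserting the indicator leaves the product
     unchanged and confines it to one. *)
  have i1 : (leb2 R).-integrable L (EFin \o (fun p => P p * (\1_(L `&` inn A r) p * h p))).
    apply: (@integrableS _ _ _ _ setT) => //.
    apply: (locint_mul lP (cut _ cL) (@LA L)); first by apply: lbmM => //; exact: lbm_indic.
    by move=> p Lp; rewrite indicE memNset ?mul0r.
  have i2 : (leb2 R).-integrable L (EFin \o (fun p => \1_L p * (a p * 'D_v h p))).
    apply: (@integrableS _ _ _ _ setT) => //; apply: bcs_integrable.
    apply: bcsMl; last exact: lbmM.
    by have [s hs] := compact_radius cL; exact: bcs_indic hs.
  have := integrableD mL i1 i2; apply: eq_integrable => // p /set_mem Lp.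
  rewrite /= -EFinD; congr (_%:E); rewrite (_ : \1_L p = 1) ?mul1r; last by rewrite indicE mem_set.
  congr (_ + _).
  have [pA|pA] := pselect (inn A r p); last by rewrite (h0 p pA).1 !mulr0 mul0r.
  by rewrite indicE mem_set// mul1r mulrC.
move=> phi [sphi [L [cL LB p0]]].
have D0 := supp_compact_derive v cL p0.
have lphi : lbm phi by apply: continuous_lbm; exact: sm_cont.
have lDphi : lbm (fun p => 'D_v phi p) by apply: continuous_lbm; apply: sm_cont; exact: smD.
have := rdist_I2 d (phi := fun p => phi p * h p).
rewrite !int_off; last 2 first.
- by move=> p Bp; rewrite p0 ?mulr0// => /LB.
- by move=> p Bp; rewrite D0 ?mulr0// => /LB.
have t0 p : ~ (L `&` inn A r) p -> phi p * h p = 0.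
  move=> Lp; have [pA|pA] := pselect (inn A r p); last by rewrite (h0 p pA).1 mulr0.
  by rewrite p0 ?mul0r// => pL; apply: Lp.
have -> : I2 (fun p => u p * 'D_v (fun p => phi p * h p) p) =
    I2 (fun p => a p * h p * 'D_v phi p + a p * 'D_v h p * phi p).
  apply: eq_I2 => p; have [pA|pA] := pselect (A p); first by rewrite ua// DM//; ring.
  have hp : ~ inn A r p by move=> /(inn_sub r0).
  by rewrite DM// (h0 p hp).1 (h0 p hp).2; ring.
rewrite I2D; last 2 first.
- apply: (bcs_compact cL) => [p Lp|]; first by rewrite D0 ?mulr0.
  by do 2 apply: lbmM => //.
- apply: (bcs_compact cL) => [p Lp|]; first by rewrite p0 ?mulr0.
  by do 2 apply: lbmM => //.
have -> : I2 (fun p => (h p * P p + a p * 'D_v h p) * phi p) =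
    I2 (fun p => P p * (phi p * h p)) + I2 (fun p => a p * 'D_v h p * phi p).
  rewrite -[RHS]RintegralD//; last 2 first.
  - by apply: (locint_mul lP (cut _ cL) (@LA L)) => //; exact: lbmM.
  - apply: bcs_integrable; apply: (bcs_compact cL) => [p Lp|]; first by rewrite p0 ?mulr0.
    by do 2 apply: lbmM => //.
  by apply: eq_I2 => p; ring.
have -> : I2 (fun p => h p * a p * 'D_v phi p) = I2 (fun p => a p * h p * 'D_v phi p).
  by apply: eq_I2 => p; rewrite (mulrC (h p)).
move=> H; rewrite opprD; apply: canRL (addrK _) _; apply: H; split; first exact: sm_mul.
by exists (L `&` inn A r); split => //; exact: cut.
Qed.

End transplant.

(** * Competitors as continuous real fields on the plane *)

Section extraction.
Variable R : realType.
Implicit Types (A B : set R[i]^o) (T L : set (R * R)) (p q z w v : R * R) (V F : R[i]^o -> R[i]^o).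
Implicit Types (r M : R) (P f g h phi : R * R -> R).
Local Notation plane := (measurableTypeR R * measurableTypeR R)%type.

Lemma leb2_gt0 : (0 < leb2 R setT)%E.
Proof.
have : (leb2 R (ball (0 : R * R)%R 1%R) <= leb2 R setT)%E.
  by apply: le_measure; rewrite ?inE//; exact: measurable_ballX.
by apply: lt_le_trans; rewrite leb2_ball// lte_fin mulr1 exprn_gt0.
Qed.

Lemma normc_ge0 (c : R[i]^o) : 0 <= Normc.normc c.
Proof. by case: c => x y; exact: sqrtr_ge0. Qed.

Lemma ae_imp (P Q : R * R -> Prop) : (forall p, P p -> Q p) ->
  {ae leb2 R, forall p, P p} -> {ae leb2 R, forall p, Q p}.
Proof.
move=> PQ [N [mN N0 hN]]; exists N; split => // p nQ; apply: hN => Pp; exact: nQ (PQ _ Pp).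
Qed.

Lemma Linf_leP A F M : 0 <= M -> (Linf_norm A F <= M%:E)%E <->
  {ae leb2 R, forall p, A (toC R p) -> Normc.normc (F (toC R p)) <= M}.
Proof.
move=> M0; rewrite /Linf_norm unlock /Lnorm leb2_gt0; split.
  move=> /ess_sup_inf.ess_supP; apply: filterS => p /= + Ap.
  by rewrite patchE mem_set//= ger0_norm ?normc_ge0// lee_fin.
move=> h; apply/ess_sup_inf.ess_supP; apply: ae_imp h => p h.
rewrite /= patchE; case: ifPn => [/set_mem/h|_]; last by rewrite /= normr0 lee_fin.
by rewrite /= ger0_norm ?normc_ge0// lee_fin.
Qed.

Lemma Linf_ge0 A F : (0 <= Linf_norm A F)%E.
Proof. exact: Lnorm_ge0. Qed.

Lemma le_Re_normc (c : R[i]^o) : `|complex.Re c| <= Normc.normc c.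
Proof.
rewrite -[c]frCK; apply: le_trans (norm_le_normc _).
by rewrite prod_normE le_max lexx.
Qed.

Lemma le_Im_normc (c : R[i]^o) : `|complex.Im c| <= Normc.normc c.
Proof.
rewrite -[c]frCK; apply: le_trans (norm_le_normc _).
by rewrite prod_normE le_max lexx orbT.
Qed.

Lemma two_inv_C : (2^-1 : R[i]) = (2^-1 : R)%:C%C.
Proof. by rewrite -[2 in LHS](rmorph_nat (real_complex R)) -fmorphV. Qed.

Lemma dbar_Re (Vx Vy : R[i]^o -> R[i]^o) c :
  complex.Re (dbar_of Vx Vy c) = 2^-1 * (complex.Re (Vx c) - complex.Im (Vy c)).
Proof.
rewrite /dbar_of two_inv_C; case: (Vx c) => x1 y1; case: (Vy c) => x2 y2 /=.
by rewrite !mul0r !mul1r !subr0 add0r.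
Qed.

Lemma dbar_Im (Vx Vy : R[i]^o -> R[i]^o) c :
  complex.Im (dbar_of Vx Vy c) = 2^-1 * (complex.Im (Vx c) + complex.Re (Vy c)).
Proof.
rewrite /dbar_of two_inv_C; case: (Vx c) => x1 y1; case: (Vy c) => x2 y2 /=.
by rewrite !mul0r !mul1r !addr0 add0r.
Qed.

Lemma weak_bound T P f L r M : csm r f -> L `<=` T -> (forall p, ~ L p -> f p = 0) -> 0 <= M ->
  (leb2 R).-integrable [set: plane] (EFin \o (fun p => P p * f p)) ->
  {ae leb2 R, forall p, T p -> `|P p| <= M} ->
  `|I2 (fun p => P p * f p)| <= M * I2 (fun p => `|f p|).
Proof.
move=> cf LT f0 M0 iP hP; have bf := bcs_abs (csm_bcs cf).
have iM := bcs_integrable (bcsZ M bf).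
rewrite -I2Z//; apply: le_trans (le_normr_Rintegral _ iP) _ => //.
rewrite /I2 /Rintegral; apply: fine_le.
- by apply: integrable_fin_num => //; exact: (integrable_norm iP).
- exact: integrable_fin_num.
- have m1 := measurable_int _ (integrable_norm iP); have m2 := measurable_int _ iM.
  apply: (ae_ge0_le_integral measurableT _ m1 _ m2).
  + by move=> p _ /=; rewrite lee_fin.
  + by move=> p _ /=; rewrite lee_fin mulr_ge0.
  apply: ae_imp hP => p hp _ /=; rewrite lee_fin normrM.
  have [Lp|Lp] := pselect (L p); last by rewrite f0// normr0 !mulr0.
  by apply: ler_wpM2r => //; apply: hp; exact: LT.
Qed.

Definition zre A V : R * R -> R := (fun p => complex.Re (V (toC R p))) \_ (toC R @^-1` A).
Definition zim A V : R * R -> R := (fun p => complex.Im (V (toC R p))) \_ (toC R @^-1` A).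

Lemma zreE A V p : A (toC R p) -> zre A V p = complex.Re (V (toC R p)).
Proof. by move=> Ap; rewrite /zre patchE mem_set. Qed.
Lemma zimE A V p : A (toC R p) -> zim A V p = complex.Im (V (toC R p)).
Proof. by move=> Ap; rewrite /zim patchE mem_set. Qed.
Lemma zre0 A V p : ~ A (toC R p) -> zre A V p = 0.
Proof. by move=> Ap; rewrite /zre patchE memNset. Qed.
Lemma zim0 A V p : ~ A (toC R p) -> zim A V p = 0.
Proof. by move=> Ap; rewrite /zim patchE memNset. Qed.

(** A point outside [A] either is a boundary point, where the limit is 0, or has a neighbourhood
    that misses [A]. *)
Lemma within_boundary A V : open A ->
  (forall b, boundary A b -> V c @[c --> within A (nbhs b)] --> (0 : R[i]^o)) ->
  forall p, ~ A (toC R p) -> forall e : R, 0 < e ->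
    \forall q \near p, A (toC R q) -> `|frC (V (toC R q))| < e.
Proof.
move=> oA hb p Ap e e0; have [clA|nclA] := pselect (closure A (toC R p)).
  have bp : boundary A (toC R p) by split => // /interior_subset.
  have hN : nbhs (0 : R[i]^o) [set c | `|frC c| < e].
    apply: (nbhs_frC (0 : R[i]^o) [set q | `|q| < e]).1.
    apply/nbhs_ballP; exists e => // q.
    by rewrite -ball_normE /= (_ : frC _ = 0)// sub0r normrN.
  by have := hb _ bp _ hN; move=> /nbhs_toC.
have oC : open (~` closure A) by apply: closed_openC; exact: closed_closure.
have /nbhs_toC := open_nbhs_nbhs (conj oC nclA).
by apply: filterS => q hq Aq; case: hq; exact: (@subset_closure _ A (toC R q)).
Qed.

Lemma zext_cont A V : open A -> {within A, continuous V} ->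
  (forall b, boundary A b -> V c @[c --> within A (nbhs b)] --> (0 : R[i]^o)) ->
  continuous (zre A V) /\ continuous (zim A V).
Proof.
move=> oA cV hb; have wb := within_boundary oA hb.
have cA c : A c -> {for c, continuous V}.
  by move=> Ac; move: cV; rewrite continuous_open_subspace// => /(_ c); apply; exact: mem_set.
have nA p : A (toC R p) -> \forall q \near p, A (toC R q).
  by move=> Ap; apply/nbhs_toC; exact: open_nbhs_nbhs.
have c2 p : A (toC R p) -> {for p, continuous (@frC R \o V \o toC R)}.
  move=> Ap; apply: continuous_comp; first exact: toC_cont.
  by apply: continuous_comp; [exact: cA|exact: frC_cont].
split=> p; have [Ap|Ap] := pselect (A (toC R p)).
- rewrite /continuous_at zreE//.
  have h : {for p, continuous (fst \o (@frC R \o V \o toC R))}.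
    by apply: continuous_comp; [exact: c2|exact: cvg_fst].
  apply: cvg_trans h; apply: near_eq_cvg.
  by apply: filterS (nA p Ap) => q Aq; rewrite zreE.
- rewrite /continuous_at zre0//; apply/cvgr0Pnorm_lt => e e0.
  apply: filterS (wb p Ap e e0) => q hq.
  have [Aq|Aq] := pselect (A (toC R q)); last by rewrite zre0// normr0.
  rewrite zreE//; apply: le_lt_trans (hq Aq).
  by rewrite prod_normE le_max lexx.
- rewrite /continuous_at zimE//.
  have h : {for p, continuous (snd \o (@frC R \o V \o toC R))}.
    by apply: continuous_comp; [exact: c2|exact: cvg_snd].
  apply: cvg_trans h; apply: near_eq_cvg.
  by apply: filterS (nA p Ap) => q Aq; rewrite zimE.
- rewrite /continuous_at zim0//; apply/cvgr0Pnorm_lt => e e0.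
  apply: filterS (wb p Ap e e0) => q hq.
  have [Aq|Aq] := pselect (A (toC R q)); last by rewrite zim0// normr0.
  rewrite zimE//; apply: le_lt_trans (hq Aq).
  by rewrite prod_normE le_max lexx orbT.
Qed.

Lemma zext_subq A V : vanishes_on_boundary A V ->
  subquadratic (zre A V) /\ subquadratic (zim A V).
Proof.
move=> [_ h].
have H (e : R) : 0 < e -> exists T : R, forall p, T <= `|p| -> A (toC R p) ->
    Normc.normc (V (toC R p)) <= e * `|p| ^+ 2.
  move=> e0; have e4 : 0 < e / 4 by rewrite divr_gt0.
  have hp := h _ e4; have [T hT] : exists T : R, forall c, A c -> T <= Normc.normc c ->
      Normc.normc (V c) <= e / 4 * Normc.normc c ^+ 2.
    by near (+oo%R : set_system R) => T; exists T; near: T.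
  exists T => p Tp Ap.
  apply: le_trans (hT _ Ap (le_trans Tp (norm_le_normc p))) _.
  have n2 := normc_le_norm p.
  have : Normc.normc (toC R p) ^+ 2 <= (2 * `|p|) ^+ 2.
    by rewrite ler_pXn2r ?nnegrE ?mulr_ge0// normc_ge0.
  rewrite exprMn => h2; rewrite -mulrA ler_pM2l//.
  by rewrite mulrC ler_pdivrMr// mulrC; lra.
split=> e e0; have [T hT] := H e e0; exists T => p Tp.
  have [Ap|Ap] := pselect (A (toC R p)); last first.
    by rewrite zre0// normr0 mulr_ge0 ?sqr_ge0// ltW.
  by rewrite zreE//; apply: le_trans (hT p Tp Ap); exact: le_Re_normc.
have [Ap|Ap] := pselect (A (toC R p)); last first.
  by rewrite zim0// normr0 mulr_ge0 ?sqr_ge0// ltW.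
by rewrite zimE//; apply: le_trans (hT p Tp Ap); exact: le_Im_normc.
Unshelve. all: by end_near. Qed.

Lemma rdist_ext T v u u' P : (forall p, T p -> u p = u' p) -> rdist T v u P -> rdist T v u' P.
Proof.
move=> e [l h]; split => // phi tphi; rewrite -h//.
by apply: eq_Rintegral => p /set_mem pT; rewrite e.
Qed.

(** The factor 2 is the one half in the definition of dbar: the pairings [E1] and [E2] see 2 Re [F]
    and 2 Im [F]. *)
Lemma zext_weakA A V F M : continuous (zre A V) -> continuous (zim A V) -> 0 <= M ->
  is_dbar A V F -> (Linf_norm A F <= M%:E)%E ->
  weakA (toC R @^-1` A) (2 * M) (zre A V) (zim A V).
Proof.
move=> ca cb M0 [Vx [Vy [/distr_rdist[dxr dxi] /distr_rdist[dyr dyi] EF]]] /Linf_leP-/(_ M0) hF.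
move=> r f L cf cL LT f0.
have sf := cf.1; have bf := csm_bcs cf; have lf := bcs_lbm bf.
have tf : rtest (toC R @^-1` A) f by split => //; exists L.
have ex u P v : rdist (toC R @^-1` A) v u P -> (forall p, A (toC R p) -> u p = zre A V p) ->
    I2 (fun p => zre A V p * 'D_v f p) = - I2 (fun p => P p * f p).
  by move=> /[swap] e /(rdist_ext e)/rdist_I2; exact.
have ey u P v : rdist (toC R @^-1` A) v u P -> (forall p, A (toC R p) -> u p = zim A V p) ->
    I2 (fun p => zim A V p * 'D_v f p) = - I2 (fun p => P p * f p).
  by move=> /[swap] e /(rdist_ext e)/rdist_I2; exact.
have li P v u : rdist (toC R @^-1` A) v u P ->
    (leb2 R).-integrable [set: plane] (EFin \o (fun p => P p * f p)).
  by move=> [lP _]; exact: (locint_mul lP cL).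
have bD (u : R * R -> R) v : continuous u -> bcs (fun p => u p * 'D_v f p).
  move=> cu; apply: (bcs_compact cL) => [p Lp|].
    by rewrite (supp_compact_derive v cL f0) ?mulr0.
  apply: lbmM; apply: continuous_lbm => //; apply: sm_cont; exact: smD.
have eRe p : complex.Re (F (toC R p)) =
    2^-1 * (complex.Re (Vx (toC R p)) - complex.Im (Vy (toC R p))) by rewrite EF dbar_Re.
have eIm p : complex.Im (F (toC R p)) =
    2^-1 * (complex.Im (Vx (toC R p)) + complex.Re (Vy (toC R p))) by rewrite EF dbar_Im.
have i1 := li _ _ _ dxr; have i2 := li _ _ _ dxi; have i3 := li _ _ _ dyr; have i4 := li _ _ _ dyi.
split.
- rewrite /E1 I2B; [|exact: bD|exact: bD].
  rewrite (ex _ _ _ dxr) ?(ey _ _ _ dyi); try by move=> p Ap; rewrite ?zreE ?zimE.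
  rewrite opprK addrC -opprB normrN -RintegralB//.
  rewrite (_ : \int[_]_p _ = I2 (fun p => (2 * complex.Re (F (toC R p))) * f p)); last first.
    by apply: eq_I2 => p; rewrite eRe; field.
  apply: (weak_bound cf LT f0); first by rewrite mulr_ge0.
    have := integrableB measurableT i1 i4; apply: eq_integrable => // p _ /=.
    by rewrite -EFinB; congr (_%:E); rewrite eRe; field.
  apply: ae_imp hF => p hF Ap; rewrite normrM ger0_norm// ler_pM2l//.
  by apply: le_trans (hF Ap); exact: le_Re_normc.
- rewrite /E2 I2D; [|exact: bD|exact: bD].
  rewrite (ey _ _ _ dxi) ?(ex _ _ _ dyr); try by move=> p Ap; rewrite ?zreE ?zimE.
  rewrite -opprD normrN -RintegralD//.
  rewrite (_ : \int[_]_p _ = I2 (fun p => (2 * complex.Im (F (toC R p))) * f p)); last first.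
    by apply: eq_I2 => p; rewrite eIm; field.
  apply: (weak_bound cf LT f0); first by rewrite mulr_ge0.
    have := integrableD measurableT i2 i3; apply: eq_integrable => // p _ /=.
    by rewrite -EFinD; congr (_%:E); rewrite eIm; field.
  apply: ae_imp hF => p hF Ap; rewrite normrM ger0_norm// ler_pM2l//.
  by apply: le_trans (hF Ap); exact: le_Im_normc.
Qed.

End extraction.

(** * Transplanting competitors *)

Section density_transplant.
Variable R : realType.
Implicit Types (A B : set R[i]^o) (T L : set (R * R)) (p q z w v : R * R) (V F : R[i]^o -> R[i]^o).
Implicit Types (r M : R) (P f g h phi : R * R -> R).

(** The field is zero near each boundary point of [B], since a point outside [T] is within [r] of
    it, and zero far away, since [T] meets [B] in a bounded set. The components are abstract so that
    both a given competitor and a constant field can be cut off. *)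
Lemma cut_family B w T a b ua ub Pxr Pxi Pyr Pyi h r (D : R) : 0 < r ->
  continuous a -> continuous b -> (forall p, T p -> ua p = a p) -> (forall p, T p -> ub p = b p) ->
  sm h -> (forall p, ~ inn T r p -> h p = 0 /\ forall v, 'D_v h p = 0) ->
  rdist T (1, 0) ua Pxr -> rdist T (1, 0) ub Pxi ->
  rdist T (0, 1) ua Pyr -> rdist T (0, 1) ub Pyi ->
  (forall p, boundary B (toC R p) -> exists2 q, ~ T q & `|q - p| < r) ->
  (forall p, T p -> B (toC R p) -> `|p| <= D) -> h w * a w = 1 -> h w * b w = 0 ->
  exists V F, [/\ teichmuller_family B (toC R w) V, is_dbar B V F & forall p, F (toC R p) =
    toC R (h p * (2^-1 * (Pxr p - Pyi p)) + 2^-1 * (a p * 'D_(1, 0) h p - b p * 'D_(0, 1) h p),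
           h p * (2^-1 * (Pxi p + Pyr p)) + 2^-1 * (b p * 'D_(1, 0) h p + a p * 'D_(0, 1) h p))].
Proof.
move=> r0 ca cb ea eb sh h0 dxr dxi dyr dyi hB hD ha hb.
pose V c : R[i]^o := toC R (h (frC c) * a (frC c), h (frC c) * b (frC c)).
pose X c : R[i]^o := toC R (h (frC c) * Pxr (frC c) + a (frC c) * 'D_(1, 0) h (frC c),
                           h (frC c) * Pxi (frC c) + b (frC c) * 'D_(1, 0) h (frC c)).
pose Y c : R[i]^o := toC R (h (frC c) * Pyr (frC c) + a (frC c) * 'D_(0, 1) h (frC c),
                           h (frC c) * Pyi (frC c) + b (frC c) * 'D_(0, 1) h (frC c)).
have ch := sm_cont sh.
have cG : continuous (fun p => (h p * a p, h p * b p)).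
  by move=> p; exact: (cvg_pair (cvgM (ch p) (ca p)) (cvgM (ch p) (cb p))).
have cV : continuous V.
  by move=> c; exact: (continuous_comp (continuous_comp (@frC_cont R c) (cG _)) (@toC_cont R _)).
have V0 c : ~ inn T r (frC c) -> V c = 0.
  by move=> /h0[e _]; rewrite /V e !mul0r.
have cut v ua' a' P' : continuous a' -> (forall p, T p -> ua' p = a' p) -> rdist T v ua' P' ->
    rdist (toC R @^-1` B) v (fun p => h p * a' p) (fun p => h p * P' p + a' p * 'D_v h p).
  move=> ca' ea' d; have hv p : ~ inn T r p -> h p = 0 /\ 'D_v h p = 0 by move=> /h0[-> ->].
  exact: (rdist_cut _ r0 ca' ea' sh hv d).
have dX : distr_derivative B (1, 0) V X.
  apply/distr_rdist; split.
  - have := cut _ _ _ _ ca ea dxr; congr (rdist _ _ _ _); apply/funext => p;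
    by rewrite /V /X /= toCK.
  - have := cut _ _ _ _ cb eb dxi; congr (rdist _ _ _ _); apply/funext => p;
    by rewrite /V /X /= toCK.
have dY : distr_derivative B (0, 1) V Y.
  apply/distr_rdist; split.
  - have := cut _ _ _ _ ca ea dyr; congr (rdist _ _ _ _); apply/funext => p;
    by rewrite /V /Y /= toCK.
  - have := cut _ _ _ _ cb eb dyi; congr (rdist _ _ _ _); apply/funext => p;
    by rewrite /V /Y /= toCK.
have db : is_dbar B V (dbar_of X Y) by exists X, Y.
exists V, (dbar_of X Y); split => //; last first.
  move=> p; rewrite -[LHS]frCK; congr (toC R _).
  rewrite /frC dbar_Re dbar_Im /X /Y /= toCK.
  by move: ('D_(1, 0) h p) ('D_(0, 1) h p) => d1 d2; congr pair; ring.
split; last by exists (dbar_of X Y).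
- by rewrite /V toCK ha hb.
- exact: continuous_subspaceT.
- split.
    move=> c; rewrite -[c]frCK; move: (frC c) => p /hB[q Tq qp] S S0.
    have hp : \forall x \near p, V (toC R x) = 0.
      apply/nbhs_ballP; exists (r - `|q - p|); first by rewrite /= subr_gt0.
      move=> x; rewrite -ball_normE /= => px; apply: V0; rewrite toCK => hx; apply: Tq; apply: hx.
      by have := ler_normD (q - p) (p - x); rewrite addrA subrK; lra.
    have /nbhs_toC hq : nbhs p (toC R @^-1` [set c | V c = 0]) by exact: hp.
    apply: filterS hq => c' /= -> _; exact: nbhs_singleton.
  move=> e e0; exists (2 * D); split; first exact: num_real.
  move=> M DM c Bc Mc; have Vc0 : V c = 0.
    apply: V0 => /(inn_sub r0)/hD; rewrite frCK => /(_ Bc).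
    by have := normc_le_norm (frC c); rewrite frCK; lra.
  by rewrite Vc0 Normc.normc0; apply: mulr_ge0; [exact: ltW|exact: sqr_ge0].
Qed.

(** At distance 4^-k the field is of size k 4^-k and the cutoff has slope 4^k / (k S): the factors
    cancel up to (2k + 1)/k <= 3, the same at every scale. *)
Lemma gradient_gain (C1 C2 M S x y : R) (k : nat) : 0 <= C1 -> 0 <= C2 -> 0 <= M -> 0 < S -> (0 < k)%N ->
  `|x| <= C1 * (2 * M) * (2 * k).+1%:R / 2 ^+ (2 * k) -> `|y| <= C2 * 2 ^+ (2 * k) / k%:R / S ->
  `|x * y| <= 6 * C1 * C2 * M / S.
Proof.
move=> C10 C20 M0 S0 k0 hx hy; rewrite normrM.
have k0' : 0 < k%:R :> R by rewrite ltr0n.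
have e0 : 0 < 2 ^+ (2 * k) :> R by rewrite exprn_gt0.
apply: le_trans (ler_pM (normr_ge0 _) (normr_ge0 _) hx hy) _.
have Ek : (2 * k).+1%:R = 2 * k%:R + 1 :> R by rewrite -natr1 natrM.
have k1 : 1 <= k%:R :> R by rewrite ler1n.
rewrite Ek; move: (k%:R) (2 ^+ (2 * k)) k0' e0 k1 => K E K0 E0 K1.
rewrite (_ : C1 * (2 * M) * (2 * K + 1) / E * (C2 * E / K / S) =
  (2 * C1 * C2 * M / S) * ((2 * K + 1) / K)); last by field; rewrite !gt_eqF.
rewrite (_ : 6 * C1 * C2 * M / S = (2 * C1 * C2 * M / S) * 3); last by field; rewrite gt_eqF.
apply: ler_wpM2l; first by rewrite !mulr_ge0 ?invr_ge0 ?(ltW S0).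
by rewrite ler_pdivrMr//; lra.
Qed.

Lemma vec_bound (x1 y1 x2 y2 e : R) : `|x1| <= e -> `|y1| <= e -> `|x2| <= e -> `|y2| <= e ->
  Normc.normc (toC R (2^-1 * (x1 - y2), 2^-1 * (x2 + y1))) <= 2 * e.
Proof.
move=> h1 h2 h3 h4; apply: le_trans (normc_le_norm _) _; rewrite prod_normE /=.
rewrite ler_pM2l// ge_max !normrM ger0_norm ?invr_ge0//.
have := ler_normB x1 y2; have := ler_normD x2 y1.
by move=> ? ?; apply/andP; split; lra.
Qed.

Lemma normc_affine (c : R[i]^o) (t x y : R) : 0 <= t <= 1 ->
  Normc.normc (toC R (t * complex.Re c + x, t * complex.Im c + y)) <=
  Normc.normc c + Normc.normc (toC R (x, y)).
Proof.
move=> /andP[t0 t1].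
have -> : toC R (t * complex.Re c + x, t * complex.Im c + y) =
    ((t%:C)%C * c : R[i]) + toC R (x, y) :> R[i].
  by case: c => u v; rewrite /toC /=; congr Complex; rewrite ?mul0r ?subr0 ?addr0.
apply: le_trans (le_normcD _ _) _; rewrite lerD2r Normc.normcM.
rewrite [Normc.normc _%:C%C](_ : _ = t); last first.
  by rewrite /= expr0n addr0 sqrtr_sqr ger0_norm.
by rewrite ler_piMl// normc_ge0.
Qed.

(** [A] and [B] enter asymmetrically so that the lemma can be used in both directions. Of the size
    of the domains only that of their intersection matters, and [C] is fixed by [D] and [d] before
    them. *)
Lemma transplant (D d : R) : 0 <= D -> 0 < d -> exists2 C : R, 0 <= C &
  forall A B w z1 z2 m l M, open A -> (0 < m)%N -> (0 < l)%N ->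
  inn (toC R @^-1` A) (2 ^+ (2 * m))^-1 w ->
  (forall p, A (toC R p) -> B (toC R p) -> `|p - w| <= D) ->
  ~ A (toC R z1) -> ~ A (toC R z2) -> `|z1 - w| <= D -> `|z2 - w| <= D -> d <= `|z2 - z1| ->
  (forall p, boundary B (toC R p) ->
     exists2 q, ~ A (toC R q) & `|q - p| < (2 ^+ (2 * (m + l)))^-1) ->
  0 <= M -> (teichmuller_density A (toC R w) < M%:E)%E ->
  (teichmuller_density B (toC R w) <= (M * (1 + C / harm R m l))%:E)%E.
Proof.
move=> D0 d0; have D1 : 0 <= D + 1 by rewrite addr_ge0.
have [C1 C10 hC1] := log_lipschitz D1 d0.
have [C2 C20 hC2] := cutoff_exists R.
exists (12 * C1 * C2); first by rewrite !mulr_ge0.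
move=> A B w z1 z2 m l M oA m0 l0 iw AB A1 A2 z1D z2D dz hB M0.
move=> /ereal_inf_lt[_ [V [F [[Vw cV vV _] dF ->]]]] /ltW LF.
have [ca cb] := zext_cont oA cV vV.1; have [qa qb] := zext_subq vV.
have wA := zext_weakA ca cb M0 dF LF.
have wC : weakC (2 * M) (zre A V) (zim A V).
  apply: rado wA => //; first by rewrite mulr_ge0.
  by move=> p Ap; rewrite zre0 ?zim0.
have [h [sh h01 h1 h0 hD]] := hC2 (toC R @^-1` A) m l m0 l0.
have S0 := harm_gt0 R m0 l0.
have r0 n : 0 < (2 ^+ n)^-1 :> R by rewrite invr_gt0 exprn_gt0.
have Aw : A (toC R w) := inn_sub (r0 _) iw.
have [Vx [Vy [dX dY EF]]] := dF.
have [dxr dxi] := (distr_rdist _ _ _ _).1 dX; have [dyr dyi] := (distr_rdist _ _ _ _).1 dY.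
have bnd p : A (toC R p) -> B (toC R p) -> `|p| <= D + `|w|.
  by move=> Ap Bp; have := AB p Ap Bp; have := ler_normD (p - w) w; rewrite subrK; lra.
have ea p : A (toC R p) -> complex.Re (V (toC R p)) = zre A V p by move=> Ap; rewrite zreE.
have eb p : A (toC R p) -> complex.Im (V (toC R p)) = zim A V p by move=> Ap; rewrite zimE.
have ha : h w * zre A V w = 1 by rewrite h1// zreE// Vw mul1r.
have hb : h w * zim A V w = 0 by rewrite h1// zimE// Vw mul1r.
have [V' [F' [tV' dF' EF']]] :=
  cut_family (r0 _) ca cb ea eb sh h0 dxr dxi dyr dyi hB bnd ha hb.
have key p : A (toC R p) -> B (toC R p) ->
    Normc.normc (toC R (2^-1 * (zre A V p * 'D_(1, 0) h p - zim A V p * 'D_(0, 1) h p),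
      2^-1 * (zim A V p * 'D_(1, 0) h p + zre A V p * 'D_(0, 1) h p))) <=
    12 * C1 * C2 * M / harm R m l.
  (* Where the cutoff varies at scale 4^-k there is a zero [q] of the extended field at that
     distance, and the log-Lipschitz estimate between [p] and [q] bounds the field at [p]. As [q]
     may lie outside both domains, it is used with radius D + 1. *)
  move=> Ap Bp; have pD := AB p Ap Bp; have [z|[k [k0 /innN[q Aq qp] g1 g2]]] := hD p.
    by rewrite !z !mulr0 subrr addr0 mulr0 Normc.normc0 !mulr_ge0 ?invr_ge0 ?(ltW S0).
  have q1 : `|q - p| <= 1.
    by apply: le_trans (ltW qp) _; rewrite invf_le1 ?exprn_gt0// exprn_ege1// ler1n.
  have zz : [/\ zre A V z1 = 0, zim A V z1 = 0, zre A V z2 = 0 & zim A V z2 = 0].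
    by rewrite !zre0 ?zim0.
  have le1 (x : R) : x <= D -> x <= D + 1 by move=> /le_trans; apply; rewrite lerDl.
  have qD : `|q - w| <= D + 1.
    have := ler_normD (q - p) (p - w); rewrite addrA subrK => /le_trans; apply.
    by rewrite addrC; exact: lerD.
  have pq : `|p - q| <= (2 ^+ (2 * k))^-1 by rewrite distrC ltW.
  have M2 : 0 <= 2 * M by rewrite mulr_ge0.
  have [] := hC1 _ _ _ _ _ _ M2 ca cb wC qa qb (le1 _ z1D) (le1 _ z2D) dz zz _ _ _ (le1 _ pD) qD pq.
  rewrite (zre0 V Aq) (zim0 V Aq) !subr0 => a1 b1.
  have e1 := gradient_gain C10 C20 M0 S0 k0 a1 g1.
  have e2 := gradient_gain C10 C20 M0 S0 k0 a1 g2.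
  have e3 := gradient_gain C10 C20 M0 S0 k0 b1 g1.
  have e4 := gradient_gain C10 C20 M0 S0 k0 b1 g2.
  rewrite (_ : 12 * C1 * C2 * M / harm R m l = 2 * (6 * C1 * C2 * M / harm R m l)).
    exact: (vec_bound e1 e2 e3 e4).
  by rewrite !mulrA -natrM.
have c0 : 0 <= M * (1 + 12 * C1 * C2 / harm R m l).
  by rewrite mulr_ge0// addr_ge0// !mulr_ge0 ?invr_ge0 ?(ltW S0).
apply: (@le_trans _ _ (Linf_norm B F')); first by apply: ereal_inf_lbound; exists V', F'.
apply/(Linf_leP B F' c0); apply: ae_imp ((Linf_leP A F M0).1 LF) => p hF Bp.
(* Outside [A] nothing is known of [F], but there the cutoff and its derivatives vanish. *)
rewrite EF'; have [Ap|Ap] := pselect (A (toC R p)); last first.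
  have [|e1 e2] := h0 p; first by move=> /(inn_sub (r0 _)).
  by rewrite e1 !e2 !mulr0 !mul0r subrr !addr0 !mulr0 !addr0 Normc.normc0.
rewrite -(dbar_Re Vx Vy) -(dbar_Im Vx Vy) -EF.
apply: le_trans (normc_affine _ _ _ (h01 p)) _.
rewrite [M * _]mulrDr [M * 1]mulr1; apply: lerD; first exact: hF.
by apply: le_trans (key p Ap Bp) _; rewrite !mulrA -!(mulrC M) !mulrA.
Qed.

End density_transplant.

(** * An a priori bound for the density *)

Section apriori.
Variable R : realType.
Implicit Types (A B : set R[i]^o) (T L : set (R * R)) (p q z w v : R * R) (V F : R[i]^o -> R[i]^o).
Implicit Types (r M : R) (P f g h phi : R * R -> R).

Lemma rdist_cst T v (c : R) : rdist T v (cst c) (cst 0).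
Proof.
split; first by move=> L cL _; exact: integrable0.
move=> phi tphi; have [r [sphi hr]] := rtest_csm tphi; have [_ [L [cL LT p0]]] := tphi.
rewrite !int_off; last 2 first.
- by move=> p _; rewrite mul0r.
- by move=> p Tp; rewrite (supp_compact_derive v cL p0) ?mulr0// => /LT.
rewrite I2Z; last exact: (csm_bcs (csmD v (conj sphi hr))).
rewrite (int_D v sphi hr) mulr0 (_ : (fun p => cst 0 p * phi p) = cst 0).
  by rewrite [I2 _](_ : _ = 0) ?oppr0// /I2 /Rintegral integral0_eq.
by apply/funext => p; rewrite /= mul0r.
Qed.

Lemma boundary_open A c : open A -> boundary A c -> ~ A c.
Proof. by move=> oA [_ nA] Ac; apply: nA; exact: open_nbhs_nbhs. Qed.

(** The competitor is the constant field 1 cut off inside a square about [w], so the bound depends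
    only on the size of the square. *)
Lemma density_apriori n : exists2 C : R, 0 <= C & forall A w, open A ->
  inn (toC R @^-1` A) (2 ^+ n)^-1 w -> (teichmuller_density A (toC R w) <= C%:E)%E.
Proof.
have [C C0 hC] := soft_exists R; exists (2 * (C * 2 ^+ n)).
  by rewrite !mulr_ge0// exprn_ge0.
move=> A w oA iw; pose T : set (R * R) := [set q | `|q - w| < (2 ^+ n)^-1].
have TA p : T p -> A (toC R p) := iw p.
have r0 k : 0 < (2 ^+ k)^-1 :> R by rewrite invr_gt0 exprn_gt0.
have [s [ss s01 s1 s0 sD]] := hC T n.
have sw : s w = 1 by have [] := s1 w.
have bA p : boundary A (toC R p) -> exists2 q, ~ T q & `|q - p| < (2 ^+ n.+1)^-1.
  by move=> /(boundary_open oA) nA; exists p; [move=> /TA|rewrite subrr normr0].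
have bT p : T p -> A (toC R p) -> `|p| <= (2 ^+ n)^-1 + `|w|.
  by move=> Tp _; have := ler_normD (p - w) w; move: Tp; rewrite /T /= subrK; lra.
have h1 : s w * cst 1 w = 1 by rewrite sw mul1r.
have h2 : s w * cst 0 w = 0 by rewrite mulr0.
have cc (c : R) : continuous (cst c : R * R -> R) by move=> p; exact: cvg_cst.
have [V [F [tV dF EF]]] := cut_family (r0 n.+1) (cc 1) (cc 0) (fun _ _ => erefl) (fun _ _ => erefl)
  ss s0 (rdist_cst T (1, 0) 1) (rdist_cst T (1, 0) 0) (rdist_cst T (0, 1) 1) (rdist_cst T (0, 1) 0)
  bA bT h1 h2.
have c0 : 0 <= 2 * (C * 2 ^+ n) by rewrite !mulr_ge0// exprn_ge0.
apply: (@le_trans _ _ (Linf_norm A F)); first by apply: ereal_inf_lbound; exists V, F.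
apply/(Linf_leP A F c0); apply: (@ae_imp R setT); last first.
  by exists set0; split => // p; apply.
move=> p _ _; rewrite EF /= subr0 addr0 !mulr0 !add0r.
have [g1 g2] := sD p.
by apply: vec_bound; rewrite ?mul1r ?mul0r ?normr0// mulr_ge0// exprn_ge0.
Qed.

End apriori.

(** * Boundaries and distances *)

Section geometry.
Variable R : realType.
Implicit Types (A B K U W : set R[i]^o) (T L : set (R * R)) (p q z w v : R * R) (r : R).

(** The exit time is the infimum of the times spent outside [A]; openness makes it positive and
    attained. *)
Lemma ray_exit A w v (T : R) : open A -> A (toC R w) -> 0 <= T -> ~ A (toC R (w + T *: v)) ->
  exists t, [/\ 0 < t, t <= T, boundary A (toC R (w + t *: v)) &
    forall s, 0 <= s -> s < t -> A (toC R (w + s *: v))].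
Proof.
move=> oA Aw T0 AT; pose g (t : R) := w + t *: v.
have cg : continuous g.
  by move=> t; apply: cvgD; [exact: cvg_cst|apply: cvgZr_tmp; exact: cvg_id].
have oG : open (g @^-1` (toC R @^-1` A)).
  by apply: open_comp => [t _|]; [exact: cg|exact: open_toC].
pose S := [set t : R | 0 <= t <= T /\ ~ A (toC R (g t))].
have ST : S T by split => //; rewrite T0 lexx.
have lS : lbound S 0 by move=> t [/andP[]].
have hS : has_inf S by split; [exists T|exists 0].
have i0 : 0 <= inf S by apply: lb_le_inf => //; exists T.
have iT : inf S <= T by apply: ge_inf => //; exists 0.
have inS : ~ A (toC R (g (inf S))).
  move=> Ai; have /nbhs_ballP[e /= e0 he] := open_nbhs_nbhs (conj oG Ai).
  have [t St ti] := inf_adherent e0 hS; apply: St.2; apply: he.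
  have it : inf S <= t by apply: ge_inf => //; exists 0.
  by rewrite -ball_normE /= ltr_norml; apply/andP; split; lra.
have below s : 0 <= s -> s < inf S -> A (toC R (g s)).
  move=> s0 si; apply: contrapT => nA.
  have : inf S <= s.
    apply: ge_inf; first by exists 0.
    by split=> //; rewrite s0 (le_trans (ltW si)).
  by rewrite leNgt si.
have g0 : g 0 = w by rewrite /g scale0r addr0.
have i0' : 0 < inf S.
  by rewrite lt_neqAle i0 andbT; apply/eqP => e; apply: inS; rewrite -e g0.
exists (inf S); split => //; split; last by move=> /interior_subset.
move=> N /nbhs_toC hN; have /nbhs_ballP[e /= e0 he] := cg (inf S) _ hN.
pose s := Num.max 0 (inf S - e / 2).
have sS : s < inf S by rewrite gt_max i0' /=; lra.
exists (toC R (g s)); split; first by apply: below => //; rewrite le_max lexx.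
apply: he; rewrite -ball_normE /= ger0_norm ?subr_ge0 ?(ltW sS)//.
have : inf S - e / 2 <= s by rewrite le_max lexx orbT.
by lra.
Qed.

Lemma inn_boundary A w r : open A -> A (toC R w) ->
  (forall p, boundary A (toC R p) -> r <= `|p - w|) -> inn (toC R @^-1` A) r w.
Proof.
move=> oA Aw hr q qr; apply: contrapT => Aq.
have [|t [t0 t1 /hr]] := ray_exit (T := 1) (v := q - w) oA Aw ler01.
  by rewrite scale1r addrC subrK.
rewrite addrAC subrr add0r normrZ gtr0_norm// => h _.
suff : `|q - w| < `|q - w| by rewrite ltxx.
apply: (lt_le_trans qr); apply: (le_trans h).
by rewrite ler_piMl.
Qed.

Lemma bounded_plane U : bounded_set U -> exists M : R, forall p, U (toC R p) -> Normc.normc (toC R p) <= M.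
Proof.
move=> [M [Mr h]]; exists (complex.Re (M + 1)) => p Up.
have hM : M < M + 1 by rewrite ltrDl ltr01.
have : `|toC R p| <= M + 1 := h _ hM _ Up.
by rewrite lecE => /andP[_].
Qed.

Lemma set_dist_le A B z w : A (toC R z) -> B (toC R w) ->
  (set_dist A B <= (Normc.normc (toC R (z - w)))%:E)%E.
Proof.
move=> Az Bw; apply: ereal_inf_lbound; exists (toC R z) => //; exists (toC R w) => //.
Qed.

Lemma diam_ge A z w : A (toC R z) -> A (toC R w) ->
  ((Normc.normc (toC R (z - w)))%:E <= diam A)%E.
Proof.
move=> Az Aw; apply: ereal_sup_ubound; exists (toC R z) => //; exists (toC R w) => //.
Qed.

Lemma normc_horizontal w (t : R) : Normc.normc (toC R (w + t *: (1, 0) - w)) = `|t|.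
Proof.
rewrite addrAC subrr add0r normC_sq /= [t *: _]mulr1 [t *: _]mulr0 expr0n addr0.
exact: sqrtr_sqr.
Qed.

Lemma norm_horizontal w (t : R) : `|w + t *: (1, 0) - w| = `|t|.
Proof. by rewrite addrAC subrr add0r normrZ prod_normE /= normr1 normr0 max_l ?mulr1. Qed.

Lemma compact_inner K U : compact K -> open U -> K `<=` U ->
  exists2 e : R, 0 < e & forall p q, K (toC R p) -> `|q - p| < e -> U (toC R q).
Proof.
move=> cK oU KU; have cK' := compact_toC cK.
have := @compact_near_coveringP (R * R)%type (toC R @^-1` K).
move=> [/(_ cK') H _].
have hn : \forall e \near (0 : R)^'+, (toC R @^-1` K) `<=`
    (fun p => forall q, `|q - p| < e -> U (toC R q)).
  apply: H => p Kp.
  have /nbhs_ballP[e /= e0 he] := open_nbhs_nbhs (conj (open_toC oU) (KU _ Kp)).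
  have e2 : 0 < e / 2 by rewrite divr_gt0.
  exists ([set z | `|p - z| < e / 2], [set t | t < e / 2]) => /=.
    split; first by apply/nbhs_ballP; exists (e / 2) => //= z; rewrite -ball_normE.
    exact: nbhs_right_lt.
  move=> [x y] [/= px yx] q qx; apply: he.
  rewrite -ball_normE /=; have := ler_normD (p - x) (x - q); rewrite addrA subrK.
  by rewrite (distrC x q); lra.
have [e [e0 he]] : exists e : R, 0 < e /\ forall p, K (toC R p) ->
    forall q, `|q - p| < e -> U (toC R q).
  near (0 : R)^'+ => e; exists e; split => //; near: e; exact: hn.
by exists e => // p q Kp; exact: he.
Unshelve. all: by end_near. Qed.

(** The infimum in the Hausdorff distance need not be attained, whence 2e in place of e. *)
Lemma hausdorff_near (A B : set R[i]^o) (e : R) : 0 < e -> (hausdorff_dist A B <= e%:E)%E ->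
  (forall p, A (toC R p) -> exists2 q, B (toC R q) & `|q - p| < 2 * e) /\
  (forall p, B (toC R p) -> exists2 q, A (toC R q) & `|q - p| < 2 * e).
Proof.
move=> e0 h; have : (hausdorff_dist A B < (2 * e)%:E)%E.
  by apply: le_lt_trans h _; rewrite lte_fin; lra.
move=> /ereal_inf_lt[_ [r [r0 AB BA] <-]]; rewrite lte_fin => re.
have H (S T : set R[i]^o) p : S `<=` nbhd r T -> S (toC R p) ->
    exists2 q, T (toC R q) & `|q - p| < 2 * e.
  move=> ST /ST /ereal_inf_lt[_ [_ -> [c Tc <-]]]; rewrite lte_fin => hr.
  exists (frC c); first by rewrite frCK.
  apply: le_lt_trans (lt_trans hr re); rewrite distrC; apply: le_trans (norm_le_normc _) _.
  by rewrite -toCB frCK.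
by split=> p; exact: H.
Qed.

End geometry.

(** * Harmonic sums, the choice of scales, and the passage to differences *)

Section conclusion.
Variable R : realType.
Implicit Types (A B K U W : set R[i]^o) (T L : set (R * R)) (p q z w v : R * R) (r : R).

(** Telescoping ln((k + 1)/k) <= 1/k. *)
Lemma harm_ge_ln m l : (0 < m)%N -> ln ((m + l)%:R / m%:R) <= harm R m l.
Proof.
elim: l m => [|l IH] m m0; have m0' : 0 < m%:R :> R by rewrite ltr0n.
  by rewrite addn0 divff ?gt_eqF// ln1 /harm big_nil.
rewrite /harm /= big_cons -/(harm R m.+1 l).
have s0 : 0 < m.+1%:R :> R by rewrite ltr0n.
rewrite (_ : (m + l.+1)%:R / m%:R = (m.+1%:R / m%:R) * ((m.+1 + l)%:R / m.+1%:R)); last first.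
  rewrite addSnnS; move: (m + l.+1)%:R m.+1%:R m%:R s0 m0' => x s t s0 t0.
  by field; rewrite !gt_eqF.
rewrite lnM ?posrE ?divr_gt0 ?ltr0n//.
apply: lerD; last exact: IH.
rewrite -natr1 mulrDl divff ?gt_eqF// mul1r; apply: le_ln1Dx.
by apply: lt_trans (_ : -1 < 0) _; rewrite ?ltrN10// invr_gt0.
Qed.

Lemma scale_choice m : (0 < m)%N -> exists2 e1 : R, 0 < e1 & forall e : R, 0 < e -> e < e1 ->
  exists l, [/\ (0 < l)%N, 2 * e <= (2 ^+ (2 * (m + l)))^-1, 0 < ln (ln (1 / e)) &
    (harm R m l)^-1 <= 2 / ln (ln (1 / e))].
Proof.
(* With X = ln(1/e) this says X > 64 m^2, so that X/(8m) is at least the square root of X and its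
   logarithm at least half of ln X. *)
move=> m0; exists (expR (- (64 * m%:R ^+ 2))); first exact: expR_gt0.
move=> e e0 he; set X := ln (1 / e).
have eX : e = expR (- X) by rewrite /X div1r lnV ?posrE// opprK lnK ?posrE.
have X1 : 64 * m%:R ^+ 2 < X by move: he; rewrite eX ltr_expR ltrN2.
have m1 : 1 <= m%:R :> R by rewrite ler1n.
have mm : m%:R <= m%:R ^+ 2 :> R by rewrite expr2 ler_peMl// ler0n.
have X0 : 0 <= X / 4 by lra.
(* The last scale N = m + l is the integer part of X/4: then 2 * 4^N <= exp(2N + 1) <= exp X, while
   N >= X/8 keeps the harmonic sum large. *)
have /andP[N1 N2] := truncn_itv X0; move: (Num.trunc _) N1 N2 => N; rewrite -[N.+1%:R]natr1 => N1 N2.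
have mN : (m < N)%N by rewrite -(ltr_nat R); lra.
have l0 : (0 < N - m)%N by rewrite subn_gt0.
have S0 := harm_gt0 R m0 l0.
exists (N - m)%N; split => //.
- rewrite subnKC ?(ltnW mN)// -[leLHS]invrK lef_pV2 ?posrE ?invr_gt0 ?mulr_gt0 ?exprn_gt0//.
  have e2 : 2 <= expR 1 :> R by have := expR_ge1Dx (1 : R).
  rewrite invfM ler_pdivlMl// -exprS eX -expRN opprK.
  apply: le_trans (_ : expR 1 ^+ (2 * N).+1 <= _); first by rewrite ler_pXn2r ?nnegrE ?expR_ge0.
  rewrite -expRM_natl mulr1 ler_expR -[(2 * N).+1%:R]natr1 natrM; lra.
- by apply: ln_gt0; lra.
- have L0 : 0 < ln X by apply: ln_gt0; lra.
  rewrite -[leRHS]invrK lef_pV2 ?posrE ?invr_gt0 ?divr_gt0// invf_div.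
  have := harm_ge_ln (N - m) m0; rewrite subnKC ?(ltnW mN)//; apply: le_trans.
  have NX : X / (8 * m%:R) <= N%:R / m%:R.
    rewrite invfM mulrA ler_pM2r ?invr_gt0 ?ltr0n//.
    by lra.
  have p0 : 0 < X / (8 * m%:R) by rewrite divr_gt0 ?mulr_gt0 ?ltr0n//; lra.
  apply: le_trans (_ : ln (X / (8 * m%:R)) <= _); last first.
    by rewrite ler_ln ?posrE//; apply: lt_le_trans NX.
  rewrite ler_pdivrMr// [_ * 2]mulr_natr -lnXn// ler_ln ?posrE ?exprn_gt0//; last lra.
  rewrite expr_div_n ler_pdivlMr ?exprn_gt0 ?mulr_gt0 ?ltr0n//.
  rewrite [leRHS]expr2 ler_pM2l; last lra.
  by rewrite exprMn; lra.
Qed.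

(** The a priori bound [C] excludes infinite values and turns the relative error [c] into an
    absolute one. The strict inequalities reflect that an infimum need not be attained. *)
Lemma comparison (x y : \bar R) (C c : R) : 0 <= c -> (0 <= x)%E -> (0 <= y)%E ->
  (x <= C%:E)%E -> (y <= C%:E)%E ->
  (forall M : R, 0 <= M -> (x < M%:E)%E -> (y <= (M * (1 + c))%:E)%E) ->
  (forall M : R, 0 <= M -> (y < M%:E)%E -> (x <= (M * (1 + c))%:E)%E) ->
  (`|x - y| <= (C * c)%:E)%E.
Proof.
move=> c0; case: x => [x| |] //; case: y => [y| |] //.
rewrite !lee_fin => x0 y0 xC yC h1 h2.
have H (s t : R) : 0 <= s -> (forall M : R, 0 <= M -> (s%:E < M%:E)%E -> (t%:E <= (M * (1 + c))%:E)%E) ->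
    t <= s * (1 + c).
  move=> s0 h; apply/ler_addgt0Pr => e e0; have c1 : 0 < 1 + c by lra.
  have d0 : 0 < e / (1 + c) by rewrite divr_gt0.
  have := h (s + e / (1 + c)); rewrite lte_fin lee_fin ltrDl d0 addr_ge0 ?(ltW d0)// => /(_ isT isT).
  by rewrite mulrDl divfK ?gt_eqF.
have := H _ _ x0 h1; have := H _ _ y0 h2; rewrite !mulrDr !mulr1 => h3 h4.
have := ler_wpM2r c0 xC; have := ler_wpM2r c0 yC => h5 h6.
by rewrite ler_norml; apply/andP; split; lra.
Qed.

Lemma density_ge0 A w : (0 <= teichmuller_density A (toC R w))%E.
Proof. by apply: le_ereal_inf_tmp => _ [V [F [_ _ ->]]]; exact: Linf_ge0. Qed.

End conclusion.

Section main.
Variable R : realType.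
Implicit Types (A B K U W : set R[i]^o) (T L : set (R * R)) (p q z w v : R * R) (r : R).

(** These are the two zeros: on opposite sides of [w], so their distance is t1 + t2, and within the
    diameter of it. *)
Lemma horizontal_exits U w (D : R) : open U -> bounded_set U -> U (toC R w) -> diam U = D%:E ->
  exists t1 t2, [/\ 0 < t1 <= D, 0 < t2 <= D, boundary U (toC R (w + t1 *: (1, 0))) &
    boundary U (toC R (w + (- t2) *: (1, 0)))].
Proof.
move=> oU /bounded_plane[M hM] Uw dU.
have far (t : R) : U (toC R (w + t *: (1, 0))) -> `|t| <= D.
  by move=> /diam_ge/(_ Uw); rewrite normc_horizontal dU lee_fin.
have D0 : 0 <= D by have := far 0; rewrite scale0r addr0 normr0; exact.
have D1 : 0 <= D + 1 by rewrite addr_ge0.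
have one (s : R) : `|s| = 1 -> exists t, 0 < t <= D /\ boundary U (toC R (w + (t * s) *: (1, 0))).
  move=> s1; have fars (t : R) : 0 <= t -> U (toC R (w + t *: (s *: (1, 0)))) -> t <= D.
    by move=> t0; rewrite scalerA => /far; rewrite normrM s1 mulr1 ger0_norm.
  have [|t [t0 tT]] := ray_exit (v := s *: (1, 0)) oU Uw D1.
    by move=> /(fars _ D1); rewrite gerDl ler10.
  rewrite scalerA => bt inU; exists t; rewrite t0; split => //; rewrite leNgt; apply/negP => Dt.
  have := fars ((D + t) / 2); rewrite divr_ge0 ?addr_ge0 ?(ltW t0)// => /(_ isT) h.
  have : (D + t) / 2 <= D by apply: h; apply: inU; lra.
  by lra.
have [t1 [h1 b1]] := one 1 (normr1 _); have [|t2 [h2 b2]] := one (- 1).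
  by rewrite normrN normr1.
by exists t1, t2; move: b1 b2; rewrite mulr1 mulrN1.
Qed.

Lemma dist_diam_finite U K w : open U -> bounded_set U -> compact K -> K `<=` U -> K (toC R w) ->
  exists d D : R, [/\ 0 < d, 0 <= D, set_dist K (boundary U) = d%:E & diam U = D%:E].
Proof.
move=> oU bU cK KU Kw; have Uw := KU _ Kw.
have [M hM] := bounded_plane bU.
have d0 : (0 <= diam U)%E.
  by apply: le_trans (diam_ge Uw Uw); rewrite lee_fin normc_ge0.
have d1 : (diam U <= (2 * M)%:E)%E.
  apply: ge_ereal_sup => _ [z Uz [z' Uz' <-]]; rewrite lee_fin.
  have := hM (frC z); have := hM (frC z'); rewrite !frCK => /(_ Uz') h1 /(_ Uz) h2.
  have := le_normcD z (- z'); rewrite normcN => h3; apply: le_trans h3 _; lra.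
have [D D0 dE] : exists2 D : R, 0 <= D & diam U = D%:E.
  by move: d0 d1; case: (diam U) => [D| |] // D0 _; exists D.
have [t1 [t2 [_ _ b1 _]]] := horizontal_exits oU bU Uw dE.
have [e e0 he] := compact_inner cK oU KU.
have l1 : (e%:E <= set_dist K (boundary U))%E.
  apply: le_ereal_inf_tmp => _ [z Kz [z' bz' <-]]; rewrite lee_fin leNgt; apply/negP => h.
  apply: (boundary_open oU bz'); rewrite -[z']frCK; apply: (he (frC z)); first by rewrite frCK.
  apply: le_lt_trans h; rewrite distrC; apply: le_trans (norm_le_normc _) _.
  by rewrite -toCB !frCK.
have l2 := set_dist_le Kw b1.
move: l1 l2; case E: (set_dist K (boundary U)) => [d| |] // l1 _.
by exists d, D; split => //; move: l1; rewrite lee_fin; exact: lt_le_trans.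
Qed.

Lemma main_real (d D : R) : 0 < d -> 0 <= D -> exists C : R, forall U K,
  domain U -> bounded_set U -> compact K -> K `<=` U ->
  set_dist K (boundary U) = d%:E -> diam U = D%:E ->
  exists eps0 : R, 0 < eps0 /\
  forall (eps : R) W, 0 < eps -> eps < eps0 -> domain W -> K `<=` W ->
    (hausdorff_dist (boundary U) (boundary W) <= eps%:E)%E ->
  forall c, K c ->
    (`| teichmuller_density U c - teichmuller_density W c | <= (C / ln (ln (1 / eps)))%:E)%E.
Proof.
move=> d0 D0; have D1 : 0 <= D + 1 by rewrite addr_ge0.
(* Passing from the modulus to the sup norm halves [d], and passing from [U] to [W] halves it again:
   both domains contain the square of half-side 4^-m about [w]. *)
have [m m0 hm] : exists2 m, (0 < m)%N & (2 ^+ (2 * m))^-1 <= d / 4.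
  have [n hn] := pow2_big (d / 4)^-1; exists n.+1 => //.
  rewrite -[leRHS]invrK lef_pV2 ?posrE ?invr_gt0 ?divr_gt0 ?exprn_gt0//; apply: hn.
  by rewrite mul2n -addnn; apply: leq_trans (leq_addr _ _).
have d2 : 0 < d / 2 by rewrite divr_gt0.
have [c c0 tr] := transplant D1 d2.
have [C0 C00 ap] := density_apriori R (2 * m).
exists (C0 * (c * 2)) => U K [oU _ _] bU cK KU dK dU.
have [e1 e10 sc] := scale_choice R m0.
(* By d/8, boundary points moved by less than 2e stay d/4 away from [w] and the two zeros stay d/2
   apart; by 1/4, the moved zeros remain within D + 1 of [w]. *)
exists (Num.min e1 (Num.min (d / 8) 4^-1)); split.
  by rewrite !lt_min e10 divr_gt0//=.
move=> e W e0; rewrite !lt_min => /and3P[ee1 ed e4] [oW _ _] KW hUW c'.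
rewrite -[c']frCK; move: (frC c') => w Kw {c'}.
have Uw := KU _ Kw; have Ww := KW _ Kw.
have [nUW nWU] := hausdorff_near e0 hUW.
have [l [l0 el L0 hl]] := sc e e0 ee1.
have bUd p : boundary U (toC R p) -> d / 2 <= `|p - w|.
  move=> bp; have := set_dist_le Kw bp; rewrite dK lee_fin => h1.
  by have := normc_le_norm (w - p); rewrite distrC; lra.
have bWd p : boundary W (toC R p) -> d / 4 <= `|p - w|.
  move=> /nWU[q /bUd h1 h2]; have := ler_normD (q - p) (p - w); rewrite addrA subrK; lra.
have iU : inn (toC R @^-1` U) (2 ^+ (2 * m))^-1 w.
  by apply: inn_boundary => // p /bUd; lra.
have iW : inn (toC R @^-1` W) (2 ^+ (2 * m))^-1 w.
  by apply: inn_boundary => // p /bWd; lra.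
have UD p : U (toC R p) -> `|p - w| <= D + 1.
  move=> Up; have := diam_ge Up Uw; rewrite dU lee_fin.
  by have := norm_le_normc (p - w); lra.
have [t1 [t2 [/andP[t10 t1D] /andP[t20 t2D] b1 b2]]] := horizontal_exits oU bU Uw dU.
set z1 := w + t1 *: (1, 0) in b1; set z2 := w + - t2 *: (1, 0) in b2.
have z1w : `|z1 - w| = t1 by rewrite norm_horizontal gtr0_norm.
have z2w : `|z2 - w| = t2 by rewrite norm_horizontal normrN gtr0_norm.
have z12 : `|z1 - z2| = t1 + t2.
  rewrite /z1 /z2 opprD addrACA subrr add0r -scalerBl opprK normrZ prod_normE /=.
  by rewrite normr1 normr0 max_l// mulr1 gtr0_norm// addr_gt0.
have h1 := bUd _ b1; have h2 := bUd _ b2.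
have [y1 bW1 zy1] := nUW _ b1; have [y2 bW2 zy2] := nUW _ b2.
have S0 := harm_gt0 R m0 l0.
have UW : (forall M : R, 0 <= M -> (teichmuller_density U (toC R w) < M%:E)%E ->
    (teichmuller_density W (toC R w) <= (M * (1 + c / harm R m l))%:E)%E).
  move=> M M0; apply: (tr U W w z1 z2 m l M) => //.
  - by move=> p Up _; exact: UD.
  - exact: boundary_open.
  - exact: boundary_open.
  - by rewrite z1w; move: t1D; clear; lra.
  - by rewrite z2w; move: t2D; clear; lra.
  - by rewrite distrC z12; move: h1 h2 d0; rewrite z1w z2w; clear; lra.
  - move=> p /nWU[q /(boundary_open oU) Uq qp]; exists q => //; exact: lt_le_trans qp el.
have WU : (forall M : R, 0 <= M -> (teichmuller_density W (toC R w) < M%:E)%E ->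
    (teichmuller_density U (toC R w) <= (M * (1 + c / harm R m l))%:E)%E).
  move=> M M0; apply: (tr W U w y1 y2 m l M) => //.
  - by move=> p _; exact: UD.
  - exact: boundary_open.
  - exact: boundary_open.
  - have := ler_normD (y1 - z1) (z1 - w); rewrite addrA subrK z1w.
    by move: zy1 t1D e4; clear; lra.
  - have := ler_normD (y2 - z2) (z2 - w); rewrite addrA subrK z2w.
    by move: zy2 t2D e4; clear; lra.
  - have := ler_normD (z1 - y1) (y1 - z2); have := ler_normD (y1 - y2) (y2 - z2).
    rewrite !addrA !subrK (distrC y1 y2) (distrC z1 y1) z12.
    by move: h1 h2 zy1 zy2 ed d0; rewrite z1w z2w; clear; lra.
  - move=> p /nUW[q /(boundary_open oW) Wq qp]; exists q => //; exact: lt_le_trans qp el.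
have cS : 0 <= c / harm R m l by rewrite divr_ge0// ltW.
apply: le_trans (comparison cS (density_ge0 U w) (density_ge0 W w) (ap U w oU iU) (ap W w oW iW) UW WU) _.
rewrite lee_fin -mulrA ler_wpM2l// -mulrA; exact: ler_wpM2l.
Qed.

End main.

(* The constant is a function of d(K, dU) and diam U only.  The inequality in
   extended reals also says that both densities are finite: with the library's
   convention +oo - +oo = -oo the left-hand side would otherwise be +oo. *)
Theorem theorem1 (R : realType) :
  exists C : \bar R -> \bar R -> R,
  forall U K : set R[i]^o,
    domain U -> bounded_set U -> compact K -> K `<=` U ->
  exists eps0 : R, 0 < eps0 /\
  forall (eps : R) (W : set R[i]^o),
    0 < eps -> eps < eps0 ->
    domain W -> K `<=` W ->
    (hausdorff_dist (boundary U) (boundary W) <= eps%:E)%E ->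
  forall w, K w ->
    (`| teichmuller_density U w - teichmuller_density W w |
      <= (C (set_dist K (boundary U)) (diam U) / ln (ln (1 / eps)))%:E)%E.
Proof.
have H (x y : \bar R) : exists C : R, forall U K : set R[i]^o,
    domain U -> bounded_set U -> compact K -> K `<=` U -> set_dist K (boundary U) = x ->
    diam U = y -> exists eps0 : R, 0 < eps0 /\
    forall (eps : R) (W : set R[i]^o), 0 < eps -> eps < eps0 -> domain W -> K `<=` W ->
      (hausdorff_dist (boundary U) (boundary W) <= eps%:E)%E ->
    forall w, K w ->
      (`| teichmuller_density U w - teichmuller_density W w | <= (C / ln (ln (1 / eps)))%:E)%E.
  (* For other values of distance and diameter the constant is the dummy 0: they cannot occur when
     [K] has a point, and when [K] is empty nothing is claimed. *)
  have [[d [D [d0 D0 -> ->]]]|no] := pselect (exists d D : R, [/\ 0 < d, 0 <= D, x = d%:E & y = D%:E]).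
    exact: main_real.
  exists 0 => U K [oU _ _] bU cK KU xE yE; exists 1; split => // eps W _ _ _ _ _ w Kw.
  exfalso; apply: no; rewrite -xE -yE; apply: (@dist_diam_finite _ _ _ (frC w)) => //.
  by rewrite frCK.
have [f hf] := choice (fun xy : \bar R * \bar R => H xy.1 xy.2).
exists (fun x y => f (x, y)) => U K dU bU cK KU.
exact: (hf (set_dist K (boundary U), diam U)).
Qed.
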